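(* Let $q\ge 2$ be an integer and let $f\colon\mathbb{D}\to\mathbb{C}$ be continuously differentiable. (i) If $f$ belongs to the class $\Psi(\Omega_{2q})$, then $\mathcal{D}_z f$, $\mathcal{D}_{\overline z} f$ and $\mathcal{D}_x f$ belong to the class $\Psi(\Omega_{2q+2})$. (ii) If $f$ belongs to the class $\Psi(\Omega_{2q})$ and all its $(2q)$-complex Schoenberg coefficients $a_{m,n}^{q-2}$ ($m,n\ge 0$) are positive, then $\mathcal{D}_z f$, $\mathcal{D}_{\overline z} f$ and $\mathcal{D}_x f$ belong to the class $\Psi^+(\Omega_{2q+2})$.
   Context: $\mathbb{D}=\{z\in\mathbb{C}: |z|\le 1\}$ is the closed unit disc. A function $f\colon\mathbb{D}\to\mathbb{C}$ is called (continuously) differentiable if, writing $z=x+iy$, it is (continuously) differentiable as a function of the real variables $x,y$ on $\mathbb{D}$; $\mathcal{D}_x f$, $\mathcal{D}_y f$ denote the partial derivatives, and the Descente operators are the Wirtinger derivatives $\mathcal{D}_z f=\frac12(\mathcal{D}_x f-i\mathcal{D}_y f)$, $\mathcal{D}_{\overline z} f=\frac12(\mathcal{D}_x f+i\mathcal{D}_y f)$. For an integer $p\ge 2$, $\Omega_{2p}$ is the unit sphere of $\mathbb{C}^p$ and $\langle\cdot,\cdot\rangle$ the usual inner product of $\mathbb{C}^p$. A continuous kernel $K\colon A\times A\to\mathbb{C}$ is positive definite if $\sum_{\mu,\nu=1}^{l}c_\mu\overline{c_\nu}K(\xi_\mu,\xi_\nu)\ge 0$ for all $l$, all $\xi_1,\dots,\xi_l\in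 A$ and all $c_1,\dots,c_l\in\mathbb{C}$; it is strictly positive definite if moreover the inequality is strict whenever the points $\xi_\mu$ are pairwise distinct and at least one $c_\mu$ is nonzero. $\Psi(\Omega_{2p})$ (resp. $\Psi^+(\Omega_{2p})$) is the class of continuous functions $f\colon\mathbb{D}\to\mathbb{C}$ such that the kernel $K(\xi,\eta)=f(\langle\xi,\eta\rangle)$ on $\Omega_{2p}\times\Omega_{2p}$ is positive definite (resp. strictly positive definite). For real $\alpha>-1$ and integers $m,n\ge 0$, the disc polynomial is $R_{m,n}^{\alpha}(z)=r^{|m-n|}e^{i(m-n)\theta}R_{\min\{m,n\}}^{(\alpha,|m-n|)}(2r^2-1)$ for $z=re^{i\theta}\in\mathbb{D}$, where $R_k^{(\alpha,\beta)}$ is the Jacobi polynomial of degree $k$ with parameters $\alpha,\beta$, normalized by $R_k^{(\alpha,\beta)}(1)=1$. Every $f\in\Psi(\Omega_{2q})$ has a unique expansion $f(z)=\sum_{m,n\ge 0}a_{m,n}^{q-2}R_{m,n}^{q-2}(z)$, $z\in\mathbb{D}$, with $a_{m,n}^{q-2}\ge 0$ and $\sum_{m,n\ge0}a_{m,n}^{q-2}<\infty$; the numbers $a_{m,n}^{q-2}$ are the $(2q)$-complex Schoenberg coefficients of $f$. *)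

(* Defs.v *)
From HB Require Import structures.
From mathcomp Require Import all_boot all_order all_algebra.
From mathcomp Require Import complex.
From mathcomp Require Import ring lra.
From mathcomp Require Import all_classical all_reals all_analysis.

Set Implicit Arguments.
Unset Strict Implicit.
Unset Printing Implicit Defensive.

Import Order.TTheory GRing.Theory Num.Theory.
Import numFieldNormedType.Exports.

Local Open Scope classical_set_scope.
Local Open Scope ring_scope.
Local Open Scope complex_scope.

(* [R[i]] itself carries no topology in the library; its regular algebra
   [R[i]^o], with the same elements, has the one given by the modulus. *)
Notation cplx R := (R[i]^o).

Section Kernels.
Variable R : realType.
Local Notation C := (cplx R).

Definition disc : set C := [set z | `|z| <= 1].

(* [dotmx u v] is the sum of the products [u 0 j * (v 0 j)^*]. *)
Definition sphere (p : nat) : set 'rV[R[i]]_p := [set xi | dotmx xi xi = 1].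

Section OnSet.
Variables (T : Type) (A : set T) (K : T -> T -> R[i]).

(* In the order of [R[i]], [0 <= z] means that [z] is real and nonnegative. *)
Definition positive_definite : Prop :=
  forall (l : nat) (xi : 'I_l -> T) (c : 'I_l -> R[i]),
    (forall mu, A (xi mu)) ->
    0 <= \sum_mu \sum_nu c mu * (c nu)^*%C * K (xi mu) (xi nu).

Definition strictly_positive_definite : Prop :=
  positive_definite /\
  forall (l : nat) (xi : 'I_l -> T) (c : 'I_l -> R[i]),
    (forall mu, A (xi mu)) -> injective xi -> (exists mu, c mu != 0) ->
    0 < \sum_mu \sum_nu c mu * (c nu)^*%C * K (xi mu) (xi nu).

End OnSet.

(* Functions on the closed disc are represented by functions on the whole
   plane; only their values on [disc] matter. *)
Definition Psi (p : nat) (f : C -> C) : Prop :=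
  {within disc, continuous f} /\
  positive_definite (@sphere p) (fun xi eta => f (dotmx xi eta)).

Definition Psi_plus (p : nat) (f : C -> C) : Prop :=
  {within disc, continuous f} /\
  strictly_positive_definite (@sphere p) (fun xi eta => f (dotmx xi eta)).

End Kernels.

Section Derivatives.
Variable R : realType.
Local Notation C := (cplx R).
Implicit Types f : C -> C.

(* [f] is differentiable at [z] as a function of two real variables, relative
   to the closed disc, with partial derivatives [d.1] in [x] and [d.2] in [y].
   At a point of the unit circle the coordinate lines may leave the disc, so
   the partial derivatives are those of the differential along the disc. *)
Definition has_partials f (z : C) (d : C * C) : Prop :=
  (f w - f z - (complex.Re (w - z))%:C * d.1 - (complex.Im (w - z))%:C * d.2)
    / (w - z) @[w --> within (disc (R := R)) z^'] --> (0 : C).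

Definition partials f (z : C) : C * C := get (has_partials f z).

Definition Dx f : C -> C := fun z => (partials f z).1.
Definition Dy f : C -> C := fun z => (partials f z).2.
Definition Dz f : C -> C := fun z => 2^-1 * (Dx f z - 'i%C * Dy f z).
Definition Dzbar f : C -> C := fun z => 2^-1 * (Dx f z + 'i%C * Dy f z).

Definition continuously_differentiable f : Prop :=
  [/\ forall z, disc z -> exists d, has_partials f z d,
      {within disc (R := R), continuous Dx f} &
      {within disc (R := R), continuous Dy f}].

(* The disc has enough directions at each of its points for the pair of
   partial derivatives to be unique, so [partials] is well defined; see [partialsE]. *)
Lemma has_partials_unique f (z : C) (d d' : C * C) :
  disc z -> has_partials f z d -> has_partials f z d' -> d = d'.
Proof.
move=> Dz0 h h'.
pose L (v : C) : C := (complex.Re v)%:C * (d'.1 - d.1)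
                + (complex.Im v)%:C * (d'.2 - d.2).
have cL : L (w - z) / (w - z) @[w --> within (disc (R := R)) z^'] --> (0 : C).
  pose G (e : C * C) (w : C) : C := (f w - f z - (complex.Re (w - z))%:C * e.1
      - (complex.Im (w - z))%:C * e.2) / (w - z).
  have -> : (fun w => L (w - z) / (w - z)) = G d \- G d'.
    by apply/funext => w; rewrite /G /L /= -mulrBl; congr (_ / _); ring.
  by rewrite -(subr0 (0 : C)); exact: (cvgB h h').
have L0 (u : C) : disc u -> L (u - z) = 0.
  move=> Du; have [->|uz] := eqVneq u z; first by rewrite subrr /L /= !mul0r addr0.
  have uz0 : u - z != 0 by rewrite subr_eq0.
  apply/eqP/contraT => Lne.
  have e0 : 0 < `|L (u - z) / (u - z)| by rewrite normr_gt0 mulf_neq0 // invr_eq0.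
  move/cvgrPdist_lt : cL => /(_ _ e0).
  rewrite !near_withinE => /nbhs_ballP[e /= egt0 near_z].
  have eE : e = (complex.Re e)%:C.
    by move: egt0; rewrite ltcE /= => /andP[/eqP i0 _]; case: (e) i0 => x y /= ->.
  have re0 : 0 < complex.Re e by rewrite -ltcR -eE.
  pose M : R := complex.Re `|u - z|.
  have ME : `|u - z| = M%:C by rewrite /M normc_def.
  have M0 : 0 < M by rewrite -ltcR -ME normr_gt0.
  pose t : R := Num.min 1 (complex.Re e / (2 * M)).
  have t0 : 0 < t by rewrite lt_min ltr01 divr_gt0 // mulr_gt0.
  have t1 : t <= 1 by rewrite ge_min lexx.
  have tM : t * M < complex.Re e.
    have : t <= complex.Re e / (2 * M) by rewrite ge_min lexx orbT.
    rewrite ler_pdivlMr ?mulr_gt0 // => ?.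
    have ? : 0 < t * M by rewrite mulr_gt0.
    lra.
  have tC0 : t%:C != 0 :> C by rewrite eq_complex /= gt_eqF.
  pose w : C := z + t%:C * (u - z).
  have wz : w - z = t%:C * (u - z) by rewrite /w addrC addKr.
  have wNz : w != z by rewrite -subr_eq0 wz mulf_neq0.
  have normt (x : R) : 0 <= x -> `|x%:C| = x%:C :> C.
    by move=> x0; rewrite normc_def /= expr0n /= addr0 sqrtr_sqr ger0_norm.
  have Dw : disc w.
    rewrite /disc /=.
    have -> : w = (1 - t)%:C * z + t%:C * u.
      by rewrite /w rmorphB rmorph1; ring.
    apply: (le_trans (ler_normD _ _)); rewrite !normrM !normt ?subr_ge0 ?(ltW t0) //.
    have -> : 1 = (1 - t)%:C + t%:C :> C by rewrite -rmorphD subrK.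
    by apply: lerD; apply: ler_piMr; rewrite // ler0c ?subr_ge0 // ltW.
  have Bw : ball z e w.
    rewrite -ball_normE /ball_ /= distrC wz normrM normt ?(ltW t0) // ME eE.
    by rewrite -rmorphM ltcR.
  have LZ : L (w - z) = t%:C * L (u - z).
    rewrite wz /L; case: (u - z) => x y; rewrite /= !mul0r subr0 addr0.
    by rewrite (rmorphM (real_complex R)) (rmorphM (real_complex R)); ring.
  have := near_z _ Bw wNz Dw.
  by rewrite sub0r normrN LZ wz -mulf_div divff // mul1r ltxx.
have D4 (x y : R) : x ^+ 2 + y ^+ 2 = 1 -> disc (x +i* y : C).
  by move=> xy; rewrite /disc /= normc_def /= xy sqrtr1.
have E (x y : R) : x ^+ 2 + y ^+ 2 = 1 ->
    (x - complex.Re z)%:C * (d'.1 - d.1) + (y - complex.Im z)%:C * (d'.2 - d.2) = 0.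
  by move=> /D4/L0; rewrite /L; case: (z).
have e1 : (d'.1 - d.1) = 0.
  have h1 := E 1 0; have h2 := E (-1) 0.
  rewrite expr0n addr0 expr1n in h1; rewrite expr0n addr0 sqrrN expr1n in h2.
  have := congr2 (fun a b => a - b) (h1 erefl) (h2 erefl).
  rewrite subrr opprD addrACA subrr addr0 -mulrBl -rmorphB.
  have -> : 1 - complex.Re z - (-1 - complex.Re z) = 2 by ring.
  by move/eqP; rewrite mulf_eq0 eq_complex /= pnatr_eq0 /= => /eqP.
have e2 : (d'.2 - d.2) = 0.
  have h1 := E 0 1; have h2 := E 0 (-1).
  rewrite expr0n add0r expr1n in h1; rewrite expr0n add0r sqrrN expr1n in h2.
  have := congr2 (fun a b => a - b) (h1 erefl) (h2 erefl).
  rewrite e1 subrr !mulr0 !add0r -mulrBl -rmorphB.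
  have -> : 1 - complex.Im z - (-1 - complex.Im z) = 2 by ring.
  by move/eqP; rewrite mulf_eq0 eq_complex /= pnatr_eq0 /= => /eqP.
move/eqP: e1; rewrite subr_eq0 => /eqP e1.
move/eqP: e2; rewrite subr_eq0 => /eqP e2.
by rewrite [d]surjective_pairing [d']surjective_pairing e1 e2.
Qed.

Lemma partialsE f (z : C) (d : C * C) :
  disc z -> has_partials f z d -> partials f z = d.
Proof.
move=> Dz0 fd; apply: (has_partials_unique Dz0 _ fd).
by rewrite /partials; apply: (@getI _ (has_partials f z) d).
Qed.

End Derivatives.

Section DiscPolynomials.
Variable R : realType.
Local Notation C := (cplx R).

Definition pochhammer (x : R) (j : nat) : R := \prod_(i < j) (x + i%:R).

(* The Jacobi polynomial divided by its value at 1, that is, the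
   hypergeometric polynomial 2F1(-k, k + alpha + beta + 1; alpha + 1; (1-x)/2). *)
Definition jacobi (alpha beta : R) (k : nat) : {poly R} :=
  \sum_(j < k.+1)
    (pochhammer (- k%:R) j * pochhammer (k%:R + alpha + beta + 1) j
      / (pochhammer (alpha + 1) j * j`!%:R)) *: (2^-1 *: (1 - 'X)) ^+ j.

(* For z = r e^(i theta), the first factor is r^|m-n| e^(i (m-n) theta);
   see [disc_poly_polar]. *)
Definition disc_poly (alpha : R) (m n : nat) (z : C) : C :=
  (if (n <= m)%N then z ^+ (m - n) else (z^*%C) ^+ (n - m)) *
  ((jacobi alpha `|m - n|%N%:R (minn m n)).[2 * complex.Re `|z| ^+ 2 - 1])%:C.

(* The expansion converges absolutely, as the disc polynomials are bounded by
   1 on the disc, so any exhaustion by finite sums gives the same value. *)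
Definition schoenberg_coeffs (q : nat) (f : C -> C) (a : nat -> nat -> R) :
    Prop :=
  [/\ forall m n, 0 <= a m n,
      summable [set: nat * nat] (fun mn => (a mn.1 mn.2)%:E) &
      forall z, disc z ->
        \sum_(m < N) \sum_(n < N) (a m n)%:C * disc_poly (q - 2)%:R m n z
          @[N --> \oo] --> f z].

Lemma jacobi_at1 (alpha beta : R) (k : nat) : (jacobi alpha beta k).[1] = 1.
Proof.
rewrite /jacobi horner_sum big_ord_recl big1 => [|i _]; last first.
  by rewrite hornerZ horner_exp !hornerE subrr ?mulr0 expr0n /= mulr0.
by rewrite /pochhammer !big_ord0 hornerZ expr0 hornerC fact0 !mulr1 addr0 divr1.
Qed.

Lemma disc_poly_polar (alpha : R) (m n : nat) (r theta : R) : 0 <= r ->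
  disc_poly alpha m n (r%:C * (cos theta +i* sin theta)) =
  (r ^+ `|m - n|%N)%:C
  * (cos ((m%:R - n%:R) * theta) +i* sin ((m%:R - n%:R) * theta))
  * ((jacobi alpha `|m - n|%N%:R (minn m n)).[2 * r ^+ 2 - 1])%:C.
Proof.
move=> r0; rewrite /disc_poly.
have -> : complex.Re `|r%:C * (cos theta +i* sin theta) : C| = r.
  rewrite normrM !normc_def -rmorphM /= cos2Dsin2 sqrtr1 mulr1 expr0n addr0.
  by rewrite sqrtr_sqr ger0_norm.
congr (_ * _). 
have moivre (k : nat) (t : R) :
    (cos t +i* sin t : C) ^+ k = cos (k%:R * t) +i* sin (k%:R * t).
  elim: k => [|k IH]; first by rewrite expr0 mul0r cos0 sin0.
  rewrite exprS IH -natr1 mulrDl mul1r addrC cosD sinD.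
  by apply/eqP; rewrite eq_complex /=; apply/andP; split; apply/eqP; ring.
case: leqP => mn.
  by rewrite exprMn moivre distnEl // natrB // rmorphXn.
have -> : (r%:C * (cos theta +i* sin theta) : C)^*%C
    = r%:C * (cos (- theta) +i* sin (- theta)).
  by rewrite cosN sinN; apply/eqP; rewrite eq_complex /=; apply/andP; split;
    apply/eqP; ring.
have -> : (m%:R - n%:R) * theta = (n - m)%:R * - theta.
  by rewrite (natrB _ (ltnW mn)); ring.
by rewrite exprMn moivre distnEr ?(ltnW mn) // rmorphXn.
Qed.

End DiscPolynomials.

(* Main.v *)
(* Write q = a + 2 and R_mn for the disc polynomials with parameter a.  As a
   combination of monomials z^c (z^* )^d, R_mn is, up to a positive constant, its own
   convolution square on the sphere of C^q; hence it is positive definite, bounded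
   by 1 on the disc, and convolution with a polynomial multiplies it by an explicit
   number.  For f in Psi(Omega_2q), the coefficients A_mn >= 0 are limits of those of
   polynomials tending to f uniformly, and the multipliers of the
   nonnegative kernel ((1 + z)(1 + z^* )/4)^N, which tend to 1, give f = sum A_mn R_mn.

   The derivative of R_mn in z is m (n + a + 1)/(a + 1) times the disc polynomial
   with parameter a + 1 and indices m - 1, n, and symmetrically in z^*.  All the
   difference quotients of Re R_mn at 1 along [0, 1] are nonnegative, so
   differentiability of f at 1 alone makes sum A_mn (c_mn + c'_mn) finite, where c_mn and
   c'_mn are these factors.  Since c_mn + c'_mn is a Lipschitz constant of R_mn, the
   expansion can be differentiated term by term on the whole disc, and the
   derivatives are nonnegative combinations of kernels that are positive definite on the
   sphere of C^(q+1).

   When all A_mn are positive, a vanishing quadratic form of the z-derivative vanishes for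
   every power z^k, hence for a polynomial equal to 1 at 1 and to 0 at all inner products
   of distinct points, which forces the weights to be 0. *)
Require Import Defs.
From HB Require Import structures.
From mathcomp Require Import all_boot all_order all_algebra.
From mathcomp Require Import complex.
From mathcomp Require Import zify ring lra.
From mathcomp Require Import all_classical all_reals all_analysis.

Set Implicit Arguments.
Unset Strict Implicit.
Unset Printing Implicit Defensive.

Import Order.TTheory GRing.Theory Num.Theory.
Import numFieldNormedType.Exports.

Local Open Scope ring_scope.

(** * Finite differences *)

(** Integrals over the sphere are replaced by averages [avg L] over explicit weighted nodes, and
    every integral formula by the statement that a difference tends to 0 as [L] grows. This suits
    the hypothesis: a double average of a positive definite kernel is literally one of the finite
    sums in its definition. The price is that the convolution formulas hold only in the limit, so
    errors are tracked uniformly in the parameters ([unull]), which permits averaging an error a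
    second time. The moments are computed only for powers of two inner products, by induction on the
    dimension; polarization, that is, replacing a vector by [u + k v] for natural [k] and comparing
    powers of [k], yields the others. What then remains of the convolution formula is an identity
    between factorials, settled by finite differences. On the boundary of the disc the coordinate
    lines may leave it. Differentiation is therefore phrased by Taylor inequalities between two
    points of the closed disc, and convexity is what allows a step to be shortened. *)

Section FiniteDifferences.
Variable K : numFieldType.

Lemma factr_neq0 n : n`!%:R != 0 :> K.
Proof. by rewrite pnatr_eq0 -lt0n fact_gt0. Qed.

(** Binomial expansion of the power [M] of [1 - E], where [E] shifts the second argument: each row
    of [G] is the difference of the previous one. To evaluate an alternating sum it suffices to
    guess the whole table [G] and to check this recursion. *)
Lemma alt_binomial_sum (G : nat -> nat -> K) :
  (forall M i, G M.+1 i = G M i - G M i.+1) ->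
  forall M i, \sum_(m < M.+1) (-1) ^+ m * 'C(M, m)%:R * G 0%N (i + m)%N = G M i.
Proof.
move=> GS; elim=> [|M IH] i.
  by rewrite big_ord_recl big_ord0 bin0 expr0 !mul1r addr0 addn0.
rewrite GS -!IH [X in _ - X]big_ord_recr big_ord_recl /= !bin0 binn.
rewrite [X in _ = X - _]big_ord_recl bin0 /= !expr0 !mulr1 !mul1r addn0.
rewrite -!addrA; congr (_ + _); rewrite opprD addrA -sumrN -big_split /=.
rewrite big_ord_recr /= !addSnnS /bump /= binn add1n exprS; congr (_ + _); last by ring.
apply: eq_bigr => m _; rewrite /bump /= add1n binS natrD exprS addSnnS; ring.
Qed.

(** By Pascal's rule a difference of binomial coefficients is one of lower order; after more than
    [D] steps a polynomial of degree [D] is annihilated. *)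
Lemma alt_binomial_sum_bin A D M :
  \sum_(m < M.+1) (-1) ^+ m * 'C(M, m)%:R * 'C(A + m, D)%:R
  = if (M <= D)%N then (-1) ^+ M * 'C(A, D - M)%:R else 0 :> K.
Proof.
pose G M i : K := if (M <= D)%N then (-1) ^+ M * 'C(A + i, D - M)%:R else 0.
rewrite -{2}(addn0 A) -/(G M 0%N) -alt_binomial_sum => [|{}M i].
  by apply: eq_bigr => m _; rewrite /G /= subn0 mul1r add0n.
rewrite /G addnS; case: (ltngtP M D) => [MD|MD|->].
- by rewrite -(subnSK MD) binS natrD exprS; ring.
- by rewrite subr0.
- by rewrite subnn !bin0 subrr.
Qed.

(** A Beta integral in disguise: up to the factor [D!], the quotient of factorials is the integral
    of [t^(A+m) (1-t)^D] over [0, 1], and the alternating sum inserts [(1-t)^M] under the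
    integral. *)
Lemma alt_binomial_sum_inv A D M :
  \sum_(m < M.+1) (-1) ^+ m * 'C(M, m)%:R
    * ((A + m)`!%:R / (A + m + D).+1`!%:R)
  = A`!%:R * (D + M)`!%:R / (D`!%:R * (A + D + M).+1`!%:R) :> K.
Proof.
pose G M i : K := (A + i)`!%:R * (D + M)`!%:R / (D`!%:R * (A + i + D + M).+1`!%:R).
have -> : A`!%:R * (D + M)`!%:R / (D`!%:R * (A + D + M).+1`!%:R) = G M 0%N.
  by rewrite /G addn0.
rewrite -alt_binomial_sum => [|{}M i].
  apply: eq_bigr => m _; rewrite /G /= !addn0 add0n; congr (_ * _).
  by rewrite invfM; field; rewrite !factr_neq0.
rewrite /G !addnS !addSn !(factS (_ + M)) !(factS (A + i)) (factS (A + i + D + M).+1) !natrM.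
have h1 := factr_neq0 (A + i + D + M).+1.
have h2 := factr_neq0 D.
have h3 : (A + i + D + M).+2%:R != 0 :> K by rewrite pnatr_eq0.
field; do !(apply/andP; split) => //; rewrite -?natrD; do ?by rewrite pnatr_eq0 ?addn_eq0 //=.
all: by move: h3; rewrite -!natr1 !natrD.
Qed.

End FiniteDifferences.

(** * Disc polynomials as sums of monomials *)

Section Zernike.
Variable R : realType.
Local Notation C := R[i].
Local Open Scope complex_scope.
Implicit Types (a m n i : nat) (z : C).

(** Coefficient of [z^(m-i) (conj z)^(n-i)] in the disc polynomial, as in the classical radial
    Zernike polynomials; meaningful for [i <= minn m n]. The formula is symmetric in [m] and [n],
    unlike the definition of the disc polynomial by cases. *)
Definition zernike a m n i : R :=
  m`!%:R * n`!%:R * a`!%:R / ((m + a)`!%:R * (n + a)`!%:R)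
  * ((-1) ^+ i * (m + n - i + a)`!%:R / (i`!%:R * (m - i)`!%:R * (n - i)`!%:R)).

Lemma pochhammer_nat (N j : nat) :
  pochhammer (N.+1%:R : R) j = (N + j)`!%:R / N`!%:R.
Proof.
rewrite /pochhammer; elim: j => [|j IH].
  by rewrite big_ord0 addn0 divff ?factr_neq0.
by rewrite big_ord_recr /= IH addnS factS natrM -natrD addSn; ring.
Qed.

Lemma pochhammer_opp (k j : nat) :
  pochhammer (- k%:R : R) j = (-1) ^+ j * 'C(k, j)%:R * j`!%:R.
Proof.
rewrite -mulrA -natrM bin_ffact /pochhammer; elim: j => [|j IH].
  by rewrite big_ord0 ffactn0 mulr1.
rewrite big_ord_recr /= IH ffactnSr natrM exprS.
have [jk|kj] := leqP j k; first by rewrite natrB //; ring.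
by rewrite ffact_small // mulr0 mul0r mul0r mulr0.
Qed.

(** The definition expands in powers of [1 - t]. Each coefficient of the expansion in powers of [t]
    is an alternating sum of binomial coefficients, evaluated by [alt_binomial_sum_bin]. *)
Lemma jacobi_zernike a d k (t : R) :
  (jacobi a%:R d%:R k).[2 * t - 1]
  = \sum_(i < k.+1) zernike a (k + d) k i * t ^+ (k - i).
Proof.
rewrite /jacobi horner_sum.
(* The hypergeometric coefficient of [(1 - t)^j], regrouped so that [j] enters only through a sign
   and two binomial coefficients. *)
pose A j : R := (-1) ^+ j * 'C(k, j)%:R * ((k + d)`!%:R * a`!%:R / (k + a + d)`!%:R)
  * 'C(k + a + d + j, k + d)%:R.
have AE (j : 'I_k.+1) :
    pochhammer (- k%:R) j * pochhammer (k%:R + a%:R + d%:R + 1) j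
      / (pochhammer (a%:R + 1) j * j`!%:R) = A j :> R.
  rewrite -!natrD !natr1 !pochhammer_nat pochhammer_opp /A.
  have -> : 'C(k + a + d + j, k + d)%:R = (k + a + d + j)`!%:R / ((k + d)`!%:R * (a + j)`!%:R) :> R.
    rewrite -(@bin_fact (k + a + d + j) (k + d)) ?natrM; last by lia.
    have -> : (k + a + d + j - (k + d) = a + j)%N by lia.
    by field; rewrite !factr_neq0.
  by field; rewrite !factr_neq0.
under eq_bigr => j _.
  rewrite hornerZ horner_exp !hornerE AE.
  have -> : 2^-1 * (1 - (2 * t - 1)) = 1 - t by field.
  have -> : (1 - t) ^+ j = \sum_(e < k.+1) 'C(j, e)%:R * (-1) ^+ e * t ^+ e.
    rewrite exprBn (big_ord_widen k.+1 (fun e => ((-1) ^+ e * 1 ^+ (j - e) * t ^+ e) *+ 'C(j, e))) ?ltn_ord //.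
    rewrite big_mkcond /=; apply: eq_bigr => e _; rewrite expr1n mulr1.
    case: ltnP => [_|je]; first by rewrite -mulr_natl mulrA.
    by rewrite bin_small // !mul0r.
  rewrite mulr_sumr; over.
rewrite exchange_big /= (reindex_inj rev_ord_inj) /=; apply: eq_bigr => i _.
rewrite subSS; set e := (k - i)%N.
have ek : (e <= k)%N by rewrite /e leq_subr.
under eq_bigr do rewrite !mulrA.
rewrite -mulr_suml; congr (_ * _).
rewrite -mulr_suml -(big_mkord xpredT (fun j => A j * 'C(j, e)%:R)).
rewrite (big_cat_nat (n := e)) ?leqW //= big_nat big1 => [|j /andP[_ je]]; last first.
  by rewrite bin_small // mulr0.
rewrite add0r -{1}[e]add0n big_addn big_mkord.
have -> : (k.+1 - e = (k - e).+1)%N by rewrite subSn.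
pose c : R := (-1) ^+ e * 'C(k, e)%:R * ((k + d)`!%:R * a`!%:R / (k + a + d)`!%:R).
have -> : \sum_(j < (k - e).+1) A (j + e)%N * 'C(j + e, e)%:R
   = c * \sum_(j < (k - e).+1) (-1) ^+ j * 'C(k - e, j)%:R * 'C(k + a + d + e + j, k + d)%:R.
  rewrite mulr_sumr; apply: eq_bigr => j _; rewrite /A /c.
  (* Choosing [j + e] out of [k] and then [e] of these amounts to choosing the [e] first and then
     [j] of the others. *)
  have h : 'C(k, j + e)%:R * 'C(j + e, e)%:R = 'C(k, e)%:R * 'C(k - e, j)%:R :> R.
    have jk : (j + e <= k)%N by have := ltn_ord j; lia.
    have B n p : (p <= n)%N -> 'C(n, p)%:R = n`!%:R / (p`!%:R * (n - p)`!%:R) :> R.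
      by move=> pn; rewrite -(bin_fact pn) !natrM; field; rewrite !factr_neq0.
    rewrite !B ?leq_addl //; last by lia.
    have -> : (j + e - e = j)%N by lia.
    have -> : (k - e - j = k - (j + e))%N by lia.
    by field; rewrite !factr_neq0.
  have -> : (k + a + d + (j + e) = k + a + d + e + j)%N by lia.
  rewrite exprD; set u := (X in _ = X); rewrite [LHS](_ : _ = (-1) ^+ e * ('C(k, j + e)%:R * 'C(j + e, e)%:R) * ((k + d)`!%:R * a`!%:R / (k + a + d)`!%:R) * ((-1) ^+ j * 'C(k + a + d + e + j, k + d)%:R)); last by ring.
  by rewrite h /u; ring.
rewrite alt_binomial_sum_bin ifT; last by lia.
rewrite /c /zernike.
have ik : (i <= k)%N by rewrite -ltnS.
have B n p r : (p + r)%N = n -> 'C(n, p)%:R = n`!%:R / (p`!%:R * r`!%:R) :> R.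
  by move=> <-; rewrite -(@bin_fact (p + r) p) ?leq_addr // addKn !natrM; field; rewrite !factr_neq0.
rewrite (B _ _ i); last by rewrite /e; lia.
rewrite (B _ _ (k + a)%N); last by rewrite /e; lia.
have -> : (k - e = i)%N by rewrite /e; lia.
have -> : (k + d - i = d + e)%N by rewrite /e; lia.
have -> : (k + d + k - i + a = k + a + d + e)%N by rewrite /e; lia.
rewrite -/e (_ : (k + d + a = k + a + d)%N); last by lia.
have s1 : (-1) ^+ e * (-1) ^+ e = 1 :> R by rewrite -exprMn mulrNN mulr1 expr1n.
set u := (X in _ = X); transitivity ((-1) ^+ e * (-1) ^+ e * u).
  by rewrite /u; field; rewrite !factr_neq0.
by rewrite s1 mul1r.
Qed.

Lemma zernikeC a m n i : zernike a m n i = zernike a n m i.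
Proof. by rewrite /zernike (addnC m n); congr (_ * _ / _ * (_ / _)); ring. Qed.

Definition monom m n z : C := z ^+ m * (z^*%C) ^+ n.

Lemma disc_poly_zernike a m n z :
  disc_poly a%:R m n z = \sum_(i < (minn m n).+1) (zernike a m n i)%:C * monom (m - i) (n - i) z.
Proof.
have sq : ((complex.Re `|z|) ^+ 2)%:C = z * z^*%C.
  by rewrite -sqr_normc normc_def -rmorphXn.
rewrite /disc_poly; case: leqP => mn.
  rewrite distnEl // jacobi_zernike subnKC //.
  rewrite rmorph_sum mulr_sumr; apply: eq_bigr => i _.
  have iN : (i <= n)%N by rewrite -ltnS.
  rewrite (rmorphM (real_complex R)) (rmorphXn (real_complex R)) /= sq /monom exprMn.
  rewrite (_ : (m - i = m - n + (n - i))%N) ?exprD; last by lia.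
  by ring.
rewrite distnEr ?(ltnW mn) // jacobi_zernike subnKC ?(ltnW mn) //.
rewrite rmorph_sum mulr_sumr; apply: eq_bigr => i _.
have iN : (i <= m)%N by rewrite -ltnS.
rewrite (rmorphM (real_complex R)) (rmorphXn (real_complex R)) /= sq /monom exprMn zernikeC.
by rewrite (_ : (n - i = n - m + (m - i))%N) ?exprD; [ring | lia].
Qed.

(* The coefficient of the monomial [monom c d] on [disc_poly a m n], up to the
   squared norm of [disc_poly a m n]. *)
Definition lambda a c d m n : R :=
  if (c + n == d + m)%N && (n <= d)%N
  then d`!%:R * c`!%:R * a.+1`!%:R / ((d - n)`!%:R * (d + m + a).+1`!%:R) else 0.

(** Comparison of coefficients of [z^(m-e) (conj z)^(n-e)] in the convolution of [monom c d] with
    the disc polynomial. All that depends on [i] reduces to ['C(e, i)] and the quotient [T] of two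
    factorials, so the sum is a difference of order [e] of [T]. *)
Lemma lambda_zernike a c d m n e :
  (c + n = d + m)%N -> (e <= minn m n)%N ->
  \sum_(i < e.+1) zernike a m n i * ('C(d, n - e)%:R * 'C(m - i, e - i)%:R
    / ('C(d + (m - i), n - i)%:R * 'C(d + (m - i) + a.+1, a.+1)%:R))
  = lambda a c d m n * zernike a m n e :> R.
Proof.
move=> cd; rewrite leq_min => /andP[em en].
have B N p r : (p + r)%N = N -> 'C(N, p)%:R = N`!%:R / (p`!%:R * r`!%:R) :> R.
  by move=> <-; rewrite -(@bin_fact (p + r) p) ?leq_addr // addKn !natrM; field; rewrite !factr_neq0.
have [dn|nd] := ltnP d (n - e)%N.
  rewrite big1 => [|i _]; last by rewrite (bin_small dn) !(mulr0, mul0r).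
  by rewrite /lambda [(n <= d)%N]leqNgt ifF ?mul0r //; apply/negbTE; lia.
pose r := (d - (n - e))%N.
pose Kc : R := m`!%:R * n`!%:R * a`!%:R / ((m + a)`!%:R * (n + a)`!%:R).
pose T j : R := (m + n + a - e + j)`!%:R / (d + m + a - e + j).+1`!%:R.
transitivity (Kc * d`!%:R * c`!%:R * a.+1`!%:R * (-1) ^+ e / ((n - e)`!%:R * (m - e)`!%:R * r`!%:R * e`!%:R)
   * \sum_(i < e.+1) (-1) ^+ i * 'C(e, i)%:R * T i).
  rewrite mulr_sumr (reindex_inj rev_ord_inj) /=; apply: eq_bigr => i _.
  have ie : (i <= e)%N by rewrite -ltnS.
  rewrite subSS /zernike -/Kc /T.
  rewrite (B d _ r); last by rewrite /r; lia.
  rewrite (B _ (e - (e - i))%N (m - e)%N); last by lia.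
  rewrite (B (d + (m - (e - i)))%N (n - (e - i))%N c); last by lia.
  rewrite (B _ a.+1 (d + (m - (e - i)))%N); last by lia.
  rewrite (B e i (e - i)%N); last by lia.
  have -> : (e - (e - i) = i)%N by lia.
  have -> : (m + n - (e - i) + a = m + n + a - e + i)%N by lia.
  have -> : (d + (m - (e - i)) + a.+1 = (d + m + a - e + i).+1)%N by lia.
  have -> : (-1) ^+ e = (-1) ^+ (e - i) * (-1) ^+ i :> R by rewrite -exprD subnK.
  have s1 : (-1) ^+ i * (-1) ^+ i = 1 :> R by rewrite -exprMn mulrNN mulr1 expr1n.
  transitivity ((-1) ^+ i * (-1) ^+ i * (Kc * d`!%:R * c`!%:R * a.+1`!%:R * (-1) ^+ (e - i) / ((n - e)`!%:R * (m - e)`!%:R * r`!%:R) * (m + n + a - e + i)`!%:R / (d + m + a - e + i).+1`!%:R / (i`!%:R * (e-i)`!%:R))).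
    rewrite s1; field; rewrite !factr_neq0 //.
  by field; rewrite !factr_neq0.
rewrite /lambda cd eqxx /=; case: ifPn => [nd'|]; last first.
  rewrite -ltnNge => dn; rewrite mul0r.
  (* For [d < n] the quotient [T] is a polynomial in [i] of degree [D < e], and its difference of
     order [e] vanishes. For [n <= d] it is the reciprocal of a polynomial, covered by
     [alt_binomial_sum_inv]. *)
  pose D := (n - d).-1.
  transitivity (Kc * d`!%:R * c`!%:R * a.+1`!%:R * (-1) ^+ e / ((n - e)`!%:R * (m - e)`!%:R * r`!%:R * e`!%:R)
   * \sum_(i < e.+1) (-1) ^+ i * 'C(e, i)%:R * (D`!%:R * 'C(m + n + a - e + i, D)%:R)).
    congr (_ * _); apply: eq_bigr => i _; congr (_ * _); rewrite /T.
    rewrite (B _ D (d + m + a - e + i).+1); last by rewrite /D; lia.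
    by field; rewrite !factr_neq0.
  under eq_bigr do rewrite (mulrCA _ D`!%:R).
  rewrite -mulr_sumr alt_binomial_sum_bin ifF ?mulr0 //; apply/negbTE; rewrite /D; lia.
pose D := (d - n)%N.
under eq_bigr => i _.
  rewrite /T (_ : (d + m + a - e + i = m + n + a - e + i + D)%N); last by rewrite /D; lia.
  over.
rewrite alt_binomial_sum_inv /zernike -/Kc -/D.
have -> : (m + n + a - e + D + e = d + m + a)%N by rewrite /D; lia.
have -> : (m + n - e + a = m + n + a - e)%N by lia.
have -> : (D + e = r)%N by rewrite /D /r; lia.
by field; rewrite !factr_neq0.
Qed.
End Zernike.

(** * Moduli and uniform limits *)

Section Modulus.
Variable R : realType.
Local Notation C := R[i].
Local Open Scope complex_scope.
Implicit Types (x y z : C) (r : R).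

Definition modulus z : R := complex.Re `|z|.
Local Notation nc := modulus.

Lemma modulusE z : `|z| = (nc z)%:C.
Proof. by rewrite /nc normc_def. Qed.

Lemma conjcM x y : (x * y)^*%C = x^*%C * y^*%C.
Proof. exact: rmorphM. Qed.

Lemma conjcD x y : (x + y)^*%C = x^*%C + y^*%C.
Proof. exact: rmorphD. Qed.

Lemma conjcB x y : (x - y)^*%C = x^*%C - y^*%C.
Proof. exact: rmorphB. Qed.

Lemma real_complex_eq0 r : (r%:C == 0 :> C) = (r == 0).
Proof. by rewrite eq_complex /= eqxx andbT. Qed.

Lemma conjcX x n : (x ^+ n)^*%C = x^*%C ^+ n.
Proof. exact: rmorphXn. Qed.

Lemma conjc_sum (I : Type) (s : seq I) (P : pred I) (F : I -> C) :
  (\sum_(i <- s | P i) F i)^*%C = \sum_(i <- s | P i) (F i)^*%C.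
Proof. exact: rmorph_sum. Qed.

Lemma modulus_ge0 z : 0 <= nc z.
Proof. by rewrite -ler0c -modulusE. Qed.

Lemma modulus0 : nc 0 = 0.
Proof. by apply: complexI; rewrite -modulusE normr0. Qed.

Lemma modulus1 : nc 1 = 1.
Proof. by apply: complexI; rewrite -modulusE normr1. Qed.

Lemma modulusM x y : nc (x * y) = nc x * nc y.
Proof. by apply: complexI; rewrite -modulusE normrM !modulusE rmorphM. Qed.

Lemma modulusX x n : nc (x ^+ n) = nc x ^+ n.
Proof. by elim: n => [|n IH]; rewrite ?expr0 ?modulus1 // !exprS modulusM IH. Qed.

Lemma modulusV x : nc x^-1 = (nc x)^-1.
Proof. by apply: complexI; rewrite -modulusE normfV modulusE fmorphV. Qed.

Lemma modulusD x y : nc (x + y) <= nc x + nc y.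
Proof. by rewrite -lecR -modulusE rmorphD /= -!modulusE ler_normD. Qed.

Lemma modulusN x : nc (- x) = nc x.
Proof. by apply: complexI; rewrite -!modulusE normrN. Qed.

Lemma modulusB x y : nc (x - y) <= nc x + nc y.
Proof. by rewrite (le_trans (modulusD _ _)) // modulusN. Qed.

Lemma modulusBC x y : nc (x - y) = nc (y - x).
Proof. by rewrite -modulusN opprB. Qed.

Lemma modulus_real r : nc r%:C = `|r|.
Proof.
apply: complexI; rewrite -modulusE normc_def /= expr0n addr0.
by rewrite sqrtr_sqr.
Qed.

Lemma modulus_conj z : nc (z^*%C) = nc z.
Proof. by apply: complexI; rewrite -!modulusE normcJ. Qed.

Lemma modulus_nat n : nc n%:R = n%:R.
Proof. by rewrite -(rmorph_nat (real_complex R)) modulus_real ger0_norm. Qed.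

Lemma modulus_eq0 z : (nc z == 0) = (z == 0).
Proof. by rewrite -[z == 0]normr_eq0 modulusE -(inj_eq (@complexI _)). Qed.

Lemma modulus_sum (I : Type) (s : seq I) (P : pred I) (F : I -> C) :
  nc (\sum_(i <- s | P i) F i) <= \sum_(i <- s | P i) nc (F i).
Proof.
elim/big_ind2 : _ => [|x r y r' h h'|//]; first by rewrite modulus0.
by rewrite (le_trans (modulusD _ _)) // lerD.
Qed.

Lemma le_modulus z r : (`|z| <= r%:C) = (nc z <= r).
Proof. by rewrite modulusE lecR. Qed.

Lemma Re_le_modulus z : `|complex.Re z| <= nc z.
Proof. by rewrite -lecR -modulusE normc_ge_Re. Qed.

Lemma Im_le_modulus z : `|complex.Im z| <= nc z.
Proof.
have -> : complex.Im z = complex.Re (- 'i * z) by case: z => u v /=; ring.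
rewrite (le_trans (Re_le_modulus _)) // modulusM modulusN.
by rewrite [nc 'i](_ : _ = 1) ?mul1r // /nc normc_def /= expr0n expr1n add0r sqrtr1.
Qed.

Lemma modulus_le_ReIm z : nc z <= `|complex.Re z| + `|complex.Im z|.
Proof.
rewrite [z in nc z]complexE (le_trans (modulusD _ _)) // modulusM !modulus_real.
by rewrite [nc 'i](_ : _ = 1) ?mul1r // /nc normc_def /= expr0n expr1n add0r sqrtr1.
Qed.

Lemma sqr_modulus z : (nc z ^+ 2)%:C = z * z^*%C.
Proof. by rewrite -sqr_normc modulusE -rmorphXn. Qed.

(** Uniform convergence to 0 on [D], kept as an explicit estimate on real moduli. The uniformity is
    what allows a parameter of an error term to be averaged or substituted later. *)
Definition unull (T : Type) (D : T -> Prop) (F : nat -> T -> C) : Prop :=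
  forall e : R, 0 < e -> exists N, forall L, (N <= L)%N ->
    forall t, D t -> nc (F L t) <= e.

Definition ubounded (T : Type) (D : T -> Prop) (F : nat -> T -> C) : Prop :=
  exists B : R, forall L t, D t -> nc (F L t) <= B.

Section Null.
Variables (T : Type) (D : T -> Prop).
Implicit Types F G H : nat -> T -> C.

Lemma unull_eventually F G :
  (exists N, forall L, (N <= L)%N -> forall t, D t -> F L t = G L t) ->
  unull D G -> unull D F.
Proof.
move=> [N FG] G0 e /G0[M GM]; exists (maxn N M) => L.
by rewrite geq_max => /andP[NL ML] t Dt; rewrite FG // GM.
Qed.

Lemma eq_unull F G : (forall L t, D t -> F L t = G L t) -> unull D G -> unull D F.
Proof. by move=> FG; apply: unull_eventually; exists 0%N => L _; exact: FG. Qed.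

Lemma unull0 : unull D (fun _ _ => 0).
Proof. by move=> e /ltW e0; exists 0%N => L _ t _; rewrite modulus0. Qed.

Lemma unullD F G : unull D F -> unull D G -> unull D (fun L t => F L t + G L t).
Proof.
move=> F0 G0 e e0; have e2 : 0 < e / 2 by rewrite divr_gt0.
have [[N FN] [M GM]] := (F0 _ e2, G0 _ e2); exists (maxn N M) => L.
rewrite geq_max => /andP[NL ML] t Dt; rewrite (le_trans (modulusD _ _)) //.
by rewrite (splitr e) lerD ?FN ?GM.
Qed.

Lemma unull_mul F G : ubounded D F -> unull D G -> unull D (fun L t => F L t * G L t).
Proof.
move=> [B FB] G0 e e0; have B0 : 0 < 1 + `|B| by rewrite ltr_pwDl.
have [N GN] := G0 _ (divr_gt0 e0 B0); exists N => L NL t Dt; rewrite modulusM.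
rewrite -(divfK (lt0r_neq0 B0) e) mulrC ler_pM ?modulus_ge0 ?GN //.
by rewrite (le_trans (FB L t Dt)) // (le_trans (ler_norm _)) // lerDr.
Qed.

Lemma unullN F : unull D F -> unull D (fun L t => - F L t).
Proof. by move=> F0 e /F0[N FN]; exists N => L NL t Dt; rewrite modulusN FN. Qed.

Lemma unullB F G : unull D F -> unull D G -> unull D (fun L t => F L t - G L t).
Proof. by move=> F0 G0; apply: unullD => //; exact: unullN. Qed.

Lemma unull_sum (I : Type) (s : seq I) (P : pred I) (F : I -> nat -> T -> C) :
  (forall i, P i -> unull D (F i)) -> unull D (fun L t => \sum_(i <- s | P i) F i L t).
Proof.
move=> F0; elim: s => [|i s IH].
  by apply: eq_unull unull0 => L t _; rewrite big_nil.
case Pi : (P i); last by apply: eq_unull IH => L t _; rewrite big_cons Pi.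
by apply: eq_unull (unullD (F0 _ Pi) IH) => L t _; rewrite big_cons Pi.
Qed.

Lemma ubounded_cst c : ubounded D (fun _ _ => c).
Proof. by exists (nc c). Qed.

Lemma uboundedM F G : ubounded D F -> ubounded D G -> ubounded D (fun L t => F L t * G L t).
Proof.
move=> [A FA] [B GB]; exists (`|A| * `|B|) => L t Dt; rewrite modulusM.
by rewrite ler_pM ?modulus_ge0 // (le_trans _ (ler_norm _)) ?FA ?GB.
Qed.

Lemma uboundedX F n : ubounded D F -> ubounded D (fun L t => F L t ^+ n).
Proof.
move=> [A FA]; exists (`|A| ^+ n) => L t Dt; rewrite modulusX.
by rewrite lerXn2r ?nnegrE ?modulus_ge0 // (le_trans _ (ler_norm _)) ?FA.
Qed.

Lemma unull_cst (c : T -> C) t : D t -> unull D (fun _ => c) -> c t = 0.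
Proof.
move=> Dt c0; apply/eqP; rewrite -modulus_eq0 eq_le modulus_ge0 andbT leNgt.
apply/negP => ct0; have [N /(_ N (leqnn _) t Dt)] := c0 _ (divr_gt0 ct0 (ltr0Sn _ 1)).
by rewrite leNgt ltr_pdivrMr // ltr_pMr // ltr1n.
Qed.

Lemma unull_comp (T' : Type) (D' : T' -> Prop) (h : T' -> T) F :
  (forall t, D' t -> D (h t)) -> unull D F -> unull D' (fun L t => F L (h t)).
Proof. by move=> DD F0 e /F0[N FN]; exists N => L NL t /DD; exact: FN. Qed.

Lemma ubounded_comp (T' : Type) (D' : T' -> Prop) (h : T' -> T) F :
  (forall t, D' t -> D (h t)) -> ubounded D F -> ubounded D' (fun L t => F L (h t)).
Proof. by move=> DD [B FB]; exists B => L t /DD; exact: FB. Qed.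

(* Evaluating at [2 t] and subtracting [2 ^+ n] times the value at [t]
   eliminates the coefficient of highest order. *)
Lemma unull_coef n (A : nat -> nat -> T -> C) :
  (forall k : nat, unull D (fun L t => \sum_(c < n.+1) k%:R ^+ c * A c L t)) ->
  forall c, (c <= n)%N -> unull D (A c).
Proof.
elim: n A => [|n IH] A A0 c.
  rewrite leqn0 => /eqP ->; apply: eq_unull (A0 0%N) => L t _.
  by rewrite big_ord1 expr0 mul1r.
pose A' c L t := ((2 ^ c)%:R - (2 ^ n.+1)%:R) * A c L t.
have A'0 c' : (c' <= n)%N -> unull D (A' c').
  apply: IH => k; apply: eq_unull (unullB (A0 (2 * k)%N) (unull_mul (ubounded_cst (2 ^ n.+1)%:R) (A0 k))).
  move=> L t _; rewrite !(big_ord_recr n.+1) /= mulrDr opprD.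
  rewrite addrACA mulr_sumr -sumrB !natrM !natrX exprMn mulrA subrr addr0.
  by apply: eq_bigr => i _; rewrite /A' !natrX exprMn; ring.
have An c' : (c' <= n)%N -> unull D (A c').
  move=> cn; apply: eq_unull (unull_mul (ubounded_cst ((2 ^ c')%:R - (2 ^ n.+1)%:R)^-1) (A'0 _ cn)).
  move=> L t _; rewrite /A' mulKf // subr_eq0 eqr_nat.
  by rewrite eqn_exp2l // neq_ltn ltnS cn.
rewrite leq_eqVlt => /orP[/eqP ->|]; last by rewrite ltnS; exact: An.
apply: eq_unull (unullB (A0 1%N) (unull_sum (index_enum 'I_n.+1) (P := xpredT) (fun (i : 'I_n.+1) _ => An i (ltn_ord i)))).
move=> L t _; rewrite big_ord_recr /=; under eq_bigr do rewrite expr1n mul1r.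
by rewrite expr1n mul1r addrAC subrr add0r.
Qed.

End Null.
End Modulus.

(** * Averages over the unit sphere *)

Section Quadrature.
Variable R : realType.
Local Notation C := R[i].
Local Notation nc := (@modulus R).
Local Open Scope complex_scope.

Definition mesh L k : R := k%:R / L.+1%:R.

Lemma mesh_ge0 L k : 0 <= mesh L k.
Proof. by rewrite divr_ge0. Qed.

Lemma mesh_le1 L (k : 'I_L.+1) : mesh L k <= 1.
Proof. by rewrite ler_pdivrMr ?ltr0Sn // mul1r ler_nat ltnW. Qed.

(** The difference of powers factors as a sum of [i.+1] products of [i] factors, each [k] or [k.+1].
    Summed over [k], both bounds squeeze a power sum by a telescoping one. *)
Lemma power_increment (k i : nat) :
  i.+1%:R * k%:R ^+ i <= k.+1%:R ^+ i.+1 - k%:R ^+ i.+1 :> R /\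
  k.+1%:R ^+ i.+1 - k%:R ^+ i.+1 <= i.+1%:R * k.+1%:R ^+ i :> R.
Proof.
have kk : k%:R <= k.+1%:R :> R by rewrite ler_nat.
have cst (c : R) : i.+1%:R * c = \sum_(j < i.+1) c.
  by rewrite sumr_const card_ord mulr_natl.
rewrite subrXX -natrB // subSnn mul1r !cst; split; apply: ler_sum => j _.
  rewrite -[X in _ ^+ X <= _](@subnK j i) -1?ltnS // exprD.
  by rewrite ler_wpM2r ?exprn_ge0 // lerXn2r ?nnegrE.
rewrite -[X in _ <= _ ^+ X](@subnK j i) -1?ltnS // exprD.
by rewrite ler_wpM2l ?exprn_ge0 // lerXn2r ?nnegrE.
Qed.

Lemma power_sum_approx i L :
  `|(L.+1%:R)^-1 * (\sum_(k < L.+1) mesh L k ^+ i) - (i.+1%:R)^-1| <= (L.+1%:R)^-1 :> R.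
Proof.
pose n : R := L.+1%:R; have n0 : 0 < n by rewrite ltr0Sn.
pose S : R := \sum_(k < L.+1) k%:R ^+ i.
have i0 : 0 < i.+1%:R :> R by rewrite ltr0Sn.
have tel : \sum_(k < L.+1) ((k.+1)%:R ^+ i.+1 - k%:R ^+ i.+1) = n ^+ i.+1.
  rewrite -(big_mkord xpredT (fun k => (k.+1)%:R ^+ i.+1 - k%:R ^+ i.+1)) telescope_sumr //.
  by rewrite expr0n subr0.
have lo : i.+1%:R * S <= n ^+ i.+1.
  by rewrite -tel mulr_sumr ler_sum // => k _; have [] := power_increment k i.
have hi : n ^+ i.+1 <= i.+1%:R * (S + n ^+ i).
  rewrite -tel (@le_trans _ _ (\sum_(k < L.+1) i.+1%:R * k.+1%:R ^+ i)) //.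
    by apply: ler_sum => k _; have [] := power_increment k i.
  rewrite -mulr_sumr ler_wpM2l ?(ltW i0) // big_ord_recr /= /S big_ord_recl lerD2r.
  under [X in _ <= _ + X]eq_bigr do rewrite lift0.
  by rewrite lerDr exprn_ge0.
have ni0 : 0 < n ^+ i.+1 by rewrite exprn_gt0.
have -> : n^-1 * (\sum_(k < L.+1) mesh L k ^+ i) = S / n ^+ i.+1.
  rewrite exprS invfM mulrCA; congr (_ * _); rewrite mulr_suml.
  by apply: eq_bigr => k _; rewrite expr_div_n.
have e1 : i.+1%:R^-1 = (n ^+ i.+1 / i.+1%:R) / n ^+ i.+1 by field; rewrite ?gt_eqF.
have e2 : n^-1 = n ^+ i / n ^+ i.+1 by rewrite exprS; field; rewrite ?gt_eqF ?exprn_gt0.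
rewrite -/n e1 e2 -mulrBl normrM [`|_^-1|]ger0_norm ?invr_ge0 ?(ltW ni0) // ler_pM2r ?invr_gt0 //.
set q := n ^+ i.+1 / _.
have {}lo : S <= q by rewrite ler_pdivlMr // mulrC.
have {}hi : q <= S + n ^+ i by rewrite ler_pdivrMr // mulrC.
by rewrite ler_norml; apply/andP; split; lra.
Qed.

Definition riemann i j L : R :=
  (L.+1%:R)^-1 * \sum_(k < L.+1) mesh L k ^+ i * (1 - mesh L k) ^+ j.

Lemma beta_rec i j :
  i`!%:R * j.+1`!%:R / (i + j.+1).+1`!%:R
  = i`!%:R * j`!%:R / (i + j).+1`!%:R - i.+1`!%:R * j`!%:R / (i.+1 + j).+1`!%:R :> R.
Proof.
have FS n : n.+1`!%:R = n.+1%:R * n`!%:R :> R by rewrite factS natrM.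
have -> : (i + j.+1).+1`!%:R = (i + j).+2%:R * (i + j).+1`!%:R :> R by rewrite addnS FS.
have -> : (i.+1 + j).+1`!%:R = (i + j).+2%:R * (i + j).+1`!%:R :> R by rewrite addSn FS.
rewrite (FS i) (FS j).
have h2 := factr_neq0 R (i + j).+1.
have h : i.+1%:R + j.+1%:R != 0 :> R by rewrite -natrD pnatr_eq0.
have -> : (i + j).+2%:R = i.+1%:R + j.+1%:R :> R by rewrite -natrD addSn addnS.
move: h h2; move: (i.+1%:R) (j.+1%:R) ((i + j).+1`!%:R) => x y z h h2.
by field; rewrite h2 h.
Qed.

(** Multiplying by [1 - t] subtracts the sum with [i.+1] from the sum with [i], and the Beta values
    obey the same recursion; only pure powers of [t] need an estimate. *)
Lemma riemann_null (T : Type) (D : T -> Prop) i j :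
  unull D (fun L _ => (riemann i j L - i`!%:R * j`!%:R / (i + j).+1`!%:R)%:C).
Proof.
elim: j i => [|j IH] i.
  have a0 e : 0 < e -> exists N, forall L, (N <= L)%N -> L.+1%:R^-1 <= e :> R.
    move=> e0; exists (Num.truncn e^-1) => L NL; rewrite -[e]invrK lef_pV2 ?posrE ?invr_gt0 //.
    by rewrite (le_trans (ltW (truncnS_gt _))) // ler_nat.
  move=> e /a0[N NL]; exists N => L /NL Le t _; rewrite modulus_real.
  have -> : i`!%:R * 0`!%:R / (i + 0).+1`!%:R = i.+1%:R^-1 :> R.
    by rewrite addn0 mulr1 factS natrM invfM mulrCA divff ?mulr1 ?factr_neq0.
  rewrite /riemann (eq_bigr (fun k : 'I_L.+1 => mesh L k ^+ i)) => [|k _].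
    by rewrite (le_trans (power_sum_approx i L)).
  by rewrite expr0 mulr1.
apply: eq_unull (unullB (IH i) (IH i.+1)) => L t _; rewrite -rmorphB; congr _%:C.
have -> : riemann i j.+1 L = riemann i j L - riemann i.+1 j L.
  rewrite /riemann -mulrBr -sumrB; congr (_ * _); apply: eq_bigr => k _; rewrite !exprS; ring.
by rewrite beta_rec; ring.
Qed.

Definition expi (t : R) : C := cos t +i* sin t.

Lemma expiX (t : R) n : expi t ^+ n = expi (n%:R * t).
Proof.
elim: n => [|n IH]; first by rewrite expr0 mul0r /expi cos0 sin0.
rewrite exprS IH -natr1 mulrDl mul1r addrC /expi cosD sinD.
by apply/eqP; rewrite eq_complex /=; apply/andP; split; apply/eqP; ring.
Qed.

Lemma expi_conj t : expi t * (expi t)^*%C = 1.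
Proof.
apply/eqP; rewrite eq_complex /=; apply/andP; split; apply/eqP; last by ring.
by rewrite mulrN opprK -!expr2 cos2Dsin2.
Qed.

Definition unity_root L : C := expi (pi *+ 2 / L.+1%:R).

Lemma unity_rootX L : unity_root L ^+ L.+1 = 1.
Proof. by rewrite expiX mulrC divfK ?pnatr_eq0 // /expi cos2pi sin2pi. Qed.

Lemma unity_root_neq1 L j : (0 < j <= L)%N -> unity_root L ^+ j != 1.
Proof.
move=> /andP[j0 jL]; rewrite expiX /expi; set t := _ * _; rewrite eq_complex /= negb_and.
(* The real part is [1 - 2 sin^2 (t / 2)], with [t / 2] strictly between 0 and pi. *)
apply/orP; left; rewrite (_ : t = t / 2 + t / 2); last by field.
rewrite cosD -!expr2 -[X in _ != X](cos2Dsin2 (t / 2)) -subr_eq0 opprD addrACA subrr add0r.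
rewrite -opprD oppr_eq0 -mulr2n mulrn_eq0 /= expf_eq0 /= gt_eqF // sin_gt0_pi //.
have h : t / 2 = pi * (j%:R / L.+1%:R) by rewrite /t mulr2n; field.
rewrite h mulr_gt0 ?pi_gt0 ?divr_gt0 ?ltr0n //=.
by rewrite gtr_pMr ?pi_gt0 // ltr_pdivrMr ?ltr0Sn // mul1r ltr_nat ltnS.
Qed.

(** For exponents at most [L] this is exact, by a geometric sum of ratio different from 1; hence
    averaging over the phase causes no error for large [L]. *)
Lemma unity_root_ortho L i j : (i <= L)%N -> (j <= L)%N ->
  \sum_(k < L.+1) (unity_root L ^+ k) ^+ i * ((unity_root L ^+ k)^*%C) ^+ j
  = (if i == j then L.+1%:R else 0) :> C.
Proof.
move=> iL jL; set w := unity_root L.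
have ww : w * w^*%C = 1 by exact: expi_conj.
have key d : (0 < d <= L)%N -> \sum_(k < L.+1) (w ^+ d) ^+ k = 0.
  move=> dL; apply/eqP; have := unity_root_neq1 dL; rewrite -/w -subr_eq0 => /mulfI.
  rewrite -[_ == 0](inj_eq (mulfI (_ : w ^+ d - 1 != 0))) ?subr_eq0 ?unity_root_neq1 //.
  by rewrite mulr0 -subrX1 -exprM mulnC exprM unity_rootX expr1n subrr.
have key' d : (0 < d <= L)%N -> \sum_(k < L.+1) ((w^*%C) ^+ d) ^+ k = 0.
  move=> dL; have := congr1 (@conjc R) (key d dL); rewrite conjc0 rmorph_sum => h.
  rewrite -[RHS]h.
  by apply: eq_bigr => k _; rewrite !rmorphXn.
have unit k i' : (w ^+ k) ^+ i' * ((w ^+ k)^*%C) ^+ i' = 1.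
  by rewrite -exprMn rmorphXn -exprMn ww !expr1n.
case: (ltngtP i j) => [ij|ji|->].
- have -> : j = (i + (j - i))%N by rewrite subnKC // ltnW.
  under eq_bigr do rewrite exprD mulrA unit mul1r rmorphXn -exprM mulnC exprM.
  by apply: key'; rewrite subn_gt0 ij (leq_trans (leq_subr _ _)).
- have -> : i = (j + (i - j))%N by rewrite subnKC // ltnW.
  under eq_bigr do rewrite exprD mulrAC unit mul1r -exprM mulnC exprM.
  by apply: key; rewrite subn_gt0 ji (leq_trans (leq_subr _ _)).
- by under eq_bigr do rewrite unit; rewrite sumr_const card_ord.
Qed.

End Quadrature.

Section SphereAverages.
Variable R : realType.
Local Notation C := R[i].
Local Notation nc := (@modulus R).
Local Open Scope complex_scope.

Lemma dotmx_sum n (x y : 'rV[C]_n) : dotmx x y = \sum_j x 0 j * (y 0 j)^*%C.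
Proof. by rewrite dotmxE !mxE; apply: eq_bigr => j _; rewrite !mxE. Qed.

Lemma dotmx_conj n (x y : 'rV[C]_n) : (dotmx x y)^*%C = dotmx y x.
Proof.
rewrite !dotmx_sum conjc_sum; apply: eq_bigr => j _.
by rewrite conjcM conjcK mulrC.
Qed.

Lemma dotmx_addr n (x y z : 'rV[C]_n) : dotmx x (y + z) = dotmx x y + dotmx x z.
Proof. by rewrite linearDr. Qed.

Lemma dotmx_natr n k (x y : 'rV[C]_n) : dotmx x (k%:R *: y) = k%:R * dotmx x y.
Proof.
rewrite !dotmx_sum mulr_sumr; apply: eq_bigr => j _.
by rewrite !mxE rmorphM rmorph_nat; ring.
Qed.

(** Polar decomposition of the sphere of C^(q+2): [t] is the squared modulus of the first
    coordinate, [w] its phase, and [x] the direction of the other coordinates, on the sphere of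
    C^(q+1). *)
Definition cons_sphere q (t : R) (w : C) (x : 'rV[C]_q.+1) : 'rV[C]_q.+2 :=
  \row_j (if unlift ord0 j is Some i then (Num.sqrt (1 - t))%:C * x 0 i
          else (Num.sqrt t)%:C * w).

Definition tail q (u : 'rV[C]_q.+2) : 'rV[C]_q.+1 := \row_j u 0 (lift ord0 j).

Lemma dotmx_cons q t w x (u : 'rV[C]_q.+2) :
  dotmx (cons_sphere t w x) u
  = (Num.sqrt t)%:C * (w * (u 0 0)^*%C) + (Num.sqrt (1 - t))%:C * dotmx x (tail u).
Proof.
rewrite !dotmx_sum big_ord_recl mxE unlift_none mulrA mulr_sumr; congr (_ + _).
by apply: eq_bigr => j _; rewrite !mxE liftK mulrA.
Qed.

Lemma dotmx_tail q (u v : 'rV[C]_q.+2) :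
  dotmx u v = u 0 0 * (v 0 0)^*%C + dotmx (tail u) (tail v).
Proof.
rewrite !dotmx_sum big_ord_recl; congr (_ + _).
by apply: eq_bigr => j _; rewrite !mxE.
Qed.

(* Weighted points that equidistribute on the sphere of C^(q+1) as [L] grows: the
   squared modulus of the first coordinate runs over a regular mesh of [0, 1], with
   the density [q (1 - t)^(q-1)], and its argument over the roots of unity. *)
Fixpoint nodes q L : seq (R * 'rV[C]_q.+1) :=
  if q is q'.+1 then
    [seq ((L.+1%:R ^- 2 * (q'.+1%:R * (1 - mesh R L ik.1) ^+ q')) * p.1,
          cons_sphere (mesh R L ik.1) (unity_root R L ^+ ik.2) p.2)
      | ik <- [seq (i, k) | i <- iota 0%N L.+1, k <- iota 0%N L.+1], p <- nodes q' L]
  else [seq (L.+1%:R^-1, const_mx (unity_root R L ^+ k)) | k <- iota 0%N L.+1].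

Definition avg q L (g : 'rV[C]_q.+1 -> C) : C :=
  \sum_(p <- nodes q L) p.1%:C * g p.2.

Lemma avg0 L (g : 'rV[C]_1 -> C) :
  avg L g = (L.+1%:R)^-1 * \sum_(k < L.+1) g (const_mx (unity_root R L ^+ k)) :> C.
Proof.
rewrite /avg; cbn [nodes]; rewrite big_map -[iota 0 _]/(index_iota 0%N L.+1) big_mkord mulr_sumr.
by apply: eq_bigr => k _ /=; rewrite fmorphV rmorph_nat.
Qed.

Lemma avgS q L (g : 'rV[C]_q.+2 -> C) :
  avg L g = \sum_(i < L.+1) \sum_(k < L.+1)
    (L.+1%:R ^- 2 * (q.+1%:R * (1 - mesh R L i) ^+ q))%:C
      * avg L (fun x => g (cons_sphere (mesh R L i) (unity_root R L ^+ k) x)).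
Proof.
rewrite /avg; cbn [nodes]; rewrite !big_allpairs_dep.
rewrite -/(index_iota 0%N L.+1) big_mkord; apply: eq_bigr => i _.
rewrite big_mkord; apply: eq_bigr => k _.
by rewrite mulr_sumr; apply: eq_bigr => p _; rewrite /= rmorphM /= mulrA.
Qed.

Lemma avgD q L (g h : 'rV[C]_q.+1 -> C) :
  avg L (fun x => g x + h x) = avg L g + avg L h.
Proof. by rewrite -big_split /=; apply: eq_bigr => p _; rewrite mulrDr. Qed.

Lemma avgZ q L (c : C) (g : 'rV[C]_q.+1 -> C) : avg L (fun x => c * g x) = c * avg L g.
Proof. by rewrite mulr_sumr; apply: eq_bigr => p _; rewrite mulrCA. Qed.

Lemma avg_sum q L (I : Type) (s : seq I) (P : pred I) (g : I -> 'rV[C]_q.+1 -> C) :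
  avg L (fun x => \sum_(i <- s | P i) g i x) = \sum_(i <- s | P i) avg L (g i).
Proof.
rewrite /avg exchange_big /=; apply: eq_bigr => p _.
by rewrite mulr_sumr.
Qed.

Lemma nodes_ge0 q L p : p \in nodes q L -> 0 <= p.1.
Proof.
elim: q p => [|q IH] p; first by move=> /mapP[k _ ->]; rewrite invr_ge0.
case/allpairsP => -[ik p'] [/allpairsP[[i k] [iL _ ->]] p'q ->].
move: iL p'q; rewrite mem_iota /= add0n => iL p'q.
rewrite mulr_ge0 ?IH // mulr_ge0 ?invr_ge0 ?exprn_ge0 // mulr_ge0 // exprn_ge0 //.
by rewrite subr_ge0 (mesh_le1 _ (Ordinal iL)).
Qed.

Lemma nodes_sphere q L p : p \in nodes q L -> sphere p.2.
Proof.
have unit k : unity_root R L ^+ k * (unity_root R L ^+ k)^*%C = 1.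
  by rewrite conjcX -exprMn expi_conj expr1n.
elim: q p => [|q IH] p.
  by move=> /mapP[k _ ->]; rewrite /sphere /= dotmx_sum big_ord1 !mxE unit.
case/allpairsP => -[ik p'] [/allpairsP[[i k] [iL _ ->]] p'q ->].
move: iL p'q; rewrite mem_iota /sphere /= add0n => iL p'q.
have t1 : 0 <= 1 - mesh R L i by rewrite subr_ge0 (mesh_le1 _ (Ordinal iL)).
set x := cons_sphere _ _ _; have -> : dotmx x x = (Num.sqrt (mesh R L i))%:C
    * (unity_root R L ^+ k * (x 0 0)^*%C) + (Num.sqrt (1 - mesh R L i))%:C * dotmx p'.2 (tail x).
  exact: dotmx_cons.
have -> : dotmx p'.2 (tail x) = (Num.sqrt (1 - mesh R L i))%:C.
  rewrite dotmx_sum.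
  rewrite (eq_bigr (fun j => (Num.sqrt (1 - mesh R L i))%:C * (p'.2 0 j * (p'.2 0 j)^*%C))).
    by rewrite -mulr_sumr -dotmx_sum (IH _ p'q) mulr1.
  by move=> j _; rewrite !mxE liftK conjcM conjc_real mulrCA.
have -> : x 0 0 = (Num.sqrt (mesh R L i))%:C * unity_root R L ^+ k.
  by rewrite mxE unlift_none.
rewrite conjcM conjc_real (mulrCA (_ ^+ k)) unit mulr1 -!rmorphM -!expr2.
by rewrite !sqr_sqrtr ?mesh_ge0 // -rmorphD /= addrC subrK.
Qed.

Lemma eq_avg q L (g h : 'rV[C]_q.+1 -> C) :
  (forall x, sphere x -> g x = h x) -> avg L g = avg L h.
Proof. by move=> gh; apply: eq_big_seq => p /nodes_sphere/gh ->. Qed.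

End SphereAverages.

(** * Moments of inner products over the sphere *)

Section SphereMoments.
Variable R : realType.
Local Notation C := R[i].
Local Notation nc := (@modulus R).
Local Open Scope complex_scope.

(** A bounded region of parameters rather than the sphere, since [tail] and the combinations
    [u + k v] used for polarization leave the sphere. *)
Definition box q (B : R) (uv : 'rV[C]_q * 'rV[C]_q) : Prop :=
  forall j, nc (uv.1 0 j) <= B /\ nc (uv.2 0 j) <= B.

Lemma box_tail q B uv : @box q.+2 B uv -> box B (tail uv.1, tail uv.2).
Proof. by move=> uvB j; rewrite !mxE; exact: uvB. Qed.

Lemma ubounded_dotmx q B : ubounded (@box q B) (fun _ uv => dotmx uv.2 uv.1).
Proof.
exists (\sum_(j < q) `|B| * `|B|) => _ uv uvB; rewrite dotmx_sum.
rewrite (le_trans (modulus_sum _ _ _)) // ler_sum // => j _.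
have [u v] := uvB j; rewrite modulusM modulus_conj ler_pM ?modulus_ge0 //.
  by rewrite (le_trans v) // ler_norm.
by rewrite (le_trans u) // ler_norm.
Qed.

Definition angular L k l : C :=
  (L.+1%:R)^-1 * \sum_(i < L.+1) (unity_root R L ^+ i) ^+ k * ((unity_root R L ^+ i)^*%C) ^+ l.

Lemma angularE L k l : (k <= L)%N -> (l <= L)%N -> angular L k l = (k == l)%:R.
Proof.
move=> kL lL; rewrite /angular unity_root_ortho //.
by case: eqP => _; rewrite ?mulr0 // mulVf // pnatr_eq0.
Qed.

Definition radial q L k l : R :=
  (L.+1%:R)^-1 * \sum_(i < L.+1)
    q.+1%:R * (1 - mesh R L i) ^+ q * (Num.sqrt (mesh R L i) ^+ k * Num.sqrt (1 - mesh R L i) ^+ l).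

Lemma radialE q L k l : radial q L (k + k) (l + l) = q.+1%:R * riemann R k (l + q) L.
Proof.
rewrite /radial /riemann [RHS]mulrCA; congr (_ * _); rewrite mulr_sumr; apply: eq_bigr => i _.
rewrite !addnn -!mul2n !exprM !sqr_sqrtr ?mesh_ge0 ?subr_ge0 ?mesh_le1 //.
by rewrite (exprD (1 - _)); ring.
Qed.

Lemma radial_bound q L k l : `|radial q L k l| <= q.+1%:R.
Proof.
rewrite /radial normrM [`|_^-1|]ger0_norm ?invr_ge0 // ler_pdivrMl ?ltr0Sn //.
rewrite (le_trans (ler_norm_sum _ _ _)) //.
have cst : L.+1%:R * q.+1%:R = \sum_(i < L.+1) q.+1%:R :> R.
  by rewrite sumr_const card_ord mulr_natl.
rewrite [leRHS]cst; apply: ler_sum => i _.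
have t0 := mesh_ge0 R L i; have t1 := mesh_le1 R i.
have s0 : 0 <= 1 - mesh R L i by rewrite subr_ge0.
rewrite ger0_norm ?mulr_ge0 ?exprn_ge0 ?sqrtr_ge0 //.
have s1 : 1 - mesh R L i <= 1 by rewrite lerBlDr lerDl.
have r1 : Num.sqrt (mesh R L i) <= 1 by rewrite -[leRHS]sqrtr1 ler_wsqrtr.
have r2 : Num.sqrt (1 - mesh R L i) <= 1 by rewrite -[leRHS]sqrtr1 ler_wsqrtr.
by rewrite -mulrA ler_piMr // !mulr_ile1 ?mulr_ge0 ?exprn_ge0 ?exprn_ile1 ?sqrtr_ge0.
Qed.

Lemma exchange_sum4 (I J K L : finType) (F : I -> J -> K -> L -> C) :
  \sum_i \sum_j \sum_k \sum_l F i j k l = \sum_k \sum_l \sum_i \sum_j F i j k l.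
Proof.
under eq_bigr do rewrite exchange_big /=.
rewrite exchange_big /=; apply: eq_bigr => k _.
under eq_bigr do rewrite exchange_big /=.
by rewrite exchange_big.
Qed.

(** Both powers are expanded after splitting off the first coordinate; the product structure of the
    nodes then separates phase, radius and the lower-dimensional sphere. *)
Lemma avg_dotS q L n m (u v : 'rV[C]_q.+2) :
  avg L (fun x => dotmx x u ^+ n * (dotmx x v)^*%C ^+ m)
  = \sum_(i < n.+1) \sum_(j < m.+1)
      ('C(n, i) * 'C(m, j))%:R * (((u 0 0)^*%C) ^+ (n - i) * v 0 0 ^+ (m - j))
      * angular L (n - i) (m - j) * (radial q L (n - i + (m - j)) (i + j))%:C
      * avg L (fun x => dotmx x (tail u) ^+ i * (dotmx x (tail v))^*%C ^+ j).
Proof.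
rewrite avgS; pose s k := Num.sqrt (mesh R L k); pose r k := Num.sqrt (1 - mesh R L k).
pose w k := unity_root R L ^+ k.
transitivity (\sum_(k < L.+1) \sum_(l < L.+1) \sum_(i < n.+1) \sum_(j < m.+1)
   (L.+1%:R ^- 2 * (q.+1%:R * (1 - mesh R L k) ^+ q))%:C *
   (('C(n, i) * 'C(m, j))%:R * (((u 0 0)^*%C) ^+ (n - i) * v 0 0 ^+ (m - j))
   * ((s k ^+ (n - i + (m - j)) * r k ^+ (i + j))%:C * ((w l) ^+ (n - i) * (w l)^*%C ^+ (m - j)))
   * avg L (fun x => dotmx x (tail u) ^+ i * (dotmx x (tail v))^*%C ^+ j))).
  apply: eq_bigr => k _; apply: eq_bigr => l _.
  under [RHS]eq_bigr do rewrite -mulr_sumr.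
  rewrite -mulr_sumr; congr (_ * _).
  under [RHS]eq_bigr => i _ do under eq_bigr => j _ do rewrite -avgZ.
  under [RHS]eq_bigr => i _ do rewrite -avg_sum.
  rewrite -avg_sum; apply: eq_bigr => p _; congr (_ * _).
  rewrite !dotmx_cons conjcD !conjcM !conjc_real conjcK !exprDn big_distrlr /=.
  apply: eq_bigr => i _; apply: eq_bigr => j _.
  rewrite -/(s k) -/(r k) -/(w l) natrM !rmorphM !rmorphXn /= !exprMn !exprD.
  by rewrite -[X in X * _ = _]mulr_natl -[X in _ * X = _]mulr_natl; ring.
rewrite exchange_sum4; apply: eq_bigr => i _; apply: eq_bigr => j _.
rewrite /angular /radial.
have dist (F G : 'I_L.+1 -> C) : (\sum_k F k) * (\sum_l G l) = \sum_k \sum_l F k * G l.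
  by rewrite big_distrlr.
pose c : C := ('C(n, i) * 'C(m, j))%:R.
pose d : C := ((u 0 0)^*%C) ^+ (n - i) * v 0 0 ^+ (m - j).
set A := avg _ _.
pose S1 : C := \sum_(l < L.+1) w l ^+ (n - i) * (w l)^*%C ^+ (m - j).
pose S2 : R := \sum_(k < L.+1) q.+1%:R * (1 - mesh R L k) ^+ q * (s k ^+ (n - i + (m - j)) * r k ^+ (i + j)).
rewrite -/c -/d; transitivity (c * d * (L.+1%:R^-1 * S1) * (L.+1%:R^-1 * S2)%:C * A); last by [].
transitivity (c * d * A * (L.+1%:R^-1 * L.+1%:R^-1) * (S2%:C * S1)); last first.
  rewrite rmorphM /= fmorphV rmorph_nat; ring.
rewrite /S2 rmorph_sum dist mulr_sumr; apply: eq_bigr => k _.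
rewrite mulr_sumr; apply: eq_bigr => l _.
rewrite /= -/(s k) -/(r k) -/(w l).
rewrite !(rmorphM (real_complex R)) /= fmorphV (rmorphXn (real_complex R)) rmorph_nat.
by rewrite -[(_ ^+ 2)^-1]exprVn; ring.
Qed.

(** Induction on the dimension through [avg_dotS]. The phase average removes the terms with
    [n - i != m - j], the induction hypothesis those with [i != j], and the radial factor of the
    others tends to a Beta value. *)
Lemma avg_dot q n m B :
  unull (@box q.+1 B) (fun L uv =>
    avg L (fun x => dotmx x uv.1 ^+ n * (dotmx x uv.2)^*%C ^+ m)
    - (if n == m then dotmx uv.2 uv.1 ^+ n / 'C(n + q, q)%:R else 0)).
Proof.
elim: q n m => [|q IH] n m.
  apply: unull_eventually (unull0 _); exists (maxn n m) => L; rewrite geq_max => /andP[nL mL] uv _.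
  rewrite avg0.
  have E (k : 'I_L.+1) : dotmx (const_mx (unity_root R L ^+ k)) uv.1 ^+ n * (dotmx (const_mx (unity_root R L ^+ k)) uv.2)^*%C ^+ m
     = ((uv.1 0 0)^*%C ^+ n * uv.2 0 0 ^+ m) * ((unity_root R L ^+ k) ^+ n * ((unity_root R L ^+ k)^*%C) ^+ m).
    by rewrite !dotmx_sum !big_ord1 !mxE conjcM conjcK !exprMn; ring.
  under eq_bigr do rewrite E.
  rewrite -mulr_sumr mulrCA -/(angular L n m) angularE //; case: eqP => [<-|_].
    by rewrite dotmx_sum big_ord1 addn0 bin0 divr1 exprMn mulr1 mulrC subrr.
  by rewrite mulr0 subr0.
(* The limit of the term [(i, j)] of [avg_dotS]. By the binomial theorem these limits add up to the
   claimed moment, so convergence can be checked term by term. *)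
pose G i j (uv : 'rV[C]_q.+2 * 'rV[C]_q.+2) : C := if (n == m) && (i == j) then
   ('C(n, i) * 'C(m, j))%:R * (((uv.1 0 0)^*%C) ^+ (n - i) * uv.2 0 0 ^+ (m - j))
   * ((q.+1%:R * ((n - i)`!%:R * (i + q)`!%:R / (n + q).+1`!%:R))%:C
   * (dotmx (tail uv.2) (tail uv.1) ^+ i / 'C(i + q, q)%:R)) else 0.
have GE uv : (if n == m then dotmx uv.2 uv.1 ^+ n / 'C(n + q.+1, q.+1)%:R else 0)
     = \sum_(i < n.+1) \sum_(j < m.+1) G i j uv.
  rewrite /G; have [<-|nm] := eqVneq n m; last first.
    by rewrite big1 // => i _; rewrite big1.
  rewrite dotmx_tail exprDn mulr_suml; apply: eq_bigr => i _.
  rewrite (bigD1 i) //= eqxx big1 ?addr0 => [|j ji]; last first.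
    by rewrite ifF //; apply/negbTE; rewrite eq_sym.
  rewrite exprMn -[X in X / _ = _]mulr_natl.
  have B' N p : 'C(N + p, p)%:R = (N + p)`!%:R / (p`!%:R * N`!%:R) :> C.
    by rewrite -(@bin_fact (N + p) p) ?leq_addl // addnK !natrM; field; rewrite !factr_neq0.
  have Bi : 'C(n, i)%:R = n`!%:R / (i`!%:R * (n - i)`!%:R) :> C.
    have iN : (i <= n)%N by rewrite -ltnS.
    by rewrite -(bin_fact iN) !natrM; field; rewrite !factr_neq0.
  have FS N : N.+1`!%:R = N.+1%:R * N`!%:R :> C by rewrite factS natrM.
  rewrite !B' addnS natrM !rmorphM /= fmorphV !rmorph_nat Bi (FS (n + q)%N) (FS q).
  have n0 : (n + q).+1%:R != 0 :> C by rewrite pnatr_eq0.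
  have q0 : q.+1%:R != 0 :> C by rewrite pnatr_eq0.
  move: (_.+1%:R) n0 (q.+1%:R) q0 => x x0 y y0.
  by field; rewrite !factr_neq0 x0 y0.
apply: (@eq_unull R _ (box B) _ (fun L (uv : 'rV[C]_q.+2 * 'rV[C]_q.+2) => \sum_(i < n.+1) \sum_(j < m.+1) (
      ('C(n, i) * 'C(m, j))%:R * (((uv.1 0 0)^*%C) ^+ (n - i) * uv.2 0 0 ^+ (m - j))
      * angular L (n - i) (m - j) * (radial q L (n - i + (m - j)) (i + j))%:C
      * avg L (fun x => dotmx x (tail uv.1) ^+ i * (dotmx x (tail uv.2))^*%C ^+ j) - G i j uv))).
  move=> L uv _; rewrite GE avg_dotS -sumrB; apply: eq_bigr => i _.
  by rewrite -sumrB.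
apply: unull_sum => i _; apply: unull_sum => j _.
have iN : (i <= n)%N by rewrite -ltnS.
have jM : (j <= m)%N by rewrite -ltnS.
have {}IH := unull_comp (@box_tail q B) (IH i j).
have bc : ubounded (@box q.+2 B) (fun _ uv =>
    ('C(n, i) * 'C(m, j))%:R * (((uv.1 0 0)^*%C) ^+ (n - i) * uv.2 0 0 ^+ (m - j))).
  apply: uboundedM; first exact: ubounded_cst.
  by apply: uboundedM; apply: uboundedX; exists B => _ uv uvB; rewrite ?modulus_conj; have [] := uvB 0.
have [nmij|nmij] := eqVneq (n - i)%N (m - j)%N; last first.
  apply: unull_eventually (unull0 _); exists (maxn n m) => L; rewrite geq_max => /andP[nL mL] uv _.
  rewrite angularE ?(leq_trans (leq_subr _ _)) // (negbTE nmij) mulr0 !mul0r /G ifF ?subr0 //.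
  by apply/negbTE/negP => /andP[/eqP nm /eqP ij]; move/eqP: nmij; lia.
have br : ubounded (@box q.+2 B) (fun L _ => (radial q L (n - i + (m - j)) (i + j))%:C).
  by exists q.+1%:R => L uv _; rewrite modulus_real radial_bound.
apply: (@unull_eventually R _ (box B) _ (fun L (uv : 'rV[C]_q.+2 * 'rV[C]_q.+2) =>
      ('C(n, i) * 'C(m, j))%:R * (((uv.1 0 0)^*%C) ^+ (n - i) * uv.2 0 0 ^+ (m - j))
      * (radial q L (n - i + (m - j)) (i + j))%:C
      * avg L (fun x => dotmx x (tail uv.1) ^+ i * (dotmx x (tail uv.2))^*%C ^+ j) - G i j uv)).
  exists (maxn n m) => L; rewrite geq_max => /andP[nL mL] uv _.
  by rewrite angularE ?(leq_trans (leq_subr _ _)) // nmij eqxx mulr1.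
have [ij|ij] := eqVneq (i : nat) j; last first.
  rewrite (negbTE ij) in IH.
  apply: eq_unull (unull_mul (uboundedM bc br) IH) => L uv _ /=.
  by rewrite /G (negbTE ij) andbF !subr0.
have nm : n = m by lia.
rewrite -ij eqxx in IH.
have bd : ubounded (@box q.+2 B) (fun _ uv => dotmx (tail uv.2) (tail uv.1) ^+ i / 'C(i + q, q)%:R).
  apply: uboundedM; last exact: ubounded_cst.
  apply: uboundedX; have := ubounded_comp (@box_tail q B) (@ubounded_dotmx q.+1 B).
  exact.
have rn := unull_mul (ubounded_cst _ (q.+1%:R)) (@riemann_null R _ (@box q.+2 B) (n - i) (i + q)).
apply: eq_unull (unullD (unull_mul (uboundedM bc br) IH) (unull_mul (uboundedM bc bd) rn)) => L uv _ /=.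
rewrite /G -!ij -nm !eqxx /= radialE addnA subnK // rmorphB !rmorphM /= !rmorph_nat.
ring.
Qed.

End SphereMoments.

(** * Polarization, and convolution of monomials in inner products *)

Section ZonalAverages.
Variable R : realType.
Local Notation C := R[i].
Local Notation nc := (@modulus R).
Local Open Scope complex_scope.

Lemma coef_linear_exp (K : comNzRingType) (x y : K) n k :
  ((x%:P + y *: 'X) ^+ n)`_k = 'C(n, k)%:R * x ^+ (n - k) * y ^+ k.
Proof.
have -> : (x%:P + y *: 'X) ^+ n = \poly_(i < n.+1) ('C(n, i)%:R * x ^+ (n - i) * y ^+ i).
  rewrite poly_def exprDn; apply: eq_bigr => i _.
  rewrite exprZn -polyC_exp -mulr_natl -!mul_polyC !polyCM polyC_natr; ring.
rewrite coef_poly; case: ltnP => // nk.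
by rewrite bin_small // !mul0r.
Qed.

Lemma size_linear_exp (K : comNzRingType) (x y : K) n :
  (size ((x%:P + y *: 'X) ^+ n) <= n.+1)%N.
Proof.
apply/leq_sizeP => j nj; rewrite coef_linear_exp.
by rewrite bin_small // !mul0r.
Qed.

Lemma sphere_coord q (x : 'rV[C]_q) j : sphere x -> nc (x 0 j) <= 1.
Proof.
rewrite /sphere /= dotmx_sum => x1.
rewrite -(@ler_sqr _ (nc (x 0 j)) 1) ?nnegrE ?modulus_ge0 // expr1n -lecR sqr_modulus.
rewrite -[X in _ <= X]x1 (bigD1 j) //= lerDl sumr_ge0 // => i _.
by rewrite mulcJ_ge0.
Qed.

Lemma dotmx_addl n (x y z : 'rV[C]_n) : dotmx (x + y) z = dotmx x z + dotmx y z.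
Proof. by rewrite -!(dotmx_conj z) dotmx_addr conjcD. Qed.

Lemma dotmx_natl n k (x y : 'rV[C]_n) : dotmx (k%:R *: x) y = k%:R * dotmx x y.
Proof. by rewrite -!(dotmx_conj y) dotmx_natr conjcM conjc_nat. Qed.

(** Polarization in the first variable: [avg_dot] at [u + k v] is a polynomial in [k], and
    [unull_coef] makes each of its coefficients converge separately. *)
Lemma avg_polar q n m B c : (c <= n)%N ->
  unull (fun uvw : 'rV[C]_q.+1 * 'rV[C]_q.+1 * 'rV[C]_q.+1 =>
          box B uvw.1 /\ box B (uvw.2, uvw.2))
    (fun L uvw =>
      avg L (fun x => dotmx x uvw.1.1 ^+ (n - c) * dotmx x uvw.1.2 ^+ c * (dotmx x uvw.2)^*%C ^+ m)
      - (if n == m then dotmx uvw.2 uvw.1.1 ^+ (n - c) * dotmx uvw.2 uvw.1.2 ^+ c / 'C(n + q, q)%:R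
         else 0)).
Proof.
set D := fun uvw : _ * _ * _ => _.
pose A c L (uvw : 'rV[C]_q.+1 * 'rV[C]_q.+1 * 'rV[C]_q.+1) : C :=
  'C(n, c)%:R * (avg L (fun x => dotmx x uvw.1.1 ^+ (n - c) * dotmx x uvw.1.2 ^+ c * (dotmx x uvw.2)^*%C ^+ m)
      - (if n == m then dotmx uvw.2 uvw.1.1 ^+ (n - c) * dotmx uvw.2 uvw.1.2 ^+ c / 'C(n + q, q)%:R
         else 0)).
move=> cn; suff /(unull_mul (ubounded_cst D ('C(n, c)%:R^-1 : C))) : unull D (A c).
  by apply: eq_unull => L uvw _; rewrite mulKf // pnatr_eq0 -lt0n bin_gt0.
apply: (@unull_coef _ _ D n) cn => k.
have DB uvw : D uvw -> box (`|B| + k%:R * `|B|) (uvw.1.1 + k%:R *: uvw.1.2, uvw.2).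
  move=> [uB wB] j /=; have [u v] := uB j; have [w _] := wB j; split; last first.
    by rewrite (le_trans w) // (le_trans (ler_norm _)) // lerDl mulr_ge0.
  rewrite !mxE (le_trans (modulusD _ _)) // lerD ?(le_trans u (ler_norm _)) //.
  by rewrite modulusM modulus_nat ler_wpM2l // (le_trans v) // ler_norm.
apply: eq_unull (unull_comp DB (@avg_dot R q n m _)) => L uvw _ /=.
rewrite /A; under [LHS]eq_bigr do rewrite mulrBr mulrBr; rewrite sumrB; congr (_ - _).
  under [LHS]eq_bigr do rewrite -!avgZ.
  rewrite -avg_sum; apply: eq_avg => x _.
  rewrite dotmx_addr dotmx_natr exprDn mulr_suml; apply: eq_bigr => i _.
  by rewrite exprMn -mulr_natl; ring.
case: eqP => [_|_]; last by rewrite big1 // => i _; rewrite !mulr0.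
rewrite dotmx_addr dotmx_natr exprDn mulr_suml; apply: eq_bigr => i _.
by rewrite exprMn -mulr_natl; ring.
Qed.

(** The sum is the coefficient of [X^d] in [(1 + conj z X)^b (z + X)^c]. The denominator combines
    the binomial coefficient left by polarization with the normalization of the moment of order
    [b + c]. *)
Definition zonal_conv q a b c d (z : C) : C :=
  if (b + c == a + d)%N then
    (\sum_(k < d.+1) ('C(b, k) * 'C(c, d - k))%:R * monom (c - (d - k)) k z)
      / ('C(b + c, d) * 'C(b + c + q, q))%:R
  else 0.

Lemma avg_zonal q a b c d :
  unull (fun uv : 'rV[C]_q.+1 * 'rV[C]_q.+1 => sphere uv.1 /\ sphere uv.2)
    (fun L uv =>
      avg L (fun x => monom a b (dotmx uv.1 x) * monom c d (dotmx x uv.2))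
      - zonal_conv q a b c d (dotmx uv.1 uv.2)).
Proof.
set D := fun uv : _ * _ => _.
pose n := (b + c)%N; pose m := (a + d)%N.
pose p (z : C) : {poly C} := (1%:P + (z^*%C) *: 'X) ^+ b * (z%:P + 1 *: 'X) ^+ c.
have pE z k : (p z)`_k = \sum_(i < k.+1) ('C(b, i) * 'C(c, k - i))%:R * monom (c - (k - i)) i z.
  rewrite coefM; apply: eq_bigr => i _; rewrite !coef_linear_exp /monom !expr1n natrM; ring.
pose A d L (uv : 'rV[C]_q.+1 * 'rV[C]_q.+1) : C :=
  'C(m, d)%:R * avg L (fun x => dotmx x uv.1 ^+ b * dotmx x uv.2 ^+ c
                * ((dotmx x uv.1)^*%C ^+ (m - d) * (dotmx x uv.2)^*%C ^+ d))
  - (if n == m then (p (dotmx uv.1 uv.2))`_d / 'C(n + q, q)%:R else 0).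
have dm : (d <= m)%N by rewrite leq_addl.
have mdn : 'C(m, d)%:R != 0 :> C by rewrite pnatr_eq0 -lt0n bin_gt0.
suff /(unull_mul (ubounded_cst D ('C(m, d)%:R^-1 : C))) : unull D (A d).
  apply: eq_unull => L uv _; rewrite /A mulrBr mulKf //; congr (_ - _).
    apply: eq_avg => x _; rewrite /monom -(dotmx_conj x uv.1) conjcK.
    by rewrite /m addnK; ring.
  rewrite /zonal_conv -/n -/m; case: eqP => [nm|_]; last by rewrite mulr0.
  by rewrite pE nm natrM; field; rewrite mdn pnatr_eq0 -lt0n bin_gt0 leq_addl.
apply: (@unull_coef _ _ D m) dm => k.
(* Second polarization, in the conjugated variable. For unit [u], [v] with inner product [z], the
   vector [u + k v] has inner products [1 + k conj z] with [u] and [z + k] with [v], whence the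
   polynomial [p]. *)
pose h (uv : 'rV[C]_q.+1 * 'rV[C]_q.+1) := (uv.1, uv.2, uv.1 + k%:R *: uv.2).
have DB uv : D uv -> box (1 + k%:R) (h uv).1 /\ box (1 + k%:R) ((h uv).2, (h uv).2).
  move=> [u1 v1]; split => j /=; rewrite ?mxE; last split.
  - by split; rewrite (le_trans (sphere_coord _ _)) ?lerDl.
  - rewrite (le_trans (modulusD _ _)) // lerD ?sphere_coord // modulusM modulus_nat.
    by rewrite ler_piMr ?sphere_coord.
  - rewrite (le_trans (modulusD _ _)) // lerD ?sphere_coord // modulusM modulus_nat.
    by rewrite ler_piMr ?sphere_coord.
have cn : (c <= n)%N by rewrite leq_addl.
apply: eq_unull (unull_comp DB (@avg_polar q n m _ c cn)) => L uv [u1 v1].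
rewrite /A; under [LHS]eq_bigr do rewrite mulrBr; rewrite sumrB; congr (_ - _).
  under [LHS]eq_bigr do rewrite -!avgZ.
  rewrite -avg_sum; apply: eq_avg => x _.
  rewrite /= {1}/n addnK dotmx_addr dotmx_natr conjcD conjcM conjc_nat exprDn mulr_sumr.
  by apply: eq_bigr => i _; rewrite exprMn -mulr_natl; ring.
case: eqP => [nm|_]; last by rewrite big1 // => i _; rewrite !mulr0.
have -> : (h uv).1.1 = uv.1 by [].
have -> : (h uv).1.2 = uv.2 by [].
rewrite /h /= {2}/n addnK !dotmx_addl !dotmx_natl u1 v1 -(dotmx_conj uv.1 uv.2).
set z := dotmx uv.1 uv.2.
have -> : (1 + k%:R * z^*%C) ^+ b * (z + k%:R * 1) ^+ c = (p z).[k%:R].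
  by rewrite /p hornerM !horner_exp !hornerE [k%:R * _]mulrC.
rewrite (@horner_coef_wide _ m.+1) ?mulr_suml; last first.
  rewrite (leq_trans (size_polyMleq _ _)) // -nm /n.
  move: (size_linear_exp 1 (z^*%C) b) (size_linear_exp z 1 c).
  by move: (size _) (size _) => s1 s2; lia.
by apply: eq_bigr => i _; ring.
Qed.

End ZonalAverages.

(** * Convolution on the sphere *)

Section Reproducing.
Variables (R : realType) (a : nat).
Local Notation C := R[i].
Local Notation nc := (@modulus R).
Local Open Scope complex_scope.
Local Notation Rp := (@disc_poly R a%:R).
Implicit Types (m n c d : nat) (z : C).
Local Notation rV := 'rV[C]_a.+2.

Lemma big_shift (V : zmodType) i M n (H : nat -> V) : (i <= M <= n)%N ->
  (forall j, (M - i < j <= n - i)%N -> H j = 0) ->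
  \sum_(j < (n - i).+1) H j = \sum_(e < M.+1) (if (i <= e)%N then H (e - i)%N else 0).
Proof.
move=> /andP[iM Mn] H0.
rewrite -(big_mkord xpredT H) -(big_mkord xpredT (fun e => if (i <= e)%N then H (e - i)%N else 0)).
rewrite (big_cat_nat (n := (M - i).+1)) //=; last by rewrite ltnS leq_sub2r.
rewrite [X in _ + X]big_nat [X in _ + X]big1 => [|j Mj]; last by rewrite H0 // -ltnS.
rewrite [RHS](big_cat_nat (n := i)) //=; last by rewrite leqW.
rewrite [X in _ = X + _]big_nat [X in _ = X + _]big1 => [|j /andP[_ ji]]; last first.
  by rewrite leqNgt ji.
rewrite add0r addr0 -[X in _ = \sum_(X <= _ < _) _](add0n i) big_addn subSn //; apply: eq_bigr => j _.
by rewrite leq_addl addnK.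
Qed.

(** The Funk-Hecke formula for a monomial: convolution with it multiplies the disc polynomial by a
    number. Grouping by output monomials turns it into [lambda_zernike]. *)
Lemma conv_zernike c d m n z :
  \sum_(i < (minn m n).+1) (zernike R a m n i)%:C * zonal_conv a.+1 c d (m - i) (n - i) z
  = (lambda R a c d m n)%:C * Rp m n z.
Proof.
set M := minn m n.
have iM (i : 'I_M.+1) : (i <= m)%N /\ (i <= n)%N.
  by have := ltn_ord i; rewrite ltnS leq_min => /andP[].
have [cd|cd] := eqVneq (c + n)%N (d + m)%N; last first.
  rewrite /lambda (negbTE cd) mul0r big1 // => i _; have [im iN] := iM i.
  rewrite /zonal_conv ifF ?mulr0 //; apply/negbTE; move/eqP: cd; lia.
pose T i e : C := ('C(d, n - e)%:R * 'C(m - i, e - i)%:R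
    / ('C(d + (m - i), n - i)%:R * 'C(d + (m - i) + a.+1, a.+1)%:R)).
pose G i e : C := (zernike R a m n i)%:C * T i e * monom (m - e) (n - e) z.
transitivity (\sum_(i < M.+1) \sum_(e < M.+1) if (i <= e)%N then G i e else 0).
  apply: eq_bigr => i _; have [im iN] := iM i.
  rewrite /zonal_conv ifT; last by apply/eqP; lia.
  rewrite (reindex_inj rev_ord_inj) /= mulr_suml mulr_sumr.
  pose H j : C := (zernike R a m n i)%:C * (('C(d, n - i - j)%:R * 'C(m - i, j)%:R)
    * monom (m - i - j) (n - i - j) z / ('C(d + (m - i), n - i)%:R * 'C(d + (m - i) + a.+1, a.+1)%:R)).
  rewrite (eq_bigr (fun j : 'I_(n - i).+1 => H j)); last first.
    move=> j _; rewrite subSS subKn -1?ltnS // /H !natrM; congr (_ * (_ * _ / _)).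
  rewrite (@big_shift _ i M) ?geq_minr -1?ltnS ?andbT //; last first.
    move=> j /andP[Mj jn]; rewrite /H; have [jm|mj] := leqP j (m - i); last first.
      by rewrite (bin_small mj) !(mulr0, mul0r).
    by move: (nat_of_ord i) im iN jn jm Mj; rewrite /M => k; case: (leqP m n); lia.
  apply: eq_bigr => e _; case: ifP => // ie; rewrite /H /G /T.
  rewrite (_ : (n - i - (e - i) = n - e)%N); last by lia.
  rewrite (_ : (m - i - (e - i) = m - e)%N); last by lia.
  by ring.
rewrite exchange_big disc_poly_zernike mulr_sumr; apply: eq_bigr => e _ /=.
have eM : (e <= M)%N by rewrite -ltnS.
rewrite mulrA -rmorphM -(@lambda_zernike R a c d m n e cd eM) rmorph_sum mulr_suml.
pose F i : R := zernike R a m n i * ('C(d, n - e)%:R * 'C(m - i, e - i)%:R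
    / ('C(d + (m - i), n - i)%:R * 'C(d + (m - i) + a.+1, a.+1)%:R)).
rewrite [RHS](big_ord_widen M.+1 (fun i => (F i)%:C * monom (m - e) (n - e) z)) // [RHS]big_mkcond /=.
apply: eq_bigr => i _; rewrite ltnS; case: ifP => // ie.
rewrite /F /G /T; move: (zernike _ _ _ _ _) => r.
by rewrite !rmorphM /= fmorphV !rmorphM /= !rmorph_nat.
Qed.

Lemma monomJ m n z : monom m n z^*%C = (monom m n z)^*%C.
Proof. by rewrite /monom conjcM !conjcX. Qed.

Lemma disc_polyJ m n z : Rp m n z^*%C = (Rp m n z)^*%C.
Proof.
rewrite !disc_poly_zernike conjc_sum; apply: eq_bigr => i _.
by rewrite conjcM conjc_real monomJ.
Qed.

Lemma disc_poly1 m n : Rp m n 1 = 1.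
Proof.
rewrite /disc_poly conjc1 !expr1n if_same mul1r normr1 expr1n mulr1.
have -> : 2 - 1 = 1 :> R by rewrite -[2]/(1 + 1) addrK.
by rewrite jacobi_at1.
Qed.

Local Opaque disc_poly.

Definition zpoly (s : seq (C * (nat * nat))) z : C :=
  \sum_(t <- s) t.1 * monom t.2.1 t.2.2 z.

(* The factor by which the convolution with [zpoly s] on the sphere of C^(a+2)
   multiplies [disc_poly a m n]. *)
Definition zcoef (s : seq (C * (nat * nat))) m n : C :=
  \sum_(t <- s) t.1 * (lambda R a t.2.1 t.2.2 m n)%:C.

Definition spheres (uv : rV * rV) : Prop := sphere uv.1 /\ sphere uv.2.

Lemma avg_zpoly s m n :
  unull spheres (fun L uv =>
    avg L (fun x => zpoly s (dotmx uv.1 x) * Rp m n (dotmx x uv.2))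
    - zcoef s m n * Rp m n (dotmx uv.1 uv.2)).
Proof.
have mono c d : unull spheres (fun L uv =>
    avg L (fun x => monom c d (dotmx uv.1 x) * Rp m n (dotmx x uv.2))
    - (lambda R a c d m n)%:C * Rp m n (dotmx uv.1 uv.2)).
  have := unull_sum (index_enum 'I_(minn m n).+1) (P := xpredT) (fun i _ =>
     unull_mul (ubounded_cst spheres (zernike R a m n i)%:C) (@avg_zonal R a.+1 c d (m - i) (n - i))).
  apply: eq_unull => L uv _; rewrite -conv_zernike.
  under [RHS]eq_bigr do rewrite mulrBr; rewrite sumrB; congr (_ - _).
  under [RHS]eq_bigr do rewrite -avgZ.
  rewrite -avg_sum; apply: eq_avg => x _; rewrite disc_poly_zernike mulr_sumr.
  by apply: eq_bigr => i _; rewrite mulrCA.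
have := unull_sum s (P := xpredT) (fun t _ =>
  unull_mul (ubounded_cst spheres t.1) (mono t.2.1 t.2.2)).
apply: eq_unull => L uv _; rewrite /zcoef mulr_suml.
under [RHS]eq_bigr do rewrite mulrBr; rewrite sumrB; congr (_ - _).
  under [RHS]eq_bigr do rewrite -avgZ.
  rewrite -avg_sum; apply: eq_avg => x _; rewrite /zpoly mulr_suml.
  by apply: eq_bigr => t _; rewrite mulrA.
by apply: eq_bigr => t _; rewrite -mulrA.
Qed.

Definition pole : rV := delta_mx 0 0.

Lemma dotmx_pole (x : rV) : dotmx x pole = x 0 0.
Proof.
rewrite dotmx_sum big_ord_recl big1 => [|j _]; rewrite !mxE ?eqxx ?conjc1 ?conjc0.
  by rewrite mulr1 addr0.
by rewrite mulr0.
Qed.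

Lemma sphere_pole : sphere pole.
Proof. by rewrite /sphere /= dotmx_pole mxE !eqxx. Qed.

(** The second coordinate, available in C^(a+2), completes [z] to a unit vector. Thus facts about
    kernels become facts about functions on the whole disc. *)
Lemma sphere_disc (z : C) : disc z -> exists2 x : rV, sphere x & dotmx x pole = z.
Proof.
rewrite /disc /= -[1]/(1%:C) le_modulus => z1.
pose x : rV := \row_j (if j == 0 then z else if j == 1 then (Num.sqrt (1 - nc z ^+ 2))%:C else 0).
have x0 : x 0 ord0 = z by rewrite mxE eqxx.
have x1 : x 0 (lift ord0 ord0) = (Num.sqrt (1 - nc z ^+ 2))%:C by rewrite mxE.
have xj j : x 0 (lift ord0 (lift ord0 j)) = 0 by rewrite mxE.
exists x; last by rewrite dotmx_pole.
rewrite /sphere /= dotmx_sum !big_ord_recl x0 x1 big1 => [|j _].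
  rewrite conjc_real -sqr_modulus addr0 -rmorphM -expr2 sqr_sqrtr.
    by rewrite -rmorphD /= addrC subrK.
  by rewrite subr_ge0 expr_le1 ?modulus_ge0.
by rewrite xj mul0r.
Qed.

Definition zdisc m n : seq (C * (nat * nat)) :=
  [seq ((zernike R a m n i)%:C, ((m - i)%N, (n - i)%N)) | i <- iota 0%N (minn m n).+1].

Lemma zpoly_zdisc m n z : zpoly (zdisc m n) z = Rp m n z.
Proof.
rewrite /zpoly big_map -/(index_iota 0%N (minn m n).+1) big_mkord disc_poly_zernike.
by apply: eq_bigr.
Qed.

Lemma zcoef_limit s m n :
  unull (fun _ : unit => True) (fun L _ =>
    avg L (fun x => zpoly s (dotmx pole x) * Rp m n (dotmx x pole)) - zcoef s m n).
Proof.
have pp (t : unit) : True -> spheres (pole, pole) by split; exact: sphere_pole.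
apply: eq_unull (unull_comp pp (avg_zpoly s m n)) => L _ _ /=.
by rewrite (_ : dotmx pole pole = 1) ?disc_poly1 ?mulr1 //; exact: sphere_pole.
Qed.

(** The mean of the squared modulus of the disc polynomial over the sphere. Only the leading
    monomial enters: [lambda] vanishes for the lower ones. *)
Definition sqnorm m n : R := zernike R a m n 0 * lambda R a m n m n.

Lemma sqnorm_gt0 m n : 0 < sqnorm m n.
Proof.
rewrite /sqnorm /zernike /lambda [(n + m)%N]addnC eqxx leqnn /= expr0 mul1r.
by rewrite !(mulr_gt0, invr_gt0, ltr0n, fact_gt0).
Qed.

Lemma zcoef_zdisc_self m n : zcoef (zdisc m n) m n = (sqnorm m n)%:C.
Proof.
rewrite /zcoef big_map -/(index_iota 0%N (minn m n).+1) big_mkord big_ord_recl big1 => [|i _].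
  by rewrite /= !subn0 addr0 -rmorphM.
rewrite /= /lambda ifF ?mulr0 //; apply/negbTE; rewrite negb_and; apply/orP; right.
by have := ltn_ord i; rewrite /bump; lia.
Qed.

Lemma zcoef_zdisc_lt m' n' m n : (m' < m)%N || (n' < n)%N -> zcoef (zdisc m' n') m n = 0.
Proof.
move=> mn; rewrite /zcoef big_map -/(index_iota 0%N (minn m' n').+1) big_mkord big1 // => i _.
rewrite /= /lambda ifF ?mulr0 //; apply/negbTE; rewrite negb_and.
by have := ltn_ord i; lia.
Qed.

Lemma avg_conj L (g : rV -> C) : (avg L g)^*%C = avg L (fun x => (g x)^*%C).
Proof. by rewrite /avg conjc_sum; apply: eq_bigr => p _; rewrite conjcM conjc_real. Qed.

Lemma unull_conj (T : Type) (D : T -> Prop) (F : nat -> T -> C) :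
  unull D F -> unull D (fun L t => (F L t)^*%C).
Proof. by move=> F0 e /F0[N FN]; exists N => L NL t Dt; rewrite modulus_conj FN. Qed.

(** This symmetry is invisible in the formula for [lambda]; it is read off from the averages whose
    limits the two sides are. With the triangularity in [zcoef_zdisc_lt] it gives orthogonality. *)
Lemma zcoef_zdiscC m' n' m n : zcoef (zdisc m' n') m n = (zcoef (zdisc m n) m' n')^*%C.
Proof.
apply/eqP; rewrite -subr_eq0; apply/eqP.
apply: (@unull_cst _ _ (fun _ : unit => True) (fun _ => _) tt I).
have := unullB (unull_conj (zcoef_limit (zdisc m n) m' n')) (zcoef_limit (zdisc m' n') m n).
apply: eq_unull => L _ _; rewrite conjcB avg_conj.
have flip (F G : C -> C) : (forall z, F z^*%C = (F z)^*%C) -> (forall z, G z^*%C = (G z)^*%C) ->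
    avg L (fun x => (F (dotmx pole x) * G (dotmx x pole))^*%C)
    = avg L (fun x : rV => G (dotmx pole x) * F (dotmx x pole)).
  move=> FJ GJ; apply: eq_avg => x _.
  by rewrite conjcM -FJ -GJ dotmx_conj (dotmx_conj x pole) mulrC.
set A' := avg L _; set A := avg L _.
have -> : A' = A.
  rewrite /A (@eq_avg R a.+1 L _ (fun x => Rp m' n' (dotmx pole x) * Rp m n (dotmx x pole))).
    rewrite -(flip _ _ (disc_polyJ m n) (disc_polyJ m' n')); apply: eq_avg => x _.
    by rewrite zpoly_zdisc.
  by move=> x _; rewrite zpoly_zdisc.
by rewrite opprB [RHS]addrC addrA subrK.
Qed.

Lemma zcoef_zdisc m' n' m n :
  zcoef (zdisc m' n') m n = if (m' == m) && (n' == n) then (sqnorm m n)%:C else 0.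
Proof.
case: andP => [[/eqP-> /eqP->]|mn]; first exact: zcoef_zdisc_self.
have [?|mn'] := boolP ((m' < m) || (n' < n))%N; first exact: zcoef_zdisc_lt.
rewrite zcoef_zdiscC zcoef_zdisc_lt ?conjc0 //.
by apply/negP => mn2; apply: mn; split; apply/eqP; lia.
Qed.

Definition disc_span N (g : C -> C) : Prop :=
  exists e : nat -> nat -> C, forall z, g z = \sum_(m < N) \sum_(n < N) e m n * Rp m n z.

Lemma disc_spanD N g h : disc_span N g -> disc_span N h -> disc_span N (fun z => g z + h z).
Proof.
move=> [e ge] [e' he]; exists (fun m n => e m n + e' m n) => z; rewrite ge he -big_split.
by apply: eq_bigr => m _; rewrite -big_split; apply: eq_bigr => n _; rewrite mulrDl.
Qed.

Lemma disc_spanZ N (c : C) g : disc_span N g -> disc_span N (fun z => c * g z).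
Proof.
move=> [e ge]; exists (fun m n => c * e m n) => z; rewrite ge mulr_sumr.
by apply: eq_bigr => m _; rewrite mulr_sumr; apply: eq_bigr => n _; rewrite mulrA.
Qed.

Lemma disc_span_sum N (I : Type) (s : seq I) (g : I -> C -> C) :
  (forall i, disc_span N (g i)) -> disc_span N (fun z => \sum_(i <- s) g i z).
Proof.
move=> gN; elim: s => [|i s [e IH]].
  exists (fun _ _ => 0) => z; rewrite big_nil big1 // => m _.
  by rewrite big1 // => n _; rewrite mul0r.
have [e' h] := disc_spanD (gN i) (ex_intro _ e IH).
by exists e' => z; rewrite big_cons h.
Qed.

Lemma disc_span_disc_poly N m n : (m < N)%N -> (n < N)%N -> disc_span N (Rp m n).
Proof.
move=> mN nN; exists (fun i j => ((i == m) && (j == n))%:R) => z.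
rewrite (bigD1 (Ordinal mN)) //= (bigD1 (Ordinal nN)) //= !eqxx mul1r.
rewrite big1 ?addr0 => [|j jn]; last first.
  by rewrite -(inj_eq val_inj) /= in jn; rewrite (negbTE jn) mul0r.
rewrite big1 ?addr0 // => i im; rewrite big1 // => j _.
by rewrite -(inj_eq val_inj) /= in im; rewrite (negbTE im) mul0r.
Qed.

(** Triangular inversion: the leading coefficient of the disc polynomial is nonzero and its other
    monomials have lower degree in both variables. *)
Lemma disc_span_monom N c d : (c < N)%N -> (d < N)%N -> disc_span N (monom c d).
Proof.
elim/ltn_ind: c d => c IH d cN dN.
have z0 : zernike R a c d 0 != 0.
  by have := sqnorm_gt0 c d; rewrite /sqnorm; case: eqP => // ->; rewrite mul0r ltxx.
have /(disc_spanZ (zernike R a c d 0)%:C^-1) : disc_span N (fun z => Rp c d z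
    + -1 * (\sum_(i < minn c d) (zernike R a c d i.+1)%:C * monom (c - i.+1) (d - i.+1) z)).
  apply: disc_spanD; first exact: disc_span_disc_poly.
  apply: disc_spanZ; apply: disc_span_sum => i; apply: disc_spanZ.
  have := ltn_ord i; rewrite leq_min => /andP[ic id].
  by apply: IH; lia.
case=> e h; exists e => z; rewrite -h disc_poly_zernike big_ord_recl /= !subn0.
by rewrite mulN1r addrK mulKf // real_complex_eq0.
Qed.

(** [disc_span_monom] provides some coefficients for each monomial; averaging against each disc
    polynomial and using orthogonality identifies them. *)
Lemma zpoly_expand N s z : (forall t, t \in s -> (t.2.1 < N)%N /\ (t.2.2 < N)%N) ->
  zpoly s z = \sum_(m < N) \sum_(n < N) zcoef s m n / (sqnorm m n)%:C * Rp m n z.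
Proof.
move=> sN.
have mono c d : (c < N)%N -> (d < N)%N ->
    monom c d z = \sum_(m < N) \sum_(n < N) (lambda R a c d m n / sqnorm m n)%:C * Rp m n z.
  move=> cN dN; have [e me] := disc_span_monom cN dN; rewrite me.
  apply: eq_bigr => m _; apply: eq_bigr => n _; congr (_ * _).
  have s0 : (sqnorm m n)%:C != 0 :> C.
    by rewrite real_complex_eq0 gt_eqF // sqnorm_gt0.
  rewrite rmorphM fmorphV; apply: (canRL (mulfK s0)); apply/eqP; rewrite -subr_eq0; apply/eqP.
  apply: (@unull_cst _ _ (fun _ : unit => True) (fun _ => e m n * (sqnorm m n)%:C - (lambda R a c d m n)%:C) tt I).
  have := unullB (zcoef_limit [:: (1, (c, d))] m n)
    (unull_sum (index_enum 'I_N) (P := xpredT) (fun (m' : 'I_N) _ =>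
      unull_sum (index_enum 'I_N) (P := xpredT) (fun (n' : 'I_N) _ =>
        unull_mul (ubounded_cst _ (e m' n')) (zcoef_limit (zdisc m' n') m n)))).
  apply: eq_unull => L _ _.
  have -> : zcoef [:: (1, (c, d))] m n = (lambda R a c d m n)%:C.
    by rewrite /zcoef big_seq1 mul1r.
  set A := avg L _.
  have -> : A = \sum_(m' < N) \sum_(n' < N) e m' n' * avg L (fun x => zpoly (zdisc m' n') (dotmx pole x) * Rp m n (dotmx x pole)).
    under [RHS]eq_bigr => m' _ do under eq_bigr => n' _ do rewrite -avgZ.
    under [RHS]eq_bigr => m' _ do rewrite -avg_sum.
    rewrite -avg_sum; apply: eq_avg => x _; rewrite {1}/zpoly big_seq1 mul1r me mulr_suml.
    apply: eq_bigr => m' _; rewrite mulr_suml; apply: eq_bigr => n' _.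
    by rewrite zpoly_zdisc mulrA.
  have -> : e m n * (sqnorm m n)%:C = \sum_(m' < N) \sum_(n' < N) e m' n' * zcoef (zdisc m' n') m n.
    rewrite (bigD1 m) //= (bigD1 n) //= zcoef_zdisc !eqxx.
    rewrite big1 ?addr0 => [|n' nn]; last by rewrite zcoef_zdisc (negbTE (nn : (n' : nat) != n)) andbF mulr0.
    rewrite big1 ?addr0 // => m' mm; rewrite big1 // => n' _.
    by rewrite zcoef_zdisc (negbTE (mm : (m' : nat) != m)) mulr0.
  set Z := \sum_(m' < N) \sum_(n' < N) e m' n' * zcoef _ _ _.
  set S := \sum_(m' < N) \sum_(n' < N) e m' n' * avg _ _.
  transitivity (S - (lambda R a c d m n)%:C - (S - Z)).
    by rewrite opprB [RHS]addrC addrA subrK.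
  congr (_ - _); rewrite -sumrB; apply: eq_bigr => m' _.
  by rewrite -sumrB; apply: eq_bigr => n' _; rewrite mulrBr.
rewrite /zpoly (eq_big_seq (fun t => \sum_(m < N) \sum_(n < N)
   (t.1 * (lambda R a t.2.1 t.2.2 m n)%:C) / (sqnorm m n)%:C * Rp m n z)) => [|t /sN[c d]].
  rewrite exchange_big; apply: eq_bigr => m _; rewrite exchange_big; apply: eq_bigr => n _.
  by rewrite /zcoef !mulr_suml.
rewrite mono // mulr_sumr; apply: eq_bigr => m _; rewrite mulr_sumr; apply: eq_bigr => n _.
by rewrite rmorphM fmorphV /=; ring.
Qed.

End Reproducing.

(** * Positivity and boundedness of the disc polynomials *)

Section PositiveDefiniteness.
Variables (R : realType) (a : nat).
Local Notation C := R[i].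
Local Notation nc := (@modulus R).
Local Open Scope complex_scope.
Local Notation Rp := (@disc_poly R a%:R).
Implicit Types (m n : nat) (z : C).
Local Notation rV := 'rV[C]_a.+2.
Local Opaque disc_poly.

Definition null (u : nat -> C) : Prop := unull (fun _ : unit => True) (fun L _ => u L).

Lemma nullP (u : nat -> C) :
  null u <-> forall e : R, 0 < e -> exists N, forall L, (N <= L)%N -> nc (u L) <= e.
Proof.
split=> u0 e /u0[N uN]; exists N => L NL; first exact: uN NL tt I.
by move=> t _; exact: uN.
Qed.

Lemma unull_at (T : Type) (D : T -> Prop) F t : D t -> unull D F -> null (fun L => F L t).
Proof. by move=> Dt; apply: (unull_comp (h := fun _ : unit => t)). Qed.

Lemma null_le (u M : nat -> C) (c c' : C) (B : R) :
  null (fun L => u L - c) -> null (fun L => M L - c') ->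
  (forall L, nc (u L) <= B * nc (M L)) -> 0 <= B -> nc c <= B * nc c'.
Proof.
move=> /nullP u0 /nullP M0 uM B0; apply/ler_addgt0Pr => e e0.
have B1 : 0 < 1 + B by rewrite ltr_pwDl.
pose d := e / (1 + B); have d0 : 0 < d by rewrite divr_gt0.
have ed : e = d + B * d by rewrite /d; field; rewrite gt_eqF.
have [[N uN] [P MP]] := (u0 _ d0, M0 _ d0).
have := uN (maxn N P) (leq_maxl _ _); have := MP (maxn N P) (leq_maxr _ _).
move: (maxn N P) => L {uN MP} ML uL.
have h1 : nc c <= nc (u L) + d.
  by rewrite -[c](subKr (u L)) (le_trans (modulusB _ _)) // lerD2l.
have h2 : nc (M L) <= nc c' + d.
  by rewrite -[M L](subrK c') addrC (le_trans (modulusD _ _)) // lerD2l.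
have h3 := le_trans (uM L) (ler_wpM2l B0 h2).
by rewrite ed; lra.
Qed.

Lemma null_ge0 (u : nat -> C) (c : C) :
  null (fun L => u L - c) -> (forall L, 0 <= u L) -> 0 <= c.
Proof.
move=> /nullP u0 u_ge0.
have Im0 : complex.Im c = 0.
  apply/eqP; rewrite -normr_le0; apply/ler_addgt0Pr => e /u0[N uN].
  rewrite add0r (le_trans _ (uN N (leqnn _))) // (le_trans _ (Im_le_modulus _)) //.
  by rewrite raddfB /= (ger0_Im (u_ge0 N)) sub0r normrN.
rewrite lecE Im0 eqxx /=; apply/ler_addgt0Pr => e /u0[N uN].
have := le_trans (Re_le_modulus _) (uN N (leqnn _)).
have := u_ge0 N; rewrite lecE => /andP[_ /=].
rewrite raddfB /= ler_norml => ? /andP[? ?]; lra.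
Qed.

(** The weights come from Riemann sums of the radial density, so their total tends to 1 but need not
    equal 1; it has to be carried through the estimates. *)
Definition mass L : R := \sum_(p <- nodes R a.+1 L) p.1.

Lemma avg_cst L (c : C) : avg L (fun _ : rV => c) = (mass L)%:C * c.
Proof. by rewrite /avg -mulr_suml rmorph_sum. Qed.

Lemma mass_null : null (fun L => (mass L)%:C - 1).
Proof.
have pp : @box R a.+2 1 (pole R a, pole R a).
  by move=> j; split; exact/sphere_coord/sphere_pole.
apply: eq_unull (unull_at pp (@avg_dot R a.+1 0 0 1)) => L t _ /=.
rewrite (@eq_avg R a.+1 L _ (fun=> 1)) ?avg_cst ?mulr1 ?expr0 ?binn ?divr1 // => x _.
by rewrite !expr0 mulr1.
Qed.

Lemma mass_ge0 L : 0 <= mass L.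
Proof. by rewrite /mass big_seq sumr_ge0 // => p /nodes_ge0. Qed.

Lemma avg_ge0 L (g : rV -> C) : (forall x, sphere x -> 0 <= g x) -> 0 <= avg L g.
Proof.
move=> g0; rewrite /avg big_seq sumr_ge0 // => p pL.
by rewrite mulr_ge0 ?ler0c ?(nodes_ge0 pL) // g0 //; exact: nodes_sphere pL.
Qed.

Lemma avg_bound L (g h : rV -> C) (B : R) : (forall x, sphere x -> nc (g x) <= B) ->
  (forall x, sphere x -> 0 <= h x) ->
  nc (avg L (fun x => g x * h x)) <= B * nc (avg L h).
Proof.
move=> gB h0.
have hR x : sphere x -> h x = (complex.Re (h x))%:C.
  by move=> /h0 hx; rewrite RRe_real // ger0_real.
have hE : avg L h = (\sum_(p <- nodes R a.+1 L) p.1 * complex.Re (h p.2))%:C.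
  rewrite /avg rmorph_sum; apply: eq_big_seq => p pL /=.
  by rewrite rmorphM /= -hR //; exact: nodes_sphere pL.
have R0 p : p \in nodes R a.+1 L -> 0 <= p.1 * complex.Re (h p.2).
  move=> pL; rewrite mulr_ge0 ?(nodes_ge0 pL) // -ler0c -hR; first exact/h0/nodes_sphere/pL.
  exact: nodes_sphere pL.
rewrite hE modulus_real ger0_norm; last by rewrite big_seq sumr_ge0.
rewrite (le_trans (modulus_sum _ _ _)) // mulr_sumr big_seq [leRHS]big_seq ler_sum // => p pL.
have sp := nodes_sphere pL.
have -> : nc (p.1%:C * (g p.2 * h p.2)) = nc (g p.2) * (p.1 * complex.Re (h p.2)).
  have hn : nc (h p.2) = complex.Re (h p.2).
    by rewrite {1}(hR _ sp) modulus_real ger0_norm // -ler0c -hR // h0.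
  by rewrite !modulusM modulus_real (ger0_norm (nodes_ge0 pL)) hn; ring.
by rewrite ler_wpM2r ?R0 // gB.
Qed.

Lemma dotmx_spheres (x y : rV) : sphere x -> sphere y -> nc (dotmx x y) <= 1.
Proof.
move=> x1 y1; pose s := dotmx x y.
(* The part of [x] orthogonal to [y], of squared norm [1 - |s|^2]. *)
pose w : rV := x - s *: y.
have w0 : 0 <= dotmx w w.
  by rewrite dotmx_sum sumr_ge0 // => i _; rewrite mulcJ_ge0.
have : dotmx w w = 1 - s * s^*%C.
  transitivity (dotmx x x - s^*%C * dotmx x y - s * dotmx y x + s * s^*%C * dotmx y y).
    rewrite !dotmx_sum !mulr_sumr -!sumrB -big_split; apply: eq_bigr => j _.
    by rewrite !mxE conjcB conjcM /=; ring.
  by rewrite x1 y1 -(dotmx_conj x y) -/s; ring.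
rewrite -sqr_modulus => ww; move: w0; rewrite ww -[1]/(1%:C) -rmorphB ler0c subr_ge0.
by rewrite expr_le1 ?modulus_ge0.
Qed.

Lemma disc_dotmx (x y : rV) : sphere x -> sphere y -> disc (dotmx x y).
Proof. by move=> x1 y1; rewrite /disc /= -[1]/(1%:C) le_modulus dotmx_spheres. Qed.

(* The convolution of [disc_poly a m n] with itself is a positive multiple of it. *)
Lemma disc_poly_pd m n : positive_definite (@sphere R a.+2) (fun x y => Rp m n (dotmx x y)).
Proof.
move=> l xi c xi1.
have s0 := sqnorm_gt0 R a m n.
rewrite -(@pmulr_rge0 _ (sqnorm R a m n)%:C) ?ltcR //.
apply: (@null_ge0 (fun L => avg L (fun x => let u := \sum_mu c mu * Rp m n (dotmx (xi mu) x) in u * u^*%C))); last first.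
  by move=> L; apply: avg_ge0 => x _; rewrite mulcJ_ge0.
have := unull_sum (index_enum 'I_l) (P := xpredT) (fun (mu : 'I_l) _ =>
  unull_sum (index_enum 'I_l) (P := xpredT) (fun (nu : 'I_l) _ =>
    unull_mul (ubounded_cst (fun _ : unit => True) (c mu * (c nu)^*%C))
      (unull_at (conj (xi1 mu) (xi1 nu) : spheres (xi mu, xi nu)) (avg_zpoly a (zdisc R a m n) m n)))).
apply: eq_unull => L _ _; rewrite zcoef_zdisc_self /=.
transitivity (\sum_mu \sum_nu (c mu * (c nu)^*%C * avg L (fun x => zpoly (zdisc R a m n) (dotmx (xi mu) x) * Rp m n (dotmx x (xi nu))))
  - \sum_mu \sum_nu (c mu * (c nu)^*%C * ((sqnorm R a m n)%:C * Rp m n (dotmx (xi mu) (xi nu))))); last first.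
  rewrite -sumrB; apply: eq_bigr => mu _; rewrite -sumrB; apply: eq_bigr => nu _.
  by rewrite mulrBr.
congr (_ - _).
  under [RHS]eq_bigr => mu _ do under eq_bigr => nu _ do rewrite -avgZ.
  under [RHS]eq_bigr => mu _ do rewrite -avg_sum.
  rewrite -avg_sum; apply: eq_avg => x _; rewrite conjc_sum big_distrlr /=.
  apply: eq_bigr => mu _; apply: eq_bigr => nu _.
  rewrite zpoly_zdisc conjcM -(disc_polyJ a m n) (dotmx_conj (xi nu) x).
  exact: mulrACA.
rewrite mulr_sumr; apply: eq_bigr => mu _; rewrite mulr_sumr; apply: eq_bigr => nu _.
by ring.
Qed.

Lemma positive_definite2 (T : Type) (A : set T) (K : T -> T -> C) x y c c' :
  positive_definite A K -> A x -> A y ->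
  0 <= c * c^*%C * K x x + c * c'^*%C * K x y + (c' * c^*%C * K y x + c' * c'^*%C * K y y).
Proof.
move=> KP Ax Ay.
pose xi (i : 'I_2) : T := if i == ord0 then x else y.
pose d (i : 'I_2) : C := if i == ord0 then c else c'.
have xiA i : A (xi i) by rewrite /xi; case: ifP.
by have := KP 2 xi d xiA; rewrite !big_ord_recl !big_ord0 !addr0.
Qed.

(** Positive definiteness at two points with weights 1 and [- s] gives [0 <= 1 - |s|^2], because the
    kernel equals 1 on the diagonal. *)
Lemma disc_poly_le1 m n z : disc z -> nc (Rp m n z) <= 1.
Proof.
move=> /(sphere_disc a)[x x1 xz]; set s := Rp m n z.
have := positive_definite2 1 (- s) (disc_poly_pd m n) x1 (sphere_pole R a).
have -> : dotmx x x = 1 by [].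
have -> : dotmx (pole R a) (pole R a) = 1 by exact: sphere_pole.
rewrite -(dotmx_conj x (pole R a)) xz disc_polyJ disc_poly1 -/s conjc1.
have -> : (- s)^*%C = - s^*%C by rewrite rmorphN.
move: s => s; set u := (X in 0 <= X -> _).
have -> : u = 1 - s * s^*%C by rewrite /u; ring.
rewrite -sqr_modulus -[1]/(1%:C) -rmorphB ler0c subr_ge0.
by rewrite expr_le1 ?modulus_ge0.
Qed.

Lemma zcoef_bound s m n (B : R) :
  (forall z, disc z -> nc (zpoly s z) <= B) -> nc (zcoef a s m n) <= B.
Proof.
move=> sB; rewrite -[B]mulr1 -(modulus1 R).
have B0 : 0 <= B.
  by rewrite (le_trans _ (sB 1 _)) ?modulus_ge0 // /disc /= normr1.
apply: (null_le (zcoef_limit a s m n) mass_null _ B0) => L.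
rewrite -(mulr1 (mass L)%:C) -avg_cst.
rewrite (@eq_avg R a.+1 L _ (fun x => zpoly s (dotmx (pole R a) x) * Rp m n (dotmx x (pole R a)) * 1)); last first.
  by move=> x _; rewrite mulr1.
apply: avg_bound => // x x1; rewrite modulusM -[leRHS]mulr1 ler_pM ?modulus_ge0 //.
  by apply: sB; exact: (disc_dotmx (sphere_pole R a) x1).
by apply: disc_poly_le1; exact: (disc_dotmx x1 (sphere_pole R a)).
Qed.

End PositiveDefiniteness.

(** * Approximate identity *)

Section Kernel.
Variables (R : realType) (a : nat).
Local Notation C := R[i].
Local Notation nc := (@modulus R).
Local Open Scope complex_scope.
Implicit Types (m n N : nat) (z : C).

(* [((1 + z) (1 + z^* ) / 4) ^+ N], which concentrates at [z = 1]. *)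
Definition peak N : seq (C * (nat * nat)) :=
  [seq (4%:R ^- N * ('C(N, i) * 'C(N, j))%:R, (i, j)) | i <- iota 0%N N.+1, j <- iota 0%N N.+1].

Lemma zpoly_peak N z : zpoly (peak N) z = 4%:R ^- N * ((1 + z) * (1 + z)^*%C) ^+ N.
Proof.
have E : (1 + z) ^+ N = \sum_(i < N.+1) 'C(N, i)%:R * z ^+ i.
  by rewrite exprDn; apply: eq_bigr => i _; rewrite expr1n mul1r mulr_natl.
rewrite /zpoly big_allpairs_dep -/(index_iota 0%N N.+1) big_mkord.
rewrite exprMn -(conjcX (1 + z)) E conjc_sum big_distrlr mulr_sumr; apply: eq_bigr => i _.
rewrite big_mkord mulr_sumr; apply: eq_bigr => j _ /=.
by rewrite conjcM conjc_nat conjcX natrM /monom; ring.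
Qed.

Lemma zpoly_peak_ge0 N z : 0 <= zpoly (peak N) z.
Proof.
rewrite zpoly_peak mulr_ge0 ?invr_ge0 ?exprn_ge0 ?ler0n //.
by rewrite mulcJ_ge0.
Qed.

(** The normalized multiplier of [peak N] on the disc polynomial with indices [m], [n] is
    [theta N m * theta N n]. It vanishes once an index exceeds [N], thanks to the factor [i = N]. *)
Definition theta N m : R := \prod_(i < m) ((N - i)%:R / (N + i + a).+2%:R).

Lemma theta_ge0 N m : 0 <= theta N m.
Proof. by apply: prodr_ge0 => i _; rewrite divr_ge0. Qed.

Lemma theta_le1 N m : theta N m <= 1.
Proof.
apply: prodr_ile1 => i _; rewrite divr_ge0 //= ler_pdivrMr ?ltr0Sn // mul1r ler_nat.
lia.
Qed.

Lemma theta_eq0 N m : (N < m)%N -> theta N m = 0.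
Proof.
move=> Nm; rewrite /theta (bigD1 (Ordinal Nm)) //= subnn mul0r mul0r //.
Qed.

Lemma theta_fact N m : (m <= N)%N ->
  theta N m = N`!%:R * (N + a).+1`!%:R / ((N - m)`!%:R * (N + m + a).+1`!%:R).
Proof.
have FS k : k.+1`!%:R = k.+1%:R * k`!%:R :> R by rewrite factS natrM.
elim: m => [|m IH] mN.
  by rewrite /theta big_ord0 subn0 addn0 divff // mulf_neq0 ?factr_neq0.
rewrite /theta big_ord_recr /= -/(theta N m) IH 1?ltnW // addnS addSn.
rewrite -(subnSK mN) (FS (N - m.+1)%N) (FS (N + m + a).+1).
have gen (A B x y z w : R) : x != 0 -> y != 0 -> z != 0 -> w != 0 ->
    A * B / (x * y * z) * (x / w) = A * B / (y * (w * z)).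
  by move=> x0 y0 z0 w0; field; rewrite x0 y0 z0 w0.
by apply: gen; rewrite ?factr_neq0 ?pnatr_eq0.
Qed.

Lemma theta_null m : null (fun N => (theta N m)%:C - 1 : C).
Proof.
elim: m => [|m IH].
  by apply: eq_unull (unull0 _) => N _ _; rewrite /theta big_ord0 subrr.
have fac : null (fun N => ((N - m)%:R / (N + m + a).+2%:R)%:C - 1 : C).
  apply/nullP => e e0; pose c : R := (m + m + a).+2%:R.
  exists (maxn m (Num.truncn (c / e)).+1) => N; rewrite geq_max => /andP[mN cN].
  have N0 : 0 < (N + m + a).+2%:R :> R by rewrite ltr0Sn.
  have -> : ((N - m)%:R / (N + m + a).+2%:R)%:C - 1 = (- (c / (N + m + a).+2%:R))%:C :> C.
    rewrite -(rmorph1 (real_complex R)) -rmorphB; congr _%:C.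
    apply: (mulIf (lt0r_neq0 N0)); rewrite mulrBl mul1r mulNr !divfK ?gt_eqF //.
    apply/eqP; rewrite subr_eq addrC eq_sym subr_eq /c -natrD eqr_nat; apply/eqP; lia.
  rewrite modulus_real normrN ger0_norm ?divr_ge0 // ler_pdivrMr // mulrC -ler_pdivrMr //.
  rewrite (le_trans (ltW (truncnS_gt _))) // ler_nat (leq_trans cN) //; clear; lia.
have b : ubounded (fun _ : unit => True) (fun N _ => (theta N m)%:C : C).
  by exists 1 => N _ _; rewrite modulus_real ger0_norm ?theta_ge0 ?theta_le1.
apply: eq_unull (unullD (unull_mul b fac) IH) => N _ _.
by rewrite /theta big_ord_recr rmorphM /=; ring.
Qed.

(** The multiplier for [m = n = 0], that is, the mean of the peak kernel over the sphere. *)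
Definition peak_mass N : R :=
  4%:R ^- N * (N`!%:R * a.+1`!%:R / (N + a).+1`!%:R * 'C((N + N + a).+1, N)%:R).

Lemma peak_mass_gt0 N : 0 < peak_mass N.
Proof.
rewrite /peak_mass !(mulr_gt0, invr_gt0) ?exprn_gt0 ?ltr0n ?fact_gt0 //.
by rewrite bin_gt0; lia.
Qed.

Lemma zcoef_peak N m n :
  zcoef a (peak N) m n = (peak_mass N * theta N m * theta N n)%:C.
Proof.
rewrite /zcoef big_allpairs_dep -/(index_iota 0%N N.+1) big_mkord.
pose F i j : R := 4%:R ^- N * (('C(N, i) * 'C(N, j))%:R * lambda R a i j m n).
transitivity (\sum_(i < N.+1) \sum_(j < N.+1) F i j)%:C.
  rewrite rmorph_sum; apply: eq_bigr => i _; rewrite big_mkord rmorph_sum; apply: eq_bigr => j _.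
  rewrite /F /=; move: (lambda _ _ _ _ _ _) => l.
  by rewrite !(rmorphM (real_complex R)) /= fmorphV rmorphXn /= !rmorph_nat mulrA.
congr _%:C.
have [nN|Nn] := leqP n N; last first.
  rewrite (theta_eq0 Nn) mulr0 big1 // => i _; rewrite big1 // => j _.
  rewrite /F /lambda ifF ?mulr0 //; apply/negbTE; rewrite negb_and -!ltnNge.
  by rewrite (leq_trans (ltn_ord j)) ?orbT.
have [mN|Nm] := leqP m N; last first.
  rewrite (theta_eq0 Nm) mulr0 mul0r big1 // => i _; rewrite big1 // => j _.
  rewrite /F /lambda ifF ?mulr0 //; apply/negbTE; rewrite negb_and.
  by have := ltn_ord i; have := ltn_ord j; lia.
(* [lambda] restricts the double sum to [(i, j) = (m + t, n + t)]. *)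
pose H t : R := 4%:R ^- N * (('C(N, m + t) * 'C(N, n + t))%:R
   * ((n + t)`!%:R * (m + t)`!%:R * a.+1`!%:R / (t`!%:R * (n + t + m + a).+1`!%:R))).
rewrite exchange_big /=.
transitivity (\sum_(t < (N - n).+1) H t).
  rewrite (@big_shift _ n N N H) ?nN ?leqnn //; last first.
    by move=> t /andP[h1 h2]; move: (leq_trans h1 h2); rewrite ltnn.
  apply: eq_bigr => j _; case: ifPn => nj; last first.
    by rewrite big1 // => i _; rewrite /F /lambda (negbTE nj) andbF !mulr0.
  have E : F (m + (j - n))%N j = H (j - n)%N.
    rewrite /F /H /lambda ifT ?subnKC //; last by apply/andP; split=> //; apply/eqP; lia.
  have [jN|Nj] := ltnP (m + (j - n)) N.+1.
    rewrite (bigD1 (Ordinal jN)) //= E big1 ?addr0 // => i ij.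
    rewrite /F /lambda ifF ?mulr0 //; apply/negbTE; rewrite negb_and; apply/orP; left.
    by apply: contra ij => /eqP h; apply/eqP/val_inj => /=; lia.
  rewrite /H bin_small ?mul0n ?mul0r ?mulr0 // big1 // => i _.
  rewrite /F /lambda ifF ?mulr0 //; apply/negbTE; rewrite negb_and; apply/orP; left.
  by apply/eqP; have := ltn_ord i; move: Nj nj; clear; lia.
have B k p r : (p + r)%N = k -> 'C(k, p)%:R = k`!%:R / (p`!%:R * r`!%:R) :> R.
  by move=> <-; rewrite -(@bin_fact (p + r) p) ?leq_addr // addKn !natrM; field; rewrite !factr_neq0.
(* Once the factorials independent of [t] are taken out, what is left is a Vandermonde
   convolution. *)
pose c : R := 4%:R ^- N * (N`!%:R ^+ 2 * a.+1`!%:R / ((N - m)`!%:R * (N + m + a).+1`!%:R)).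
transitivity (c * \sum_(t < (N - n).+1) ('C(N - m, t) * 'C((N + m + a).+1, N - n - t))%:R).
  rewrite mulr_sumr; apply: eq_bigr => t _.
  have tn : (t <= N - n)%N by rewrite -ltnS.
  have [tm|mt] := leqP t (N - m); last first.
    by rewrite /H (bin_small mt) bin_small ?mul0n ?mul0r ?mulr0 //; lia.
  rewrite /H /c (natrM _ 'C(N, m + t)) (natrM _ 'C(N - m, t)) (B N (m + t)%N (N - m - t)%N); last by lia.
  rewrite (B N (n + t)%N (N - n - t)%N); last by lia.
  rewrite (B (N - m)%N t (N - m - t)%N); last by lia.
  rewrite (B _ (N - n - t)%N (n + t + m + a).+1); last by lia.
  by field; rewrite !factr_neq0 expf_neq0.
rewrite -natr_sum binomial.Vandermonde /peak_mass !theta_fact //.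
have -> : (N - m + (N + m + a).+1 = (N + N + a).+1)%N by lia.
rewrite (B _ (N - n)%N (N + n + a).+1); last by lia.
rewrite (B _ N (N + a).+1); last by lia.
rewrite /c; by field; rewrite !factr_neq0 expf_neq0.
Qed.

End Kernel.

(** * Weierstrass approximation on the disc *)

Section Bernstein.
Variable R : realType.
Local Notation C := R[i].
Local Notation nc := (@modulus R).
Local Open Scope complex_scope.

Definition bernstein (K : comNzRingType) n i (x : K) : K :=
  'C(n, i)%:R * x ^+ i * (1 - x) ^+ (n - i).

Definition bernstein_mean (K : comNzRingType) n (x : K) (g : nat -> K) : K :=
  \sum_(i < n.+1) bernstein n i x * g i.

(** [bernstein_mean] is the expectation of [g] at the number of successes in [n] trials; this is
    conditioning on one more trial. *)
Lemma bernstein_meanS (K : comNzRingType) n (x : K) g :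
  bernstein_mean n.+1 x g = x * bernstein_mean n x (fun i => g i.+1)
                            + (1 - x) * bernstein_mean n x g.
Proof.
have ext : bernstein_mean n x g
    = bernstein n 0 x * g 0%N + \sum_(i < n.+1) bernstein n i.+1 x * g i.+1.
  transitivity (\sum_(i < n.+2) bernstein n i x * g i); last by rewrite big_ord_recl.
  by rewrite big_ord_recr /= {2}/bernstein bin_small // !mul0r addr0.
rewrite ext mulrDr !mulr_sumr addrCA -big_split /bernstein_mean big_ord_recl; congr (_ + _).
  by rewrite /bernstein !bin0 !subn0 exprS; ring.
apply: eq_bigr => i _; rewrite /bernstein /= binS natrD subSS.
have [ni|ni] := ltnP i n; first by rewrite -(subnSK ni) !exprS; ring.
by rewrite (bin_small (ni : (n < i.+1)%N)) exprS; ring.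
Qed.

Lemma bernstein_mean_cst (K : comNzRingType) n (x c : K) : bernstein_mean n x (fun=> c) = c.
Proof.
elim: n => [|n IH]; last by rewrite bernstein_meanS IH; ring.
by rewrite /bernstein_mean big_ord1 /bernstein bin0 !expr0 !mul1r.
Qed.

Lemma bernstein_meanD (K : comNzRingType) n (x : K) g h :
  bernstein_mean n x (fun i => g i + h i) = bernstein_mean n x g + bernstein_mean n x h.
Proof. by rewrite -big_split; apply: eq_bigr => i _; rewrite mulrDr. Qed.

Lemma bernstein_meanZ (K : comNzRingType) n (x c : K) g :
  bernstein_mean n x (fun i => c * g i) = c * bernstein_mean n x g.
Proof. by rewrite mulr_sumr; apply: eq_bigr => i _; rewrite mulrCA. Qed.

(** The centre [y] is arbitrary because a success in the extra trial moves it to [y - 1] in the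
    induction. *)
Lemma bernstein_variance (K : comNzRingType) n (x y : K) :
  bernstein_mean n x (fun i => (i%:R - y) ^+ 2) = n%:R * x * (1 - x) + (n%:R * x - y) ^+ 2.
Proof.
elim: n y => [|n IH] y.
  by rewrite /bernstein_mean big_ord1 /bernstein /= bin0 subnn !expr0 mulr0n; ring.
rewrite bernstein_meanS IH (_ : bernstein_mean n x _ = bernstein_mean n x (fun i => (i%:R - (y - 1)) ^+ 2)).
  by rewrite IH -natr1; ring.
by apply: eq_bigr => i _; congr (_ * _); rewrite -[i.+1%:R]natr1; ring.
Qed.

Lemma bernstein_ge0 n i (x : R) : 0 <= x <= 1 -> 0 <= bernstein n i x.
Proof.
by move=> /andP[x0 x1]; rewrite /bernstein !mulr_ge0 ?exprn_ge0 ?subr_ge0.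
Qed.

Lemma bernstein_real n i (x : R) : bernstein n i (x%:C) = (bernstein n i x)%:C.
Proof.
by rewrite /bernstein !rmorphM !rmorphXn /= rmorphB rmorph1 rmorph_nat.
Qed.

End Bernstein.

Section ZPoly.
Variable R : realType.
Local Notation C := R[i].
Local Open Scope complex_scope.

Definition is_zpoly (g : C -> C) : Prop := exists s, forall z, g z = zpoly s z.

Lemma is_zpoly_ext g h : (forall z, g z = h z) -> is_zpoly h -> is_zpoly g.
Proof. by move=> gh [s hs]; exists s => z; rewrite gh. Qed.

Lemma is_zpoly_monom (c : C) m n : is_zpoly (fun z => c * monom m n z).
Proof. by exists [:: (c, (m, n))] => z; rewrite /zpoly big_seq1. Qed.

Lemma is_zpoly_cst (c : C) : is_zpoly (fun=> c).
Proof. by apply: is_zpoly_ext (is_zpoly_monom c 0 0) => z; rewrite /monom !expr0 !mulr1. Qed.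

Lemma is_zpoly_id : is_zpoly (fun z => z).
Proof. by apply: is_zpoly_ext (is_zpoly_monom 1 1 0) => z; rewrite /monom expr0 expr1 mulr1 mul1r. Qed.

Lemma is_zpoly_conj : is_zpoly (fun z => z^*%C).
Proof. by apply: is_zpoly_ext (is_zpoly_monom 1 0 1) => z; rewrite /monom expr0 expr1 !mul1r. Qed.

Lemma is_zpolyD g h : is_zpoly g -> is_zpoly h -> is_zpoly (fun z => g z + h z).
Proof.
by move=> [s gs] [t ht]; exists (s ++ t) => z; rewrite gs ht /zpoly big_cat.
Qed.

Lemma is_zpolyM g h : is_zpoly g -> is_zpoly h -> is_zpoly (fun z => g z * h z).
Proof.
move=> [s gs] [t ht].
exists [seq (u.1 * v.1, ((u.2.1 + v.2.1)%N, (u.2.2 + v.2.2)%N)) | u <- s, v <- t] => z.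
rewrite gs ht /zpoly big_allpairs_dep mulr_suml; apply: eq_bigr => u _.
by rewrite mulr_sumr; apply: eq_bigr => v _; rewrite /monom /= !exprD; ring.
Qed.

Lemma is_zpoly_sum (I : Type) (r : seq I) (F : I -> C -> C) :
  (forall i, is_zpoly (F i)) -> is_zpoly (fun z => \sum_(i <- r) F i z).
Proof.
move=> FI; elim: r => [|i r IH].
  by apply: is_zpoly_ext (is_zpoly_cst 0) => z; rewrite big_nil.
by apply: is_zpoly_ext (is_zpolyD (FI i) IH) => z; rewrite big_cons.
Qed.

Lemma is_zpolyX g n : is_zpoly g -> is_zpoly (fun z => g z ^+ n).
Proof.
move=> gP; elim: n => [|n IH].
  by apply: is_zpoly_ext (is_zpoly_cst 1) => z; rewrite expr0.
by apply: is_zpoly_ext (is_zpolyM gP IH) => z; rewrite exprS.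
Qed.

Lemma is_zpoly_bernstein g n i : is_zpoly g -> is_zpoly (fun z => bernstein n i (g z)).
Proof.
move=> gP; rewrite /bernstein; apply: is_zpolyM.
  by apply: is_zpolyM; [exact: is_zpoly_cst | exact: is_zpolyX].
apply: is_zpolyX; apply: is_zpolyD; first exact: is_zpoly_cst.
by apply: is_zpoly_ext (is_zpolyM (is_zpoly_cst (-1)) gP) => z; rewrite mulN1r.
Qed.

End ZPoly.

Section Weierstrass.
Variable R : realType.
Local Notation C := (cplx R).
Local Notation nc := (@modulus R).
Local Open Scope complex_scope.
Local Open Scope classical_set_scope.
Implicit Types (f : C -> C) (z w : C).

Lemma discE z : disc z <-> nc z <= 1.
Proof. by rewrite /disc /= -[1]/(1%:C) le_modulus. Qed.

Lemma within_disc_modulus f z (e : R) :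
  {within disc (R := R), continuous f} -> disc z -> 0 < e ->
  exists2 d : R, 0 < d & forall w, disc w -> nc (w - z) < d -> nc (f w - f z) <= e.
Proof.
move=> /subspace_continuousP fc Dz e0.
have /cvgrPdist_le/(_ e%:C) := fc z Dz.
rewrite ltcR => /(_ e0); rewrite near_withinE => /nbhs_ballP[d /= d0 df].
have dE : d = (complex.Re d)%:C by rewrite RRe_real // gtr0_real.
exists (complex.Re d) => [|w Dw wd]; first by rewrite -ltcR -dE.
rewrite modulusBC -le_modulus; apply: df => //=.
by rewrite -ball_normE /ball_ /= modulusE dE ltcR modulusBC.
Qed.

(** Uniform continuity in the form suited to Bernstein means: averaging the quadratic term produces
    a variance, which tends to 0 whatever [K] is. *)
Lemma uniform_modulus f (e : R) :
  {within disc (R := R), continuous f} -> 0 < e ->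
  exists2 K : R, 0 <= K &
    forall z w, disc z -> disc w -> nc (f z - f w) <= e + K * nc (z - w) ^+ 2.
Proof.
move=> fc e0.
pose sq : set R := `[(-1), 1]; pose pt (p : R * R) : C := p.1 +i* p.2.
have sqc : compact ((sq `*` sq) `*` (sq `*` sq)).
  by apply: compact_setX; apply: compact_setX; exact: segment_compact.
(* Compactness is applied to pairs of points of the square, a product of segments; the property is
   vacuous when a point lies outside the disc. *)
pose P (K : R) (q : (R * R) * (R * R)) : Prop := disc (pt q.1) -> disc (pt q.2) ->
  nc (f (pt q.1) - f (pt q.2)) <= e + K * nc (pt q.1 - pt q.2) ^+ 2.
have near_pt (p : R * R) (d : R) : 0 < d -> \forall p' \near p, nc (pt p' - pt p) < d.
  move=> d0; apply/nbhs_ballP; exists (d / 2) => /=; first by rewrite divr_gt0.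
  move=> p' [/= b1 b2].
  rewrite (le_lt_trans (modulus_le_ReIm _)) // (splitr d) ltrD //=.
    by rewrite distrC; exact: b1.
  by rewrite distrC; exact: b2.
have near_K : \forall K \near +oo, (sq `*` sq) `*` (sq `*` sq) `<=` P K.
  move/compact_near_coveringP: sqc; apply => -[p0 q0] _.
  suff [K0 HK0] : exists K0, \forall q \near (p0, q0), forall K, K0 <= K -> P K q.
    exists ([set q | forall K, K0 <= K -> P K q], [set K | K0 <= K]) => [|[q K] /= [h]]; last exact: h.
    by split; [exact: HK0 | exact: (nbhs_pinfty_ge (num_real K0))].
  have near1 d : 0 < d -> \forall q \near (p0, q0), nc (pt q.1 - pt p0) < d.
    by move=> /(near_pt p0) h; exact: (cvg_fst h).
  have near2 d : 0 < d -> \forall q \near (p0, q0), nc (pt q.2 - pt q0) < d.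
    by move=> /(near_pt q0) h; exact: (cvg_snd h).
  have out (p p' : C) : 1 < nc p -> nc (p' - p) < nc p - 1 -> ~ disc p'.
    move=> p1 pp' /discE p'1; have := modulusB p' (p' - p); rewrite subKr; lra.
  have [/discE Dp|p1] := leP (nc (pt p0)) 1; last first.
    exists 0; near=> q => K _ Dq _; exfalso; apply: (out _ (pt q.1) p1) Dq.
    by near: q; apply: near1; rewrite subr_gt0.
  have [/discE Dq|q1] := leP (nc (pt q0)) 1; last first.
    exists 0; near=> q => K _ _ Dq; exfalso; apply: (out _ (pt q.2) q1) Dq.
    by near: q; apply: near2; rewrite subr_gt0.
  have e2 : 0 < e / 2 by rewrite divr_gt0.
  have [d1 d10 fd1] := within_disc_modulus fc Dp e2.
  have [d2 d20 fd2] := within_disc_modulus fc Dq e2.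
  have [pq|pq] := eqVneq (pt p0) (pt q0).
    exists 0; near=> q => K K0 D1 D2.
    have h1 : nc (f (pt q.1) - f (pt p0)) <= e / 2.
      by apply: fd1 => //; near: q; exact: near1.
    have h2 : nc (f (pt q.2) - f (pt q0)) <= e / 2.
      by apply: fd2 => //; near: q; exact: near2.
    have h3 : 0 <= K * nc (pt q.1 - pt q.2) ^+ 2 by rewrite mulr_ge0 ?exprn_ge0 ?modulus_ge0.
    rewrite -pq in h2.
    have -> : f (pt q.1) - f (pt q.2) = (f (pt q.1) - f (pt p0)) - (f (pt q.2) - f (pt p0)) by ring.
    have := modulusB (f (pt q.1) - f (pt p0)) (f (pt q.2) - f (pt p0)); lra.
  pose r := nc (pt p0 - pt q0).
  have r0 : 0 < r by rewrite lt_neqAle modulus_ge0 eq_sym modulus_eq0 subr_eq0 pq.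
  have r4 : 0 < r / 4 by rewrite divr_gt0.
  pose M := nc (f (pt p0) - f (pt q0)).
  (* Nearby pairs stay at distance at least [r / 2], so with this constant the quadratic term
     absorbs the gap [M]. On the diagonal continuity alone suffices. *)
  exists (4 * M / r ^+ 2); near=> q => K KM D1 D2.
  have h1 : nc (f (pt q.1) - f (pt p0)) <= e / 2.
    by apply: fd1 => //; near: q; exact: near1.
  have h2 : nc (f (pt q.2) - f (pt q0)) <= e / 2.
    by apply: fd2 => //; near: q; exact: near2.
  have h3 : nc (pt q.1 - pt p0) < r / 4 by near: q; exact: near1.
  have h4 : nc (pt q.2 - pt q0) < r / 4 by near: q; exact: near2.
  have h5 : r / 2 <= nc (pt q.1 - pt q.2).
    have : r <= nc (pt q.1 - pt q.2) + (nc (pt q.1 - pt p0) + nc (pt q.2 - pt q0)).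
      rewrite /r [pt p0 - _](_ : _ = (pt q.1 - pt q.2) - ((pt q.1 - pt p0) - (pt q.2 - pt q0))); last by ring.
      by rewrite (le_trans (modulusB _ _)) // lerD2l modulusB.
    lra.
  have h6 : M <= K * nc (pt q.1 - pt q.2) ^+ 2.
    have M0 : 0 <= 4 * M / r ^+ 2 by rewrite divr_ge0 ?exprn_ge0 ?mulr_ge0 ?modulus_ge0 ?ltW.
    apply: (@le_trans _ _ (4 * M / r ^+ 2 * (r / 2) ^+ 2)).
      by rewrite le_eqVlt; apply/orP; left; apply/eqP; field; rewrite gt_eqF.
    have r2 : 0 <= r / 2 by rewrite divr_ge0 // ltW.
    by rewrite ler_pM ?exprn_ge0 // lerXn2r ?nnegrE ?modulus_ge0.
  have -> : f (pt q.1) - f (pt q.2) = (f (pt q.1) - f (pt p0)) - (f (pt q.2) - f (pt q0))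
       + (f (pt p0) - f (pt q0)) by ring.
  have := modulusB (f (pt q.1) - f (pt p0)) (f (pt q.2) - f (pt q0)).
  have := modulusD (f (pt q.1) - f (pt p0) - (f (pt q.2) - f (pt q0))) (f (pt p0) - f (pt q0)).
  rewrite -/M; lra.
have [K [K0 HK]] : exists K, 0 <= K /\ (sq `*` sq) `*` (sq `*` sq) `<=` P K.
  have [M [_ HM]] := near_K; exists (Num.max 0 (M + 1)); split; first by rewrite le_max lexx.
  by apply: HM; rewrite lt_max ltrDl ltr01 orbT.
exists K => // z w Dz Dw.
have sqE (t : R) : `|t| <= 1 -> sq t by rewrite /sq /= in_itv /= ler_norml.
have ptE (u : C) : pt (complex.Re u, complex.Im u) = u by case: u.
have := HK ((complex.Re z, complex.Im z), (complex.Re w, complex.Im w)).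
rewrite /P !ptE; apply => //; split; split => /=; apply: sqE.
- by rewrite (le_trans (Re_le_modulus _)) //; exact/discE.
- by rewrite (le_trans (Im_le_modulus _)) //; exact/discE.
- by rewrite (le_trans (Re_le_modulus _)) //; exact/discE.
- by rewrite (le_trans (Im_le_modulus _)) //; exact/discE.
Unshelve. all: end_near. Qed.

(** The grid of the square has points outside the disc, where nothing is known of [f]; they are
    moved radially to the circle, which at most doubles distances to points of the disc. *)
Definition retract (w : C) : C := if nc w <= 1 then w else w / (nc w)%:C.

Lemma retract_disc w : disc (retract w).
Proof.
apply/discE; rewrite /retract; case: (leP (nc w) 1) => // w1.
have w0 : 0 < nc w by exact: lt_trans ltr01 w1.
by rewrite modulusM modulusV modulus_real (ger0_norm (ltW w0)) divff ?gt_eqF.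
Qed.

Lemma retract_dist z w : disc z -> nc (z - retract w) <= 2 * nc (z - w).
Proof.
move=> /discE z1; rewrite /retract; case: (leP (nc w) 1) => w1.
  by rewrite mulr_natl mulr2n lerDl modulus_ge0.
have w0 : 0 < nc w by exact: lt_trans ltr01 w1.
have nE : (nc w)%:C != 0 :> C by rewrite real_complex_eq0 gt_eqF.
have -> : z - w / (nc w)%:C = (z - w) + w / (nc w)%:C * ((nc w)%:C - 1) by field.
rewrite (le_trans (modulusD _ _)) // mulr_natl mulr2n lerD2l modulusM.
have -> : nc (w / (nc w)%:C) = 1.
  by rewrite modulusM modulusV modulus_real (ger0_norm (ltW w0)) divff ?gt_eqF.
rewrite mul1r -(rmorph1 (real_complex R)) -rmorphB modulus_real ger0_norm ?subr_ge0 ?(ltW w1) //.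
have := modulusB z (z - w); rewrite subKr; lra.
Qed.

Lemma weierstrass_disc f (e : R) :
  {within disc (R := R), continuous f} -> 0 < e ->
  exists s, forall z, disc z -> nc (f z - zpoly s z) <= e.
Proof.
move=> fc e0; have e2 : 0 < e / 2 by rewrite divr_gt0.
have [K K0 fK] := uniform_modulus fc e2.
(* The variances contribute at most [K * 16 * 2 / n], which must not exceed [e / 2]. Here 16 is the
   square of 2 for [retract] times the square of 2 for rescaling [-1, 1] to [0, 1]. *)
pose n := (Num.truncn (64 * K / e)).+1.
have n0 : 0 < n%:R :> R by rewrite ltr0n.
have nK : 64 * K / e <= n%:R by rewrite ltW // truncnS_gt.
pose X (z : C) : C := 2^-1 * (1 + 2^-1 * (z + z^*%C)).
pose Y (z : C) : C := 2^-1 * (1 + (- (2^-1 * 'i)) * (z + -1 * z^*%C)).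
pose x z : R := (1 + complex.Re z) / 2; pose y z : R := (1 + complex.Im z) / 2.
have XE z : X z = (x z)%:C.
  by apply/eqP; rewrite eq_complex; case: z => u v; rewrite /X /x /=; apply/andP; split; apply/eqP; field.
have YE z : Y z = (y z)%:C.
  by apply/eqP; rewrite eq_complex; case: z => u v; rewrite /Y /y /=; apply/andP; split; apply/eqP; field.
pose c i j : C := (2 * (i%:R / n%:R) - 1) +i* (2 * (j%:R / n%:R) - 1).
pose P z : C := \sum_(i < n.+1) bernstein n i (X z) *
   \sum_(j < n.+1) bernstein n j (Y z) * f (retract (c i j)).
have [s sP] : is_zpoly P.
  have Xp : is_zpoly X.
    apply: is_zpolyM; first exact: is_zpoly_cst.
    apply: is_zpolyD; first exact: is_zpoly_cst.
    apply: is_zpolyM; first exact: is_zpoly_cst.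
    by apply: is_zpolyD; [exact: is_zpoly_id | exact: is_zpoly_conj].
  have Yp : is_zpoly Y.
    apply: is_zpolyM; first exact: is_zpoly_cst.
    apply: is_zpolyD; first exact: is_zpoly_cst.
    apply: is_zpolyM; first exact: is_zpoly_cst.
    apply: is_zpolyD; first exact: is_zpoly_id.
    by apply: is_zpolyM; [exact: is_zpoly_cst | exact: is_zpoly_conj].
  apply: is_zpoly_sum => i; apply: is_zpolyM; first exact: is_zpoly_bernstein.
  apply: is_zpoly_sum => j; apply: is_zpolyM; last exact: is_zpoly_cst.
  exact: is_zpoly_bernstein.
exists s => z Dz; rewrite -sP.
have x01 : 0 <= x z <= 1.
  have := le_trans (Re_le_modulus z) ((discE z).1 Dz); rewrite /x ler_norml => /andP[? ?].
  by apply/andP; split; lra.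
have y01 : 0 <= y z <= 1.
  have := le_trans (Im_le_modulus z) ((discE z).1 Dz); rewrite /y ler_norml => /andP[? ?].
  by apply/andP; split; lra.
pose bx i := bernstein n i (x z); pose bY j := bernstein n j (y z).
have bx0 i : 0 <= bx i by exact: bernstein_ge0.
have by0 i : 0 <= bY i by exact: bernstein_ge0.
have fE : f z = \sum_(i < n.+1) bernstein n i (X z) * \sum_(j < n.+1) bernstein n j (Y z) * f z.
  have h v w : \sum_(j < n.+1) bernstein n j w * v = v :> C by exact: bernstein_mean_cst.
  by under eq_bigr do rewrite h; rewrite h.
have D : nc (f z - P z) <= bernstein_mean n (x z) (fun i => bernstein_mean n (y z) (fun j =>
    e / 2 + K * (16 * ((i%:R / n%:R - x z) ^+ 2 + (j%:R / n%:R - y z) ^+ 2)))).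
  rewrite {1}fE -sumrB (le_trans (modulus_sum _ _ _)) //; apply: ler_sum => i _.
  rewrite -mulrBr modulusM XE bernstein_real modulus_real (ger0_norm (bx0 i)) ler_wpM2l //.
  rewrite -sumrB (le_trans (modulus_sum _ _ _)) //; apply: ler_sum => j _.
  rewrite -mulrBr modulusM YE bernstein_real modulus_real (ger0_norm (by0 j)) ler_wpM2l //.
  rewrite (le_trans (fK _ _ Dz (retract_disc _))) // lerD2l ler_wpM2l //.
  have := retract_dist (c i j) Dz => rd.
  apply: (@le_trans _ _ ((2 * nc (z - c i j)) ^+ 2)).
    by rewrite lerXn2r ?nnegrE ?mulr_ge0 ?modulus_ge0.
  rewrite exprMn.
  have -> : nc (z - c i j) ^+ 2 = (complex.Re (z - c i j)) ^+ 2 + (complex.Im (z - c i j)) ^+ 2 :> R.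
    by apply: complexI; rewrite sqr_modulus; case: (z - c i j) => u v; apply/eqP; rewrite eq_complex /=; apply/andP; split; apply/eqP; ring.
  rewrite le_eqVlt; apply/orP; left; apply/eqP.
  by rewrite /c /x /y; case: (z) => u v /=; field; rewrite gt_eqF.
rewrite (le_trans D) //.
have V t : bernstein_mean n t (fun i => (i%:R / n%:R - t) ^+ 2) = t * (1 - t) / n%:R :> R.
  rewrite (_ : bernstein_mean n t _ = bernstein_mean n t (fun i => (n%:R ^- 2) * (i%:R - n%:R * t) ^+ 2)).
    by rewrite bernstein_meanZ bernstein_variance subrr expr0n addr0; field; rewrite gt_eqF.
  by apply: eq_bigr => i _; congr (_ * _); field; rewrite gt_eqF.
have -> : bernstein_mean n (x z) (fun i => bernstein_mean n (y z) (fun j =>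
    e / 2 + K * (16 * ((i%:R / n%:R - x z) ^+ 2 + (j%:R / n%:R - y z) ^+ 2))))
   = e / 2 + K * (16 * (x z * (1 - x z) / n%:R + y z * (1 - y z) / n%:R)).
  transitivity (bernstein_mean n (x z) (fun i => e / 2 + K * (16 * ((i%:R / n%:R - x z) ^+ 2 + y z * (1 - y z) / n%:R)))).
    apply: eq_bigr => i _; congr (_ * _).
    by rewrite bernstein_meanD bernstein_mean_cst !bernstein_meanZ bernstein_meanD bernstein_mean_cst V.
  by rewrite bernstein_meanD bernstein_mean_cst !bernstein_meanZ bernstein_meanD bernstein_mean_cst V.
have q (t : R) : 0 <= t <= 1 -> t * (1 - t) <= 1 by move=> /andP[? ?]; nra.
rewrite [leRHS]splitr lerD2l -mulrDl !mulrA ler_pdivrMr //.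
have := q _ x01; have := q _ y01; move: nK; rewrite ler_pdivrMr //.
move: (x z * _) (y z * _) => u v nK hu hv.
have : K * 16 * (v + u) <= K * 16 * 2 by rewrite ler_wpM2l ?mulr_ge0 //; lra.
by lra.
Qed.

End Weierstrass.

(** * The Schoenberg expansion *)

Section Schoenberg.
Variables (R : realType) (a : nat).
Local Notation C := R[i].
Local Notation nc := (@modulus R).
Local Open Scope complex_scope.
Local Notation Rp := (@disc_poly R a%:R).
Implicit Types (m n N : nat) (z : C).
Local Notation rV := 'rV[C]_a.+2.
Local Notation sq := (sqnorm R a).
Local Opaque disc_poly.

(** The double average is a quadratic form at the nodes, with the node weights absorbed in the
    coefficients. Nodes may coincide, which positive definiteness allows. *)
Lemma avg_positive_definite L (K : rV -> rV -> C) (g : rV -> C) :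
  positive_definite (@sphere R a.+2) K ->
  0 <= avg L (fun x => avg L (fun y => g x * (g y)^*%C * K x y)).
Proof.
move=> KP; pose d : R * rV := (0, 0); pose s := nodes R a.+1 L.
pose xi (i : 'I_(size s)) := (nth d s i).2.
pose c (i : 'I_(size s)) := (nth d s i).1%:C * g (xi i).
have xi1 i : sphere (xi i) by apply: (@nodes_sphere _ _ L); apply: mem_nth.
have := KP _ xi c xi1; congr (0 <= _).
rewrite /avg -/s (big_nth d) big_mkord; apply: eq_bigr => i _.
rewrite (big_nth d) big_mkord mulr_sumr; apply: eq_bigr => j _.
rewrite /c conjcM conjc_real -/(xi i) -/(xi j).
by move: (g (xi i)) (g (xi j)) (K _ _) => u v w; ring.
Qed.

Lemma avg_norm_le L (g : rV -> C) (B : R) : (forall x, sphere x -> nc (g x) <= B) ->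
  nc (avg L g) <= B * mass R a L.
Proof.
move=> gB; have := @avg_bound R a L g (fun=> 1) B gB (fun _ _ => ler01).
rewrite avg_cst mulr1 modulus_real ger0_norm ?mass_ge0 //; apply: le_trans.
rewrite le_eqVlt; apply/orP; left; apply/eqP; congr (nc _).
by apply: eq_avg => x _; rewrite mulr1.
Qed.

Lemma avgB L (g h : rV -> C) : avg L (fun x => g x - h x) = avg L g - avg L h.
Proof.
rewrite -[- avg L h]mulN1r -avgZ -avgD; apply: eq_avg => x _.
by rewrite mulN1r.
Qed.

(** The form of [f] is tested on [g], a disc polynomial centred at the pole; [r] is its value. For
    the polynomial [s] the inner average multiplies by [Lam] and the outer one yields the squared
    norm. With [mass <= 2] the errors are [4 e] for replacing [f] by [s], [2 e] for the inner limit
    and [e] for the outer one. *)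
Lemma zcoef_nonneg_approx (f : C -> C) s m n (e : R) : 0 < e ->
  positive_definite (@sphere R a.+2) (fun x y => f (dotmx x y)) ->
  (forall z, disc z -> nc (f z - zpoly s z) <= e) ->
  exists2 r : R, 0 <= r & nc (zcoef a s m n * (sq m n)%:C - r%:C) <= 7 * e.
Proof.
move=> e0 fP fs; set Lam := zcoef a s m n; set e1 := pole R a.
have e1s : sphere e1 := sphere_pole R a.
have [N1 H1] := @avg_zpoly R a s m n e e0.
have [N2 H2] := (nullP _).1 (@mass_null R a) 1 ltr01.
have eL : 0 < e / (1 + nc Lam) by rewrite divr_gt0 // ltr_pwDl ?modulus_ge0.
have [N3 H3] := @zcoef_limit R a (zdisc R a m n) m n _ eL.
pose L := maxn N1 (maxn N2 N3).
have {}H1 := H1 L (leq_maxl _ _).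
have {}H2 := H2 L (leq_trans (leq_maxl _ _) (leq_maxr _ _)).
have {}H3 := H3 L (leq_trans (leq_maxr _ _) (leq_maxr _ _)) tt I.
have m2 : mass R a L <= 2.
  move: H2; rewrite -(rmorph1 (real_complex R)) -rmorphB modulus_real ler_norml => /andP[_]; lra.
have m0 := mass_ge0 R a L.
pose g x := Rp m n (dotmx e1 x).
have g1 x : sphere x -> nc (g x) <= 1.
  by move=> x1; apply: disc_poly_le1; exact: disc_dotmx.
pose Q := avg L (fun x => avg L (fun y => g x * (g y)^*%C * f (dotmx x y))).
pose QP := avg L (fun x => avg L (fun y => g x * (g y)^*%C * zpoly s (dotmx x y))).
have Q0 : 0 <= Q by exact: avg_positive_definite.
have QE : Q = (complex.Re Q)%:C by rewrite RRe_real // ger0_real.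
exists (complex.Re Q); first by rewrite -ler0c -QE.
rewrite -QE.
have gJ x : (g x)^*%C = Rp m n (dotmx x e1) by rewrite /g -disc_polyJ dotmx_conj.
have d1 : nc (Q - QP) <= 4 * e.
  rewrite /Q /QP -avgB.
  apply: (@le_trans _ _ (2 * e * mass R a L)); last first.
    have -> : 4 * e = 2 * e * 2 by ring.
    by rewrite ler_wpM2l // mulr_ge0 // ltW.
  apply: avg_norm_le => x x1; rewrite -avgB.
  apply: (@le_trans _ _ (e * mass R a L)); last by rewrite mulrC ler_wpM2r // ltW.
  apply: avg_norm_le => y y1; rewrite -mulrBr (modulusM (g x * _)) (modulusM (g x)) modulus_conj -[leRHS]mul1r.
  rewrite ler_pM ?mulr_ge0 ?modulus_ge0 //; last by apply: fs; exact: disc_dotmx.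
  by rewrite mulr_ile1 ?modulus_ge0 //; exact: g1.
pose err x := avg L (fun y => zpoly s (dotmx x y) * Rp m n (dotmx y e1)) - Lam * Rp m n (dotmx x e1).
have d2 : QP = avg L (fun x => Lam * (g x * Rp m n (dotmx x e1))) + avg L (fun x => g x * err x).
  rewrite -avgD; apply: eq_avg => x _.
  have -> : avg L (fun y => g x * (g y)^*%C * zpoly s (dotmx x y))
      = g x * avg L (fun y => zpoly s (dotmx x y) * Rp m n (dotmx y e1)).
    rewrite -avgZ; apply: eq_avg => y _; rewrite gJ -mulrA; congr (_ * _); exact: mulrC.
  by rewrite /err mulrBr (mulrCA Lam) addrC subrK.
have d3 : nc (avg L (fun x => g x * err x)) <= 2 * e.
  apply: (@le_trans _ _ (e * mass R a L)); last by rewrite mulrC ler_wpM2r // ltW.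
  apply: avg_norm_le => x x1; rewrite (modulusM (g x)) -[leRHS]mul1r.
  rewrite ler_pM ?modulus_ge0 ?g1 //.
  exact: (H1 (x, e1) (conj x1 e1s)).
have d4 : nc (Lam * (sq m n)%:C - avg L (fun x => Lam * (g x * Rp m n (dotmx x e1)))) <= e.
  rewrite avgZ -mulrBr modulusM modulusBC.
  rewrite (_ : avg L (fun x => g x * Rp m n (dotmx x e1))
     = avg L (fun x => zpoly (zdisc R a m n) (dotmx e1 x) * Rp m n (dotmx x e1))); last first.
    by apply: eq_avg => x _; rewrite zpoly_zdisc.
  move: H3; rewrite zcoef_zdisc_self; move: (nc (_ - _)) => t te.
  have l0 : 0 < 1 + nc Lam by rewrite ltr_pwDl ?modulus_ge0.
  rewrite -[leRHS](@divfK _ (1 + nc Lam)) ?gt_eqF // [leRHS]mulrC.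
  have t0 : 0 <= e / (1 + nc Lam) by rewrite ltW.
  rewrite (le_trans (ler_wpM2l (modulus_ge0 _) te)) // ler_wpM2r //; lra.
have -> : Lam * (sq m n)%:C - Q = (Lam * (sq m n)%:C - avg L (fun x => Lam * (g x * Rp m n (dotmx x e1))))
   - avg L (fun x => g x * err x) - (Q - QP).
  by rewrite d2; move: (avg _ _) (avg _ _) (Lam * _) => u v w; ring.
rewrite (le_trans (modulusB _ _)) // (le_trans (lerD (modulusB _ _) (lexx _))) //; lra.
Qed.

Lemma zcoefB (s t : seq (C * (nat * nat))) m n :
  zcoef a (s ++ [seq (- u.1, u.2) | u <- t]) m n = zcoef a s m n - zcoef a t m n.
Proof.
rewrite /zcoef big_cat big_map -sumrN; congr (_ + _).
by apply: eq_bigr => u _; rewrite mulNr.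
Qed.

Lemma zpolyB (s t : seq (C * (nat * nat))) z :
  zpoly (s ++ [seq (- u.1, u.2) | u <- t]) z = zpoly s z - zpoly t z.
Proof.
rewrite /zpoly big_cat big_map -sumrN; congr (_ + _).
by apply: eq_bigr => u _; rewrite mulNr.
Qed.

Lemma zcoef_eq0 N (s : seq (C * (nat * nat))) m n : (forall t, t \in s -> (t.2.1 < N)%N /\ (t.2.2 < N)%N) ->
  (N <= m)%N || (N <= n)%N -> zcoef a s m n = 0.
Proof.
move=> sN mn; rewrite /zcoef big_seq big1 // => t /sN[t1 t2].
rewrite /lambda ifF ?mulr0 //; apply/negbTE; rewrite negb_and.
by move: (t.2.1) (t.2.2) t1 t2 mn => c d; clear; lia.
Qed.

Lemma zpoly_degree (s : seq (C * (nat * nat))) :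
  exists N, forall t, t \in s -> (t.2.1 < N)%N /\ (t.2.2 < N)%N.
Proof.
elim: s => [|u s [N sN]]; first by exists 0%N.
exists (maxn N (maxn u.2.1 u.2.2).+1) => t; rewrite inE => /orP[/eqP->|/sN[h1 h2]].
  by move: (u.2.1) (u.2.2) => c d; clear; lia.
by move: (u.2.1) (u.2.2) (t.2.1) (t.2.2) h1 h2 => c d c' d'; clear; lia.
Qed.

Lemma sum_sq_widen (V : nmodType) K N (F : nat -> nat -> V) : (K <= N)%N ->
  \sum_(m < K) \sum_(n < K) F m n
  = \sum_(m < N) \sum_(n < N) (if (m < K)%N && (n < K)%N then F m n else 0).
Proof.
move=> KN; rewrite (big_ord_widen N (fun m => \sum_(n < K) F m n)) // big_mkcond /=.
apply: eq_bigr => m _; case: ifP => mK; last by rewrite big1.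
by rewrite (big_ord_widen N (fun n => F m n)) // big_mkcond.
Qed.

End Schoenberg.

(** * Construction and summability of the Schoenberg coefficients *)

Section SchoenbergExpansion.
Variables (R : realType) (a : nat).
Local Notation C := R[i].
Local Notation nc := (@modulus R).
Local Open Scope complex_scope.
Local Open Scope classical_set_scope.
Local Notation Rp := (@disc_poly R a%:R).
Implicit Types (m n N : nat) (z : C).
Local Notation rV := 'rV[R[i]]_a.+2.
Local Notation sq := (sqnorm R a).
Local Opaque disc_poly.

Lemma disc_polyX0 (alpha : nat) k z : disc_poly alpha%:R k 0 z = z ^+ k.
Proof.
have E w : disc_poly alpha%:R k 0 w = (zernike R alpha k 0 0)%:C * w ^+ k.
  by rewrite disc_poly_zernike minn0 big_ord1 /monom /= !subn0 expr0 mulr1.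
have := disc_poly1 R alpha k 0; rewrite E expr1n mulr1 => z1.
by rewrite E z1 mul1r.
Qed.

Lemma disc_poly0X (alpha : nat) k z : disc_poly alpha%:R 0 k z = (z^*%C) ^+ k.
Proof.
have E w : disc_poly alpha%:R 0 k w = (zernike R alpha 0 k 0)%:C * (w^*%C) ^+ k.
  by rewrite disc_poly_zernike min0n big_ord1 /monom /= !subn0 expr0 mul1r.
have := disc_poly1 R alpha 0 k; rewrite E conjc1 expr1n mulr1 => z1.
by rewrite E z1 mul1r.
Qed.

Definition smooth N (c : nat -> nat -> C) z : C :=
  \sum_(m < N.+1) \sum_(n < N.+1) c m n * (theta R a N m * theta R a N n)%:C * Rp m n z.

Definition normed_zcoef s m n : C := zcoef a s m n / (sq m n)%:C.

(* Up to a constant, [smooth N] is the convolution with the nonnegative function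
   [zpoly (peak R N)]. *)
Lemma smooth_contraction N s (B : R) z : (forall z, disc z -> nc (zpoly s z) <= B) ->
  disc z -> nc (smooth N (normed_zcoef s) z) <= B.
Proof.
move=> sB Dz; have [x x1 xz] := sphere_disc a Dz.
have B0 : 0 <= B by rewrite (le_trans (modulus_ge0 _) (sB z Dz)).
have [N0 sN0] := zpoly_degree s.
pose N' := maxn N0 N.+1.
have sN t : t \in s -> (t.2.1 < N')%N /\ (t.2.2 < N')%N.
  by move=> /sN0[h1 h2]; split; [apply: leq_trans h1 _ | apply: leq_trans h2 _]; exact: leq_maxl.
have k0 := peak_mass_gt0 R a N.
have p1 := sphere_pole R a.
pose u L := avg L (fun y : rV => zpoly (peak R N) (dotmx x y) * zpoly s (dotmx y (pole R a))).
pose M L := avg L (fun y : rV => zpoly (peak R N) (dotmx x y)).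
have uS : null (fun L => u L - (peak_mass R a N)%:C * smooth N (normed_zcoef s) z).
  have := unull_sum (index_enum 'I_N') (P := xpredT) (fun (m : 'I_N') _ =>
    unull_sum (index_enum 'I_N') (P := xpredT) (fun (n : 'I_N') _ =>
      unull_mul (ubounded_cst (fun _ : unit => True) (normed_zcoef s m n))
       (unull_at (conj x1 p1 : spheres (x, pole R a)) (avg_zpoly a (peak R N) m n)))).
  apply: eq_unull => L _ _ /=.
  transitivity (\sum_(m < N') \sum_(n < N') normed_zcoef s m n *
       avg L (fun y : rV => zpoly (peak R N) (dotmx x y) * Rp m n (dotmx y (pole R a)))
     - \sum_(m < N') \sum_(n < N') normed_zcoef s m n *
       (zcoef a (peak R N) m n * Rp m n z)); last first.
    rewrite -sumrB; apply: eq_bigr => m _; rewrite -sumrB; apply: eq_bigr => n _.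
    by rewrite mulrBr xz.
  congr (_ - _).
    under [RHS]eq_bigr => m _ do under eq_bigr => n _ do rewrite -avgZ.
    under [RHS]eq_bigr => m _ do rewrite -avg_sum.
    rewrite -avg_sum; apply: eq_avg => y _; rewrite (zpoly_expand a (dotmx y _) sN) mulr_sumr.
    apply: eq_bigr => m _; rewrite mulr_sumr; apply: eq_bigr => n _.
    by rewrite /normed_zcoef mulrCA.
  have N'N : (N.+1 <= N')%N by exact: leq_maxr.
  rewrite /smooth (sum_sq_widen (fun m n => normed_zcoef s m n
     * (theta R a N m * theta R a N n)%:C * Rp m n z) N'N) mulr_sumr.
  apply: eq_bigr => m _; rewrite mulr_sumr; apply: eq_bigr => n _.
  rewrite zcoef_peak -mulrA !rmorphM /=.
  case: ifPn => [_|]; first by move: (normed_zcoef _ _ _) (Rp _ _ _) => v w; ring.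
  rewrite negb_and -!leqNgt => /orP[h|h].
    by rewrite (theta_eq0 R a h) rmorph0 !(mulr0, mul0r).
  by rewrite (theta_eq0 R a h) rmorph0 !(mulr0, mul0r).
have MS : null (fun L => M L - (peak_mass R a N)%:C).
  have := unull_at (conj x1 p1 : spheres (x, pole R a)) (avg_zpoly a (peak R N) 0 0).
  apply: eq_unull => L _ _ /=; rewrite zcoef_peak /theta !big_ord0 !mulr1 disc_polyX0 expr0 mulr1.
  congr (_ - _); apply: eq_avg => y _.
  by rewrite disc_polyX0 expr0 mulr1.
have h : forall L, nc (u L) <= B * nc (M L).
  move=> L; rewrite /u (@eq_avg R a.+1 L _ (fun y => zpoly s (dotmx y (pole R a)) * zpoly (peak R N) (dotmx x y))).
    apply: avg_bound => y y1; first by apply: sB; exact: disc_dotmx.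
    exact: zpoly_peak_ge0.
  by move=> y _; exact: mulrC.
have := null_le uS MS h B0; rewrite modulusM modulus_real gtr0_norm // mulrC.
by rewrite ler_pM2r.
Qed.

Variable f : cplx R -> cplx R.
Hypothesis fc : {within disc (R := R), continuous f}.
Hypothesis fP : positive_definite (@sphere R a.+2) (fun x y => f (dotmx x y)).

Definition approx (s : seq (R[i] * (nat * nat))) (e : R) : Prop :=
  forall z, disc z -> nc (f z - zpoly s z) <= e.

Lemma approx_exists e : 0 < e -> exists s, approx s e.
Proof. by move=> e0; have [s fs] := weierstrass_disc fc e0; exists s. Qed.

Lemma approxB s t e e' z : approx s e -> approx t e' -> disc z ->
  nc (zpoly (s ++ [seq (- u.1, u.2) | u <- t]) z) <= e + e'.
Proof.
move=> fs ft Dz; rewrite zpolyB.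
have -> : zpoly s z - zpoly t z = (f z - zpoly t z) - (f z - zpoly s z).
  by rewrite opprB addrCA addrAC subrr add0r.
by rewrite (le_trans (modulusB _ _)) // addrC lerD ?fs ?ft.
Qed.

Lemma approx_zcoef s t e e' m n : approx s e -> approx t e' ->
  nc (zcoef a s m n - zcoef a t m n) <= e + e'.
Proof.
by move=> fs ft; rewrite -zcoefB; apply: zcoef_bound => z; exact: approxB.
Qed.

(* The common limit of the [zcoef s m n] over polynomials [s] tending to [f]. *)
Definition conv_coef m n : R :=
  sup [set x | exists s e, approx s e /\ x = complex.Re (zcoef a s m n) - e].

(** The coefficients of two approximants differ by at most the sum of their errors, so every lower
    bound [Re - e] lies below every upper bound [Re + e], and the supremum lies between. *)
Lemma conv_coef_Re s e m n : approx s e ->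
  `|complex.Re (zcoef a s m n) - conv_coef m n| <= e.
Proof.
move=> fs; rewrite /conv_coef; set E := [set x | _].
have lt_zcoef t e' : approx t e' ->
    complex.Re (zcoef a t m n) - e' <= complex.Re (zcoef a s m n) + e.
  move=> ft; have := le_trans (Re_le_modulus _) (approx_zcoef m n ft fs).
  by rewrite raddfB /= ler_norml => /andP[_]; lra.
have ubE : ubound E (complex.Re (zcoef a s m n) + e).
  by move=> _ [t [e' [ft ->]]]; exact: lt_zcoef.
have Es : E (complex.Re (zcoef a s m n) - e) by exists s, e.
have h1 : sup E <= complex.Re (zcoef a s m n) + e.
  by apply: ge_sup => //; exists (complex.Re (zcoef a s m n) - e).
have h2 : complex.Re (zcoef a s m n) - e <= sup E.
  by apply: ub_le_sup => //; exists (complex.Re (zcoef a s m n) + e).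
by rewrite ler_norml; apply/andP; split; lra.
Qed.

Lemma approx_nonneg s e m n : 0 < e -> approx s e ->
  - (7 * e) <= complex.Re (zcoef a s m n) * sq m n /\
  `|complex.Im (zcoef a s m n)| * sq m n <= 7 * e.
Proof.
move=> e0 fs; have [r r0] := zcoef_nonneg_approx m n e0 fP fs.
move: (zcoef a s m n) => [u v] h.
have {}h : nc ((u * sq m n - r) +i* (v * sq m n)) <= 7 * e.
  move: h; congr (nc _ <= _); apply/eqP; rewrite eq_complex /=.
  by apply/andP; split; apply/eqP; ring.
have s0 := ltW (sqnorm_gt0 R a m n).
split.
  have := le_trans (Re_le_modulus _) h; rewrite /= ler_norml => /andP[? _]; lra.
by have := le_trans (Im_le_modulus _) h; rewrite /= normrM [`|sq m n|]ger0_norm.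
Qed.

Lemma conv_coef_ge0 m n : 0 <= conv_coef m n.
Proof.
have s0 := sqnorm_gt0 R a m n.
apply/ler_addgt0Pr => e e0; pose d := e / (1 + 7 / sq m n).
have q0 : 0 < 1 + 7 / sq m n by rewrite addr_gt0 ?divr_gt0.
have d0 : 0 < d by rewrite divr_gt0.
have ed : e = d + 7 * d / sq m n by rewrite /d; field; rewrite !gt_eqF // ltr_wpDr // ltW.
have [s fs] := approx_exists d0.
have [h1 _] := approx_nonneg m n d0 fs.
have := conv_coef_Re m n fs; rewrite ler_norml => /andP[h2 h3].
have : - (7 * d / sq m n) <= complex.Re (zcoef a s m n).
  by rewrite -mulNr ler_pdivrMr.
rewrite ed; lra.
Qed.

(** The summand 1 accounts for the real part, and [7 / sq m n] for the imaginary part, which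
    positivity of the form keeps small. *)
Definition coef_rate m n : R := 1 + 7 / sq m n.

Lemma conv_coef_approx s e m n : 0 < e -> approx s e ->
  nc (zcoef a s m n - (conv_coef m n)%:C) <= coef_rate m n * e.
Proof.
move=> e0 fs; have [_ h] := approx_nonneg m n e0 fs.
have s0 := sqnorm_gt0 R a m n.
rewrite (le_trans (modulus_le_ReIm _)) // /coef_rate mulrDl mul1r.
rewrite raddfB /= raddfB /= subr0 lerD ?conv_coef_Re //.
by rewrite mulrAC ler_pdivlMr.
Qed.

Definition schoenberg m n : R := conv_coef m n / sq m n.

Lemma schoenberg_ge0 m n : 0 <= schoenberg m n.
Proof. by rewrite divr_ge0 ?conv_coef_ge0 // ltW // sqnorm_gt0. Qed.

Definition rate N : R := \sum_(m < N.+1) \sum_(n < N.+1) coef_rate m n / sq m n.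

Lemma rate_ge0 N : 0 <= rate N.
Proof.
apply: sumr_ge0 => m _; apply: sumr_ge0 => n _; have s0 := ltW (sqnorm_gt0 R a m n).
by rewrite divr_ge0 // addr_ge0 // divr_ge0.
Qed.

Lemma theta2_bound N m n : 0 <= theta R a N m * theta R a N n <= 1.
Proof. by rewrite mulr_ge0 ?theta_ge0 // mulr_ile1 ?theta_ge0 ?theta_le1. Qed.

Lemma smooth_approx N s e z : 0 < e -> approx s e -> disc z ->
  nc (smooth N (fun m n => (schoenberg m n)%:C) z - smooth N (normed_zcoef s) z) <= rate N * e.
Proof.
move=> e0 fs Dz; rewrite /smooth -sumrB (le_trans (modulus_sum _ _ _)) // /rate mulr_suml.
apply: ler_sum => m _; rewrite -sumrB (le_trans (modulus_sum _ _ _)) // mulr_suml.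
apply: ler_sum => n _.
have s0 := sqnorm_gt0 R a m n; have /andP[t0 t1] := theta2_bound N m n.
have -> : (schoenberg m n)%:C * (theta R a N m * theta R a N n)%:C * Rp m n z
    - normed_zcoef s m n * (theta R a N m * theta R a N n)%:C * Rp m n z
  = ((conv_coef m n)%:C - zcoef a s m n) / (sq m n)%:C * ((theta R a N m * theta R a N n)%:C * Rp m n z).
  rewrite /schoenberg /normed_zcoef rmorphM fmorphV /=.
  by move: (Rp _ _ _) (_ * _)%:C => v w; ring.
rewrite modulusM -[leRHS]mulr1 ler_pM ?modulus_ge0 //.
  rewrite modulusM modulusV modulus_real gtr0_norm // modulusBC mulrAC.
  by rewrite ler_pM2r ?invr_gt0 // conv_coef_approx.
rewrite (modulusM (_ * _)%:C) modulus_real ger0_norm // mulr_ile1 ?modulus_ge0 //.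
exact: disc_poly_le1.
Qed.

Lemma le_eps_rate (x y k : R) : 0 <= k -> (forall e, 0 < e -> x <= y + k * e) -> x <= y.
Proof.
move=> k0 h; apply/ler_addgt0Pr => e e0.
have k1 : 0 < 1 + k by rewrite ltr_pwDl.
rewrite (le_trans (h (e / (1 + k)) _)) ?divr_gt0 // lerD2l mulrCA -[leRHS]mulr1.
by rewrite ler_wpM2l ?(ltW e0) // ler_pdivrMr // mul1r lerDr.
Qed.

(** The bound of [smooth_approx] depends on [N]. It is applied only to a much finer approximant [t],
    while the contraction property controls the difference of [t] and [s]; then the error of [t]
    tends to 0 with [N] fixed. *)
Lemma smooth_approx_uniform N s e z : approx s e -> disc z ->
  nc (smooth N (fun m n => (schoenberg m n)%:C) z - smooth N (normed_zcoef s) z) <= e.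
Proof.
move=> fs Dz; apply: (@le_eps_rate _ _ (1 + rate N)); first by rewrite addr_ge0 ?rate_ge0.
move=> e' e'0; have [t ft] := approx_exists e'0.
have h1 := smooth_approx N e'0 ft Dz.
have := smooth_contraction N (fun z => approxB ft fs) Dz.
have -> : smooth N (normed_zcoef (t ++ [seq (- u.1, u.2) | u <- s])) z
    = smooth N (normed_zcoef t) z - smooth N (normed_zcoef s) z.
  rewrite /smooth -sumrB; apply: eq_bigr => m _; rewrite -sumrB; apply: eq_bigr => n _.
  by rewrite /normed_zcoef zcoefB !mulrBl.
move=> h2; rewrite -[X in nc X](subrKA (smooth N (normed_zcoef t) z)).
rewrite (le_trans (modulusD _ _)) // (le_trans (lerD h1 h2)) //; lra.
Qed.

Lemma disc_fun_bounded : exists M : R, forall z, disc z -> nc (f z) <= M.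
Proof.
have [K K0 fK] := uniform_modulus fc ltr01.
exists (1 + K * 4 + nc (f 1)) => z Dz.
have D1 : disc (1 : C) by rewrite /disc /= normr1.
rewrite -[f z](subrK (f 1)) (le_trans (modulusD _ _)) // lerD2r.
rewrite (le_trans (fK _ _ Dz D1)) // lerD2l ler_wpM2l //.
have : nc (z - 1) <= 2.
  rewrite (le_trans (modulusB _ _)) // modulus1.
  have := (discE z).1 Dz; lra.
have := modulus_ge0 (z - 1); nra.
Qed.

Lemma smooth1 N : smooth N (fun m n => (schoenberg m n)%:C) 1
  = (\sum_(m < N.+1) \sum_(n < N.+1) schoenberg m n * (theta R a N m * theta R a N n))%:C.
Proof.
rewrite rmorph_sum; apply: eq_bigr => m _; rewrite rmorph_sum; apply: eq_bigr => n _.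
by rewrite disc_poly1 mulr1 -rmorphM.
Qed.

Lemma theta2_null m n : null (fun N => (theta R a N m * theta R a N n)%:C - 1 : C).
Proof.
have b : ubounded (fun _ : unit => True) (fun N _ => (theta R a N m)%:C : R[i]).
  by exists 1 => N _ _; rewrite modulus_real ger0_norm ?theta_ge0 ?theta_le1.
have h := unullD (unull_mul b (@theta_null R a n)) (@theta_null R a m).
rewrite /null; apply: eq_unull h => N _ _.
by rewrite rmorphM /=; ring.
Qed.

(** At 1 all disc polynomials equal 1, so the smoothed sums there are sums of nonnegative terms
    bounded by the supremum of [f]. For a fixed block of indices the multipliers tend to 1. *)
Lemma schoenberg_bounded :
  exists M : R, forall N, \sum_(m < N) \sum_(n < N) schoenberg m n <= M.
Proof.
have [M fM] := disc_fun_bounded; exists M => K.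
have D1 : disc (1 : C) by rewrite /disc /= normr1.
have M0 : 0 <= M by rewrite (le_trans (modulus_ge0 _) (fM 1 D1)).
have TM N : nc (smooth N (fun m n => (schoenberg m n)%:C) 1) <= M.
  apply: (@le_eps_rate _ _ 2) => // e e0; have [s fs] := approx_exists e0.
  have h1 := smooth_approx_uniform N fs D1.
  have h2 : nc (smooth N (normed_zcoef s) 1) <= M + e.
    apply: smooth_contraction => // z Dz.
    rewrite -[zpoly s z](subKr (f z)) (le_trans (modulusB _ _)) //.
    by rewrite lerD ?fM ?fs.
  rewrite -[smooth N _ 1](subrK (smooth N (normed_zcoef s) 1)).
  by rewrite (le_trans (modulusD _ _)) //; lra.
have S0 : 0 <= \sum_(m < K) \sum_(n < K) schoenberg m n.
  by apply: sumr_ge0 => m _; apply: sumr_ge0 => n _; exact: schoenberg_ge0.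
suff : nc (\sum_(m < K) \sum_(n < K) schoenberg m n)%:C <= M * nc 1.
  by rewrite modulus_real ger0_norm // modulus1 mulr1.
apply: (@null_le _ (fun N => (\sum_(m < K) \sum_(n < K) schoenberg m n * (theta R a (N + K) m * theta R a (N + K) n))%:C) (fun _ => 1)) => //.
- have shift m n : null (fun N => (theta R a (N + K) m * theta R a (N + K) n)%:C - 1 : C).
    move=> e /(theta2_null m n)[N0 HN]; exists N0 => N NN t _.
    by apply: (HN (N + K)%N _ t I); rewrite (leq_trans NN) ?leq_addr.
  have := unull_sum (index_enum 'I_K) (P := xpredT) (fun (m : 'I_K) _ =>
    unull_sum (index_enum 'I_K) (P := xpredT) (fun (n : 'I_K) _ =>
      unull_mul (ubounded_cst (fun _ : unit => True) (schoenberg m n)%:C) (shift m n))).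
  apply: eq_unull => N _ _ /=; rewrite -rmorphB -sumrB rmorph_sum; apply: eq_bigr => m _.
  rewrite -sumrB rmorph_sum; apply: eq_bigr => n _.
  by rewrite -[X in _ - X](mulr1 (schoenberg m n)) -mulrBr rmorphM rmorphB.
- by apply: eq_unull (unull0 _) => L _ _; rewrite subrr.
move=> N; rewrite modulus1 mulr1 (le_trans _ (TM (N + K)%N)) // smooth1 !modulus_real.
have t0 m n : 0 <= schoenberg m n * (theta R a (N + K) m * theta R a (N + K) n).
  by rewrite mulr_ge0 ?schoenberg_ge0 //; have /andP[] := theta2_bound (N + K) m n.
rewrite !ger0_norm; [|by apply: sumr_ge0 => m _; apply: sumr_ge0..].
have KN : (K <= (N + K).+1)%N by rewrite leqW // leq_addl.
rewrite (sum_sq_widen (fun m n => schoenberg m n * (theta R a (N + K) m * theta R a (N + K) n)) KN).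
by apply: ler_sum => m _; apply: ler_sum => n _; case: ifP.
Qed.

End SchoenbergExpansion.

(** * Convergence of the expansion *)

Section Convergence.
Variables (R : realType) (a : nat).
Local Notation C := R[i].
Local Notation nc := (@modulus R).
Local Open Scope complex_scope.
Local Open Scope classical_set_scope.
Local Notation Rp := (@disc_poly R a%:R).
Implicit Types (m n N : nat) (z : C).
Local Notation sq := (sqnorm R a).
Local Opaque disc_poly.

Lemma sum_sq_le (F : nat -> nat -> R) K N : (forall m n, 0 <= F m n) -> (K <= N)%N ->
  \sum_(m < K) \sum_(n < K) F m n <= \sum_(m < N) \sum_(n < N) F m n.
Proof.
move=> F0 KN; rewrite (sum_sq_widen F KN).
by apply: ler_sum => m _; apply: ler_sum => n _; case: ifP.
Qed.

Lemma sum_sq_tail (F : nat -> nat -> R) (M e : R) : (forall m n, 0 <= F m n) ->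
  (forall N, \sum_(m < N) \sum_(n < N) F m n <= M) -> 0 < e ->
  exists K, forall N, (K <= N)%N ->
    \sum_(m < N) \sum_(n < N) F m n <= \sum_(m < K) \sum_(n < K) F m n + e.
Proof.
move=> F0 FM e0; pose S N := \sum_(m < N) \sum_(n < N) F m n.
have hS : has_sup (range S).
  by split; [exists (S 0%N), 0%N | exists M => _ [N _ <-]; exact: FM].
have [_ [K _ <-] SK] := sup_adherent e0 hS; exists K => N _.
have : S N <= sup (range S) by apply: sup_upper_bound => //; exists N.
by rewrite -/(S N) -/(S K); lra.
Qed.

Lemma sum_sq_diff (F : nat -> nat -> R) (G : nat -> nat -> C) K N : (K <= N)%N ->
  (forall m n, nc (G m n) <= F m n) ->
  nc (\sum_(m < N) \sum_(n < N) G m n - \sum_(m < K) \sum_(n < K) G m n)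
  <= \sum_(m < N) \sum_(n < N) F m n - \sum_(m < K) \sum_(n < K) F m n.
Proof.
move=> KN GF; rewrite (sum_sq_widen G KN) (sum_sq_widen F KN) -!sumrB.
rewrite (le_trans (modulus_sum _ _ _)) //; apply: ler_sum => m _; rewrite -!sumrB.
rewrite (le_trans (modulus_sum _ _ _)) //; apply: ler_sum => n _.
by case: ifP => _; rewrite ?subrr ?modulus0 // !subr0.
Qed.

Variable f : cplx R -> cplx R.
Hypothesis fc : {within disc (R := R), continuous f}.
Hypothesis fP : positive_definite (@sphere R a.+2) (fun x y => f (dotmx x y)).
Local Notation A := (schoenberg a f).

(** A polynomial [s] close to [f] is interposed: smoothing changes the error of [s] little,
    uniformly in [N], and converges on [s] itself because its expansion is finite. *)
Lemma smooth_cvg z : disc z -> null (fun N => smooth a N (fun m n => (A m n)%:C) z - f z).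
Proof.
move=> Dz; apply/nullP => e e0; have e3 : 0 < e / 3 by rewrite divr_gt0.
have [s fs] := approx_exists fc e3.
have [N0 sN0] := zpoly_degree s.
have [N1 HN1] : exists N1, forall N, (N1 <= N)%N ->
    nc (\sum_(m < N0) \sum_(n < N0) normed_zcoef a s m n * ((theta R a N m * theta R a N n)%:C - 1) * Rp m n z) <= e / 3.
  have := unull_sum (index_enum 'I_N0) (P := xpredT) (fun (m : 'I_N0) _ =>
    unull_sum (index_enum 'I_N0) (P := xpredT) (fun (n : 'I_N0) _ =>
      unull_mul (ubounded_cst (fun _ : unit => True) (normed_zcoef a s m n * Rp m n z)) (@theta2_null R a m n))).
  move=> /(_ _ e3)[N1 H]; exists N1 => N /H /(_ tt I); congr (nc _ <= _).
  by apply: eq_bigr => m _; apply: eq_bigr => n _; rewrite mulrAC.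
exists (maxn N0 N1) => N; rewrite geq_max => /andP[N0N N1N].
have h1 := smooth_approx_uniform fc fP N fs Dz.
have h3 := fs z Dz.
have h2 : nc (smooth a N (normed_zcoef a s) z - zpoly s z) <= e / 3.
  have N0N' : (N0 <= N.+1)%N by rewrite leqW.
  rewrite (_ : _ - _ = \sum_(m < N0) \sum_(n < N0) normed_zcoef a s m n * ((theta R a N m * theta R a N n)%:C - 1) * Rp m n z); first exact: HN1.
  rewrite (zpoly_expand a z sN0).
  have -> : smooth a N (normed_zcoef a s) z = \sum_(m < N0) \sum_(n < N0)
      normed_zcoef a s m n * (theta R a N m * theta R a N n)%:C * Rp m n z.
    rewrite (sum_sq_widen (fun m n => normed_zcoef a s m n * (theta R a N m * theta R a N n)%:C * Rp m n z) N0N').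
    apply: eq_bigr => m _; apply: eq_bigr => n _; case: ifPn => //.
    rewrite negb_and -!leqNgt => h.
    by rewrite /normed_zcoef (zcoef_eq0 a sN0 h) !mul0r.
  rewrite -sumrB; apply: eq_bigr => m _; rewrite -sumrB; apply: eq_bigr => n _.
  by rewrite mulrBr mulr1 mulrBl.
rewrite -(subrKA (smooth a N (normed_zcoef a s) z)) -[X in _ + X](subrKA (zpoly s z)).
rewrite (le_trans (modulusD _ _)) //.
have := modulusD (smooth a N (normed_zcoef a s) z - zpoly s z) (zpoly s z - f z).
by rewrite (modulusBC (zpoly s z)); lra.
Qed.

(** Removal of the multipliers by dominated convergence: outside a finite block the coefficients sum
    to at most [e / 3], and inside it the multipliers tend to 1. *)
Lemma schoenberg_cvg z : disc z ->
  null (fun N => \sum_(m < N) \sum_(n < N) (A m n)%:C * Rp m n z - f z).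
Proof.
move=> Dz; apply/nullP => e e0; have e3 : 0 < e / 3 by rewrite divr_gt0.
have A0 := schoenberg_ge0 fc fP.
have [M AM] := schoenberg_bounded fc fP.
have [K HK] := sum_sq_tail A0 AM e3.
have [N1 HN1] := (nullP _).1 (smooth_cvg Dz) _ e3.
have [N2 HN2] : exists N2, forall N, (N2 <= N)%N ->
    \sum_(m < K) \sum_(n < K) A m n * (1 - theta R a N m * theta R a N n) <= e / 3.
  have := unull_sum (index_enum 'I_K) (P := xpredT) (fun (m : 'I_K) _ =>
    unull_sum (index_enum 'I_K) (P := xpredT) (fun (n : 'I_K) _ =>
      unull_mul (ubounded_cst (fun _ : unit => True) (- (A m n)%:C)) (@theta2_null R a m n))).
  move=> /(_ _ e3)[N2 H]; exists N2 => N /H /(_ tt I); apply: le_trans.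
  rewrite [X in nc X](_ : _ = (\sum_(m < K) \sum_(n < K) A m n * (1 - theta R a N m * theta R a N n))%:C).
    by rewrite modulus_real ler_norm.
  rewrite rmorph_sum; apply: eq_bigr => m _; rewrite rmorph_sum; apply: eq_bigr => n _.
  by rewrite -(rmorph1 (real_complex R)) -rmorphB -rmorphN -rmorphM; congr _%:C; ring.
(* The successor aligns the ranges: [smooth N] runs over indices below [N.+1]. *)
exists (maxn K (maxn N1 N2)).+1 => [[//|N]]; rewrite ltnS !geq_max => /and3P[KN N1N N2N].
have KN' : (K <= N.+1)%N by rewrite leqW.
have h1 := HN1 N N1N; have h2 := HN2 N N2N; have h3 := HK N.+1 KN'.
have h4 : nc (\sum_(m < N.+1) \sum_(n < N.+1) (A m n)%:C * Rp m n z - smooth a N (fun m n => (A m n)%:C) z)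
    <= \sum_(m < N.+1) \sum_(n < N.+1) A m n * (1 - theta R a N m * theta R a N n).
  rewrite /smooth -sumrB (le_trans (modulus_sum _ _ _)) //; apply: ler_sum => m _.
  rewrite -sumrB (le_trans (modulus_sum _ _ _)) //; apply: ler_sum => n _.
  rewrite -mulrBl -[X in X - _]mulr1 -mulrBr -mulrA.
  rewrite (modulusM (A m n)%:C) modulus_real ger0_norm ?A0 // ler_wpM2l ?A0 //.
  have /andP[t0 t1] := theta2_bound R a N m n.
  rewrite -(rmorph1 (real_complex R)) -rmorphB (modulusM (_ - _)%:C) modulus_real.
  by rewrite ger0_norm ?subr_ge0 // ler_piMr ?subr_ge0 // disc_poly_le1.
have h5 : \sum_(m < N.+1) \sum_(n < N.+1) A m n * (1 - theta R a N m * theta R a N n)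
    <= \sum_(m < K) \sum_(n < K) A m n * (1 - theta R a N m * theta R a N n) + e / 3.
  have t01 m n := theta2_bound R a N m n.
  have FG m n : nc (A m n * (1 - theta R a N m * theta R a N n))%:C <= A m n.
    have /andP[t0 t1] := t01 m n.
    have p0 : 0 <= A m n * (1 - theta R a N m * theta R a N n).
      by rewrite mulr_ge0 ?A0 // subr_ge0.
    by rewrite modulus_real (ger0_norm p0) ler_piMr ?A0 // lerBlDr lerDl.
  have := sum_sq_diff KN' FG.
  have -> : \sum_(m < N.+1) \sum_(n < N.+1) (A m n * (1 - theta R a N m * theta R a N n))%:C
     - \sum_(m < K) \sum_(n < K) (A m n * (1 - theta R a N m * theta R a N n))%:C
    = (\sum_(m < N.+1) \sum_(n < N.+1) A m n * (1 - theta R a N m * theta R a N n)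
     - \sum_(m < K) \sum_(n < K) A m n * (1 - theta R a N m * theta R a N n))%:C.
    rewrite rmorphB !rmorph_sum; congr (_ - _); apply: eq_bigr => m _; exact/esym/rmorph_sum.
  rewrite modulus_real => /(le_trans (ler_norm _)); lra.
rewrite -[X in nc X](subrKA (smooth a N (fun m n => (A m n)%:C) z)).
rewrite (le_trans (modulusD _ _)) //; lra.
Qed.

End Convergence.

(** * Differentiation of the expansion *)

Section Derivative.
Variables (R : realType) (a : nat).
Local Notation C := R[i].
Local Notation nc := (@modulus R).
Local Open Scope complex_scope.
Local Open Scope classical_set_scope.
Local Notation Rp := (@disc_poly R a%:R).
Implicit Types (m n N : nat) (z w : C).
Local Opaque disc_poly.

(** A second-order Taylor inequality with one constant on the closed disc; [g1] and [g2] act as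
    derivatives in [z] and [conj z]. This form makes sense on the boundary and is stable under sums
    and products. *)
Definition wirtinger (g g1 g2 : C -> C) : Prop :=
  exists2 B : R, 0 <= B &
    (forall z, disc z -> [/\ nc (g z) <= B, nc (g1 z) <= B & nc (g2 z) <= B]) /\
    forall z w, disc z -> disc w ->
      nc (g w - g z - g1 z * (w - z) - g2 z * (w - z)^*%C) <= B * nc (w - z) ^+ 2.

Lemma wirtinger_ext g g1 g2 h h1 h2 :
  (forall z, g z = h z) -> (forall z, g1 z = h1 z) -> (forall z, g2 z = h2 z) ->
  wirtinger h h1 h2 -> wirtinger g g1 g2.
Proof.
move=> e e1 e2 [B B0 [b r]]; exists B => //; split => [z Dz|z w Dz Dw].
  by rewrite e e1 e2; exact: b.
by rewrite !e e1 e2; exact: r.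
Qed.

Lemma disc_dist z w : disc z -> disc w -> nc (w - z) <= 2.
Proof.
by move=> /discE z1 /discE w1; have := modulusB w z; lra.
Qed.

Lemma wirtinger_cst (c : C) : wirtinger (fun=> c) (fun=> 0) (fun=> 0).
Proof.
exists (nc c); first exact: modulus_ge0.
split => [z _|z w _ _]; first by rewrite modulus0 modulus_ge0.
by rewrite !mul0r !subr0 subrr modulus0 mulr_ge0 ?exprn_ge0 ?modulus_ge0.
Qed.

Lemma wirtinger_id : wirtinger (fun z => z) (fun=> 1) (fun=> 0).
Proof.
exists 1 => //; split => [z /discE Dz|z w _ _]; first by rewrite modulus0 modulus1.
by rewrite mul1r mul0r subr0 subrr modulus0 mulr_ge0 ?exprn_ge0 ?modulus_ge0.
Qed.

Lemma wirtinger_conj : wirtinger (fun z => z^*%C) (fun=> 0) (fun=> 1).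
Proof.
exists 1 => //; split => [z /discE Dz|z w _ _]; first by rewrite modulus0 modulus1 modulus_conj.
by rewrite mul1r mul0r subr0 conjcB subrr modulus0 mulr_ge0 ?exprn_ge0 ?modulus_ge0.
Qed.

Lemma wirtingerD g g1 g2 h h1 h2 : wirtinger g g1 g2 -> wirtinger h h1 h2 ->
  wirtinger (fun z => g z + h z) (fun z => g1 z + h1 z) (fun z => g2 z + h2 z).
Proof.
move=> [B B0 [b r]] [B' B'0 [b' r']]; exists (B + B'); first exact: addr_ge0.
split => [z Dz|z w Dz Dw].
  have [? ? ?] := b z Dz; have [? ? ?] := b' z Dz.
  by split => /=; rewrite (le_trans (modulusD _ _)) // lerD.
rewrite [leRHS]mulrDl; set u := (X in nc X <= _).
have -> : u = (g w - g z - g1 z * (w - z) - g2 z * (w - z)^*%C)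
   + (h w - h z - h1 z * (w - z) - h2 z * (w - z)^*%C) by rewrite /u; ring.
by rewrite (le_trans (modulusD _ _)) // lerD ?r ?r'.
Qed.

Lemma wirtingerM g g1 g2 h h1 h2 : wirtinger g g1 g2 -> wirtinger h h1 h2 ->
  wirtinger (fun z => g z * h z) (fun z => g1 z * h z + g z * h1 z)
            (fun z => g2 z * h z + g z * h2 z).
Proof.
(* Two remainders cost [B * B'] each, and the product of the increments [4 B * 4 B']; the factor 4
   arises because the disc has diameter 2. *)
move=> [B B0 [b r]] [B' B'0 [b' r']]; exists (18 * (B * B')); first by rewrite !mulr_ge0.
have BB : 0 <= B * B' by exact: mulr_ge0.
have le2 (x y : C) : nc x <= B -> nc y <= B' -> nc (x * y) <= B * B'.
  by move=> ? ?; rewrite modulusM ler_pM ?modulus_ge0.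
split => [z Dz|z w Dz Dw].
  have [h0 h1' h2'] := b z Dz; have [k0 k1 k2] := b' z Dz.
  split; first by rewrite (le_trans (le2 _ _ h0 k0)) //; lra.
    by rewrite (le_trans (modulusD _ _)) // (le_trans (lerD (le2 _ _ h1' k0) (le2 _ _ h0 k1))) //; lra.
  by rewrite (le_trans (modulusD _ _)) // (le_trans (lerD (le2 _ _ h2' k0) (le2 _ _ h0 k2))) //; lra.
have incr (k k1 k2 : C -> C) (K : R) : 0 <= K -> nc (k1 z) <= K -> nc (k2 z) <= K ->
    nc (k w - k z - k1 z * (w - z) - k2 z * (w - z)^*%C) <= K * nc (w - z) ^+ 2 ->
    nc (k w - k z) <= 4 * K * nc (w - z).
  move=> K0 h1' h2' h3.
  have -> : k w - k z = (k w - k z - k1 z * (w - z) - k2 z * (w - z)^*%C)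
     + (k1 z * (w - z) + k2 z * (w - z)^*%C) by ring.
  rewrite (le_trans (modulusD _ _)) // (le_trans (lerD h3 (modulusD _ _))) //.
  rewrite !modulusM modulus_conj.
  have d0 := modulus_ge0 (w - z); have d2 := disc_dist Dz Dw.
  have e1 : nc (k1 z) * nc (w - z) <= K * nc (w - z) by rewrite ler_wpM2r.
  have e2 : nc (k2 z) * nc (w - z) <= K * nc (w - z) by rewrite ler_wpM2r.
  have e3 : K * nc (w - z) ^+ 2 <= K * (2 * nc (w - z)).
    by rewrite ler_wpM2l // expr2 ler_wpM2r.
  lra.
have [h0 h1' h2'] := b z Dz; have [k0 k1 k2] := b' z Dz.
have i1 := incr _ _ _ _ B0 h1' h2' (r z w Dz Dw).
have i2 := incr _ _ _ _ B'0 k1 k2 (r' z w Dz Dw).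
set u := (X in nc X <= _).
have -> : u = (g z * (h w - h z - h1 z * (w - z) - h2 z * (w - z)^*%C)
   + (g w - g z - g1 z * (w - z) - g2 z * (w - z)^*%C) * h z)
   + (g w - g z) * (h w - h z) by rewrite /u; ring.
rewrite (le_trans (modulusD _ _)) // (le_trans (lerD (modulusD _ _) (lexx _))) // !modulusM.
have e1 : nc (g z) * nc (h w - h z - h1 z * (w - z) - h2 z * (w - z)^*%C) <= B * (B' * nc (w - z) ^+ 2).
  by rewrite ler_pM ?modulus_ge0 ?r'.
have e2 : nc (g w - g z - g1 z * (w - z) - g2 z * (w - z)^*%C) * nc (h z) <= B * nc (w - z) ^+ 2 * B'.
  by rewrite ler_pM ?modulus_ge0 ?r.
have e3 : nc (g w - g z) * nc (h w - h z) <= (4 * B * nc (w - z)) * (4 * B' * nc (w - z)).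
  by rewrite ler_pM ?modulus_ge0.
rewrite (le_trans (lerD (lerD e1 e2) e3)) // le_eqVlt; apply/orP; left; apply/eqP; ring.
Qed.

Lemma wirtinger_sum (I : Type) (s : seq I) (g g1 g2 : I -> C -> C) :
  (forall i, wirtinger (g i) (g1 i) (g2 i)) ->
  wirtinger (fun z => \sum_(i <- s) g i z) (fun z => \sum_(i <- s) g1 i z)
            (fun z => \sum_(i <- s) g2 i z).
Proof.
move=> H; elim: s => [|i s IH].
  by apply: wirtinger_ext (wirtinger_cst 0) => z; rewrite big_nil.
by apply: wirtinger_ext (wirtingerD (H i) IH) => z; rewrite big_cons.
Qed.

Lemma wirtinger_monom m n :
  wirtinger (monom m n) (fun z => m%:R * monom m.-1 n z) (fun z => n%:R * monom m n.-1 z).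
Proof.
have pw k : wirtinger (fun z => z ^+ k) (fun z => k%:R * z ^+ k.-1) (fun=> 0).
  elim: k => [|k IH].
    by apply: wirtinger_ext (wirtinger_cst 1) => z; rewrite ?expr0 ?mul0r.
  apply: wirtinger_ext (wirtingerM wirtinger_id IH) => z /=; rewrite ?exprS //.
    by case: k {IH} => [|k]; rewrite /= ?mul0r ?expr0 -?natr1 ?exprS; ring.
  by ring.
have pc k : wirtinger (fun z => (z^*%C) ^+ k) (fun=> 0) (fun z => k%:R * (z^*%C) ^+ k.-1).
  elim: k => [|k IH].
    by apply: wirtinger_ext (wirtinger_cst 1) => z; rewrite ?expr0 ?mul0r.
  apply: wirtinger_ext (wirtingerM wirtinger_conj IH) => z /=; rewrite ?exprS //.
    by ring.
  by case: k {IH} => [|k]; rewrite /= ?mul0r ?expr0 -?natr1 ?exprS; ring.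
by apply: wirtinger_ext (wirtingerM (pw m) (pc n)) => z; rewrite /monom //; ring.
Qed.

Definition dz_coef m n : R := m%:R * (n + a).+1%:R / a.+1%:R.
Definition dzbar_coef m n : R := n%:R * (m + a).+1%:R / a.+1%:R.

Lemma dz_coef_ge0 m n : 0 <= dz_coef m n.
Proof. by rewrite /dz_coef divr_ge0 ?mulr_ge0. Qed.

Lemma dzbar_coef_ge0 m n : 0 <= dzbar_coef m n.
Proof. by rewrite /dzbar_coef divr_ge0 ?mulr_ge0. Qed.

Lemma zernike_dz m n i : (i <= m)%N -> (i <= n)%N ->
  zernike R a m.+1 n i * (m.+1 - i)%:R = dz_coef m.+1 n * zernike R a.+1 m n i.
Proof.
move=> im iN; rewrite /zernike /dz_coef (subSn im).
have FS k : k.+1`!%:R = k.+1%:R * k`!%:R :> R by rewrite factS natrM.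
rewrite (_ : (m.+1 + n - i + a = m + n - i + a.+1)%N); last by lia.
rewrite (_ : (m.+1 + a = m + a.+1)%N); last by lia.
rewrite (_ : (n + a.+1 = (n + a).+1)%N); last by lia.
rewrite (FS m) (FS a) (FS (n + a)%N) (FS (m - i)%N).
have n1 : (m - i).+1%:R != 0 :> R by rewrite pnatr_eq0.
have n2 : (n + a).+1%:R != 0 :> R by rewrite pnatr_eq0.
have n3 : a.+1%:R != 0 :> R by rewrite pnatr_eq0.
have gen (x1 x2 x3 x4 x5 x6 x7 x8 x9 y1 y2 y3 y4 s : R) : y1 != 0 -> y2 != 0 -> y3 != 0 ->
   x4 != 0 -> x5 != 0 -> x7 != 0 -> x8 != 0 -> x9 != 0 ->
   y4 * x1 * x2 * x3 / (x4 * x5) * (s * x6 / (x7 * (y1 * x8) * x9)) * y1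
   = y4 * y2 / y3 * (x1 * x2 * (y3 * x3) / (x4 * (y2 * x5)) * (s * x6 / (x7 * x8 * x9))).
  by move=> ? ? ? ? ? ? ? ?; field; do ?(apply/andP; split).
by apply: gen; rewrite ?factr_neq0.
Qed.

Lemma zernike_dzbar m n i : (i <= m)%N -> (i <= n)%N ->
  zernike R a m n.+1 i * (n.+1 - i)%:R = dzbar_coef m n.+1 * zernike R a.+1 m n i.
Proof. by move=> im iN; rewrite zernikeC zernike_dz // zernikeC. Qed.

(** Monomials are differentiated one by one. For [m = 0] the index [m.-1] is only a default value,
    harmless because [dz_coef] is then 0; likewise for [n]. *)
Lemma wirtinger_disc_poly m n :
  wirtinger (Rp m n) (fun z => (dz_coef m n)%:C * disc_poly a.+1%:R m.-1 n z)
    (fun z => (dzbar_coef m n)%:C * disc_poly a.+1%:R m n.-1 z).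
Proof.
have := wirtinger_sum (index_enum 'I_(minn m n).+1) (fun i : 'I_(minn m n).+1 =>
  wirtingerM (wirtinger_cst (zernike R a m n i)%:C) (wirtinger_monom (m - i) (n - i))).
apply: wirtinger_ext => z; first by rewrite disc_poly_zernike.
  rewrite disc_poly_zernike.
  case: m => [|m]; first by rewrite /dz_coef !mul0r big1 // => i _; rewrite !mul0r mulr0 addr0.
  have mM : ((minn m n).+1 <= (minn m.+1 n).+1)%N by lia.
  rewrite [\sum_(i < (minn m.+1.-1 n).+1) _](big_ord_widen (minn m.+1 n).+1
    (fun i => (zernike R a.+1 m n i)%:C * monom (m - i) (n - i) z)) // big_mkcond mulr_sumr.
  apply: eq_bigr => i _; rewrite mul0r add0r mulrA -(rmorph_nat (real_complex R)) -rmorphM.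
  rewrite ltnS leq_min; have [im|mi] := leqP i m; last first.
    have -> : (m.+1 - i = 0)%N by lia.
    by rewrite !mulr0 rmorph0 mul0r.
  have iN : (i <= n)%N by have := ltn_ord i; lia.
  by rewrite iN zernike_dz // (subSn im) /= mulrA -rmorphM.
rewrite disc_poly_zernike.
case: n => [|n]; first by rewrite /dzbar_coef !mul0r big1 // => i _; rewrite !mul0r mulr0 addr0.
have mM : ((minn m n).+1 <= (minn m n.+1).+1)%N by lia.
rewrite [\sum_(i < (minn m n.+1.-1).+1) _](big_ord_widen (minn m n.+1).+1
  (fun i => (zernike R a.+1 m n i)%:C * monom (m - i) (n - i) z)) // big_mkcond mulr_sumr.
apply: eq_bigr => i _; rewrite mul0r add0r mulrA -(rmorph_nat (real_complex R)) -rmorphM.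
rewrite ltnS leq_min; have [iN|ni] := leqP i n; last first.
  have -> : (n.+1 - i = 0)%N by lia.
  by rewrite andbF !mulr0 rmorph0 mul0r.
have im : (i <= m)%N by have := ltn_ord i; lia.
by rewrite im zernike_dzbar // (subSn iN) /= mulrA -rmorphM.
Qed.

(** Some valid Taylor constant for each pair of indices, without control of its growth; later
    estimates involve only finitely many of these at a time. *)
Definition quad_coef m n : R := xget 0 [set B : R | 0 <= B /\ forall z w, disc z -> disc w ->
  nc (Rp m n w - Rp m n z - (dz_coef m n)%:C * disc_poly a.+1%:R m.-1 n z * (w - z)
      - (dzbar_coef m n)%:C * disc_poly a.+1%:R m n.-1 z * (w - z)^*%C) <= B * nc (w - z) ^+ 2].

Lemma quad_coefP m n : 0 <= quad_coef m n /\ forall z w, disc z -> disc w ->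
  nc (Rp m n w - Rp m n z - (dz_coef m n)%:C * disc_poly a.+1%:R m.-1 n z * (w - z)
      - (dzbar_coef m n)%:C * disc_poly a.+1%:R m n.-1 z * (w - z)^*%C)
  <= quad_coef m n * nc (w - z) ^+ 2.
Proof.
rewrite /quad_coef; set P := [set B : R | _]; suff /(@xgetPex _ 0 P) : exists B, P B by [].
by have [B B0 [_ H]] := wirtinger_disc_poly m n; exists B; split.
Qed.

(* Halving the step divides the quadratic term by two and keeps the linear one. *)
Lemma lipschitz_bisection (g : C -> C) (A B : R) : 0 <= B ->
  (forall z w, disc z -> disc w -> nc (g w - g z) <= A * nc (w - z) + B * nc (w - z) ^+ 2) ->
  forall z w, disc z -> disc w -> nc (g w - g z) <= A * nc (w - z).
Proof.
move=> B0 H.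
have Hk k : forall z w, disc z -> disc w ->
    nc (g w - g z) <= A * nc (w - z) + B / 2 ^+ k * nc (w - z) ^+ 2.
  elim: k => [|k IH] z w Dz Dw; first by rewrite expr0 divr1; exact: H.
  pose u := (z + w) / 2.
  have t2 : 2^-1 + 2^-1 = 1 :> C by rewrite [RHS]splitr !mul1r.
  have uz : u - z = 2^-1 * (w - z) by move: t2; rewrite /u; move: 2^-1 => t h; rewrite -[X in _ - X]mulr1 -h; ring.
  have wu : w - u = 2^-1 * (w - z) by move: t2; rewrite /u; move: 2^-1 => t h; rewrite -[X in X - _]mulr1 -h; ring.
  have n2 : nc (2^-1 * (w - z)) = nc (w - z) / 2 by rewrite modulusM modulusV modulus_nat mulrC.
  have Du : disc u.
    apply/discE; rewrite /u modulusM modulusV modulus_nat ler_pdivrMr // mul1r.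
    have := (discE z).1 Dz; have := (discE w).1 Dw; have := modulusD z w; lra.
  have h1 := IH _ _ Dz Du; have h2 := IH _ _ Du Dw.
  rewrite uz n2 in h1; rewrite wu n2 in h2.
  rewrite -(subrKA (g u)) (le_trans (modulusD _ _)) // (le_trans (lerD h2 h1)) //.
  rewrite le_eqVlt; apply/orP; left; apply/eqP; rewrite (exprS 2 k); field.
  by rewrite expf_neq0.
move=> z w Dz Dw; apply/ler_addgt0Pr => e e0.
pose c := B * nc (w - z) ^+ 2; have c0 : 0 <= c by rewrite mulr_ge0 ?exprn_ge0 ?modulus_ge0.
pose k := (Num.truncn (c / e)).+1.
rewrite (le_trans (Hk k z w Dz Dw)) // lerD2l mulrAC -/c ler_pdivrMr ?exprn_gt0 // mulrC.
rewrite -ler_pdivrMr // (le_trans (ltW (truncnS_gt _))) // -natrX ler_nat ltnW //.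
exact: ltn_expl.
Qed.

Definition slope m n : R := dz_coef m n + dzbar_coef m n.

Lemma slope_ge0 m n : 0 <= slope m n.
Proof. by rewrite addr_ge0 ?dz_coef_ge0 ?dzbar_coef_ge0. Qed.

Lemma disc_poly_succ_le1 m n z : disc z -> nc (disc_poly a.+1%:R m n z) <= 1.
Proof. exact: disc_poly_le1. Qed.

(** Both derivatives are multiples of disc polynomials of the next parameter, bounded by 1, so the
    linear term costs at most [slope m n] per unit length; bisection discards the quadratic term. *)
Lemma disc_poly_lipschitz m n z w : disc z -> disc w ->
  nc (Rp m n w - Rp m n z) <= slope m n * nc (w - z).
Proof.
have [B B0 [_ r]] := wirtinger_disc_poly m n.
move: z w; apply: (lipschitz_bisection B0) => z w Dz Dw.
have := r z w Dz Dw; set l1 := _%:C * _; set l2 := _%:C * _ => h.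
have -> : Rp m n w - Rp m n z = (Rp m n w - Rp m n z - l1 * (w - z) - l2 * (w - z)^*%C)
   + (l1 * (w - z) + l2 * (w - z)^*%C).
  by move: (Rp m n w) (Rp m n z) => u v; ring.
rewrite (le_trans (modulusD _ _)) // addrC lerD // (le_trans (modulusD _ _)) //.
rewrite !(modulusM l1) !(modulusM l2) modulus_conj mulrDl.
have b k m' n' : 0 <= k -> nc (k%:C * disc_poly a.+1%:R m' n' z) <= k.
  move=> k0; rewrite (modulusM k%:C) modulus_real ger0_norm // ler_piMr //.
  exact: disc_poly_succ_le1.
by rewrite lerD // ler_wpM2r ?modulus_ge0 // b ?dz_coef_ge0 ?dzbar_coef_ge0.
Qed.

Variable f : cplx R -> cplx R.

Lemma has_partials_modulus z d (e : R) : has_partials f z d -> 0 < e ->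
  exists2 r : R, 0 < r & forall w, disc w -> nc (w - z) < r ->
    nc (f w - f z - (complex.Re (w - z))%:C * d.1 - (complex.Im (w - z))%:C * d.2)
    <= e * nc (w - z).
Proof.
move=> /cvgrPdist_le h e0; have := h e%:C; rewrite ltcR => /(_ e0).
rewrite !near_withinE => /nbhs_ballP[r /= r0 rf].
have rE : r = (complex.Re r)%:C by rewrite RRe_real // gtr0_real.
exists (complex.Re r) => [|w Dw wr]; first by rewrite -ltcR -rE.
have [->|wz] := eqVneq w z.
  by rewrite !subrr /= !mul0r !subr0 modulus0 mulr0.
have := rf w; rewrite -ball_normE /ball_ /= modulusE rE ltcR -(modulusBC w) => /(_ wr wz Dw).
rewrite sub0r normrN le_modulus modulusM modulusV ler_pdivrMr //.
by rewrite lt_neqAle modulus_ge0 eq_sym modulus_eq0 subr_eq0 wz.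
Qed.

Variable A : nat -> nat -> R.
Hypothesis A0 : forall m n, 0 <= A m n.
Hypothesis fA : forall z, disc z ->
  null (fun N => \sum_(m < N) \sum_(n < N) (A m n)%:C * Rp m n z - f z).

Lemma null_le_real (u : nat -> C) (c : C) (r : R) : null (fun N => u N - c) ->
  (exists N, forall L, (N <= L)%N -> r <= nc (u L)) -> r <= nc c.
Proof.
move=> /nullP u0 [N H]; apply/ler_addgt0Pr => e /u0[M HM].
have := H _ (leq_maxl N M); have := HM _ (leq_maxr N M).
move: (maxn _ _) => L; have := modulusD (u L - c) c; rewrite subrK; lra.
Qed.

Lemma small_step (r e B : R) : 0 < r -> 0 < e -> 0 <= B ->
  exists t : R, [/\ 0 < t, t <= 1, t < r & B * t <= e].
Proof.
move=> r0 e0 B0; have B1 : 0 < B + 1 by rewrite ltr_wpDl.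
exists (Num.min 1 (Num.min (r / 2) (e / (B + 1)))); split.
- by rewrite !lt_min ltr01 !divr_gt0.
- by rewrite ge_min lexx.
- by rewrite !gt_min ltr_pdivrMr // mulr_natr mulr2n ltrDl r0 orbT.
set t := Num.min _ _; have : t <= e / (B + 1) by rewrite !ge_min lexx !orbT.
rewrite ler_pdivlMr // => h; have : 0 <= t by rewrite !le_min ler01 !divr_ge0 // ltW.
lra.
Qed.

(* Fatou: on [0, 1] the difference quotients of all terms at [1] are
   nonnegative, and those of [f] converge. *)
Lemma slope_sum_bounded d : has_partials f 1 d ->
  forall N, \sum_(m < N) \sum_(n < N) A m n * slope m n <= nc d.1.
Proof.
move=> fd N; have D1 : disc (1 : C) by rewrite /disc /= normr1.
have Dr (r : R) : 0 <= r <= 1 -> disc (r%:C : C).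
  by move=> /andP[r0 r1]; apply/discE; rewrite modulus_real ger0_norm.
(* At 1 the derivatives are exactly the two coefficients, so along the radius [1 - Rp m n r] is
   [slope m n * (1 - r)] up to second order. *)
have BmP m n (r : R) : 0 <= r <= 1 ->
  slope m n * (1 - r) - quad_coef m n * (1 - r) ^+ 2 <= complex.Re (1 - Rp m n r%:C).
  move=> r01; have [_ H] := quad_coefP m n.
  have := H 1 r%:C D1 (Dr r r01); rewrite !disc_poly1 !mulr1.
  have -> : (r%:C - 1 : C) = (r - 1)%:C by rewrite rmorphB.
  rewrite conjc_real modulus_real real_normK ?num_real //.
  have -> : Rp m n r%:C - 1 - (dz_coef m n)%:C * (r - 1)%:C - (dzbar_coef m n)%:C * (r - 1)%:C
    = (slope m n * (1 - r))%:C - (1 - Rp m n r%:C).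
    rewrite -!rmorphM /slope; have -> : (dz_coef m n + dzbar_coef m n) * (1 - r)
      = - (dz_coef m n * (r - 1)) - dzbar_coef m n * (r - 1) by ring.
    rewrite rmorphB rmorphN /=; move: (Rp _ _ _) => v; ring.
  move=> /(le_trans (Re_le_modulus _)); rewrite raddfB /= ler_norml => /andP[_].
  by rewrite -(sqrrN (r - 1)) opprB; lra.
have ReR0 m n (r : R) : 0 <= r <= 1 -> 0 <= complex.Re (1 - Rp m n r%:C).
  move=> r01; rewrite raddfB /= subr_ge0.
  rewrite (le_trans (ler_norm _)) // (le_trans (Re_le_modulus _)) //.
  exact: disc_poly_le1 (Dr r r01).
have Sf (r : R) : 0 <= r <= 1 ->
    \sum_(m < N) \sum_(n < N) A m n * complex.Re (1 - Rp m n r%:C) <= nc (f 1 - f r%:C).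
  move=> r01; apply: (null_le_real (u := fun L => \sum_(m < L) \sum_(n < L) (A m n)%:C * (1 - Rp m n r%:C))).
    apply: eq_unull (unullB (fA D1) (fA (Dr r r01))) => L _ _.
    have gen (x y p v : C) : x - y - (p - v) = x - p - (y - v) by ring.
    rewrite -gen; congr (_ - _); rewrite -sumrB; apply: eq_bigr => m _.
    by rewrite -sumrB; apply: eq_bigr => n _; rewrite disc_poly1; exact: mulrBr.
  exists N => L NL; apply: le_trans (le_trans (ler_norm _) (Re_le_modulus _)).
  rewrite raddf_sum /=.
  under [leRHS]eq_bigr => m _ do rewrite raddf_sum /=.
  have ReM m n : complex.Re ((A m n)%:C * (1 - Rp m n r%:C)) = A m n * complex.Re (1 - Rp m n r%:C).
    by move: (1 - _) => v; case: v => x y /=; rewrite mul0r subr0.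
  under [leRHS]eq_bigr => m _ do under eq_bigr => n _ do rewrite ReM.
  apply: (sum_sq_le (F := fun m n => A m n * complex.Re (1 - Rp m n r%:C))) NL => m n.
  by rewrite mulr_ge0 ?A0 ?ReR0.
set S := \sum_(m < N) _.
(* [N] is fixed before the step [t] shrinks, so this finite constant is harmless. *)
pose B := \sum_(m < N) \sum_(n < N) A m n * quad_coef m n.
have B0 : 0 <= B.
  apply: sumr_ge0 => m _; apply: sumr_ge0 => n _.
  by rewrite mulr_ge0 ?A0 //; have [] := quad_coefP m n.
apply/ler_addgt0Pr => e e0; have e2 : 0 < e / 2 by rewrite divr_gt0.
have [rho rho0 fr] := has_partials_modulus fd e2.
have [t [t0 t1 tr Bt]] := small_step rho0 e2 B0.
have t01 : 0 <= 1 - t <= 1 by apply/andP; split; lra.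
have h1 : S * t - B * t ^+ 2 <= nc (f 1 - f (1 - t)%:C).
  apply: le_trans (Sf _ t01); rewrite /S /B !mulr_suml -sumrB; apply: ler_sum => m _.
  rewrite !mulr_suml -sumrB; apply: ler_sum => n _.
  have := BmP m n _ t01; rewrite subKr -!mulrA -mulrBr => h.
  by rewrite ler_wpM2l ?A0.
have h2 : nc (f 1 - f (1 - t)%:C) <= e / 2 * t + t * nc d.1.
  have tE : ((1 - t)%:C - 1 : C) = (- t)%:C by rewrite rmorphB rmorphN addrAC subrr add0r.
  have := fr (1 - t)%:C (Dr _ t01); rewrite tE modulus_real normrN gtr0_norm // => /(_ tr).
  rewrite /= mul0r subr0 => h.
  have -> : f 1 - f (1 - t)%:C = - (f (1 - t)%:C - f 1 - (- t)%:C * d.1) + t%:C * d.1.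
    by rewrite rmorphN; ring.
  rewrite (le_trans (modulusD _ _)) // modulusN modulusM modulus_real gtr0_norm //.
  by rewrite lerD2r.
rewrite -(ler_pM2r t0); have : B * t ^+ 2 <= e / 2 * t by rewrite mulrA ler_wpM2r // ltW.
lra.
Qed.

End Derivative.

(** * Termwise differentiation on the closed disc *)

Section DerivativeExpansion.
Variables (R : realType) (a : nat).
Local Notation C := R[i].
Local Notation nc := (@modulus R).
Local Open Scope complex_scope.
Local Open Scope classical_set_scope.
Local Notation Rp := (@disc_poly R a%:R).
Local Notation Rs := (@disc_poly R a.+1%:R).
Implicit Types (m n N : nat) (z w : C).
Local Opaque disc_poly.
Variable f : cplx R -> cplx R.
Variable A : nat -> nat -> R.
Hypothesis A0 : forall m n, 0 <= A m n.
Hypothesis fA : forall z, disc z ->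
  null (fun N => \sum_(m < N) \sum_(n < N) (A m n)%:C * Rp m n z - f z).

Definition dz_sum N z : C := \sum_(m < N) \sum_(n < N) (A m n * dz_coef R a m n)%:C * Rs m.-1 n z.
Definition dzbar_sum N z : C := \sum_(m < N) \sum_(n < N) (A m n * dzbar_coef R a m n)%:C * Rs m n.-1 z.

Lemma null_real_le (u : nat -> C) (c : C) (r : R) : null (fun N => u N - c) ->
  (exists N, forall L, (N <= L)%N -> nc (u L) <= r) -> nc c <= r.
Proof.
move=> /nullP u0 [N H]; apply/ler_addgt0Pr => e /u0[M HM].
have := H _ (leq_maxl N M); have := HM _ (leq_maxr N M).
move: (maxn _ _) => L; have := modulusB (u L) (u L - c).
by rewrite opprB addrC subrK; lra.
Qed.

(** The Lipschitz constants of the omitted terms add up to at most [e], so the remainder of the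
    expansion is itself Lipschitz with constant [e]. *)
Lemma expansion_tail (e : R) N : (forall L, (N <= L)%N ->
    \sum_(m < L) \sum_(n < L) A m n * slope R a m n
    <= \sum_(m < N) \sum_(n < N) A m n * slope R a m n + e) ->
  forall z w, disc z -> disc w ->
  nc (f w - f z - (\sum_(m < N) \sum_(n < N) (A m n)%:C * Rp m n w
                   - \sum_(m < N) \sum_(n < N) (A m n)%:C * Rp m n z)) <= e * nc (w - z).
Proof.
move=> tail z w Dz Dw; pose S L z : C := \sum_(m < L) \sum_(n < L) (A m n)%:C * Rp m n z.
have SB L : S L w - S L z = \sum_(m < L) \sum_(n < L) (A m n)%:C * (Rp m n w - Rp m n z).
  rewrite -sumrB; apply: eq_bigr => m _; rewrite -sumrB; apply: eq_bigr => n _.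
  by apply/esym; exact: mulrBr.
rewrite -/(S N w) -/(S N z).
apply: (null_real_le (u := fun L => S L w - S L z - (S N w - S N z))).
  apply: eq_unull (unullB (fA Dw) (fA Dz)) => L _ _; rewrite -/(S L w) -/(S L z).
  have gen (x y p v s : C) : x - y - s - (p - v - s) = x - p - (y - v) by ring.
  exact: gen.
exists N => L NL; rewrite !SB.
have FG m n : nc ((A m n)%:C * (Rp m n w - Rp m n z)) <= A m n * slope R a m n * nc (w - z).
  rewrite (modulusM (A m n)%:C) modulus_real (ger0_norm (A0 m n)) -mulrA.
  by rewrite ler_wpM2l ?A0 //; exact: disc_poly_lipschitz.
apply: (le_trans (sum_sq_diff NL FG)).
have pull M : \sum_(m < M) \sum_(n < M) A m n * slope R a m n * nc (w - z)
    = (\sum_(m < M) \sum_(n < M) A m n * slope R a m n) * nc (w - z).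
  by rewrite mulr_suml; apply: eq_bigr => m _; rewrite mulr_suml.
by rewrite !pull -mulrBl ler_wpM2r ?modulus_ge0 // lerBlDl tail.
Qed.

Lemma expansion_quad N : exists2 B : R, 0 <= B & forall z w, disc z -> disc w ->
  nc (\sum_(m < N) \sum_(n < N) (A m n)%:C * Rp m n w
      - \sum_(m < N) \sum_(n < N) (A m n)%:C * Rp m n z
      - dz_sum N z * (w - z) - dzbar_sum N z * (w - z)^*%C) <= B * nc (w - z) ^+ 2.
Proof.
exists (\sum_(m < N) \sum_(n < N) A m n * quad_coef R a m n).
  apply: sumr_ge0 => m _; apply: sumr_ge0 => n _.
  by rewrite mulr_ge0 ?A0 //; have [] := quad_coefP R a m n.
move=> z w Dz Dw; rewrite /dz_sum /dzbar_sum !mulr_suml -!sumrB.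
rewrite (le_trans (modulus_sum _ _ _)) //; apply: ler_sum => m _.
rewrite !mulr_suml -!sumrB (le_trans (modulus_sum _ _ _)) //; apply: ler_sum => n _.
have [_ /(_ z w Dz Dw) h] := quad_coefP R a m n.
have gen (x y p u v s t k l : C) : x * p - x * u - x * s * v * k - x * t * y * l
   = x * (p - u - s * v * k - t * y * l) by ring.
rewrite !(rmorphM (real_complex R) (A m n)) /= gen (modulusM (A m n)%:C) modulus_real (ger0_norm (A0 m n)).
by rewrite -[leRHS]mulrA; apply: ler_wpM2l => //; exact: A0.
Qed.

Hypothesis slope_bound : exists M : R, forall N,
  \sum_(m < N) \sum_(n < N) A m n * slope R a m n <= M.

Lemma differential_approx z d (e : R) : disc z -> has_partials f z d -> 0 < e ->
  exists N0, forall N, (N0 <= N)%N -> forall u, disc u ->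
  nc (dz_sum N z * (u - z) + dzbar_sum N z * (u - z)^*%C
      - (complex.Re (u - z))%:C * d.1 - (complex.Im (u - z))%:C * d.2) <= 5 * e.
Proof.
move=> Dz fd e0; have [M SM] := slope_bound.
have As0 m n : 0 <= A m n * slope R a m n by rewrite mulr_ge0 ?A0 ?slope_ge0.
have [K HK] := sum_sq_tail As0 SM e0; exists K => N KN u Du.
have tail L : (N <= L)%N -> \sum_(m < L) \sum_(n < L) A m n * slope R a m n
    <= \sum_(m < N) \sum_(n < N) A m n * slope R a m n + e.
  move=> NL; apply: (le_trans (HK L (leq_trans KN NL))).
  by rewrite lerD2r; exact: (sum_sq_le (F := fun m n => A m n * slope R a m n)).
have [B B0 quad] := expansion_quad N.
have [rho rho0 fr] := has_partials_modulus fd e0.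
have r2 : 0 < rho / 2 by rewrite divr_gt0.
have B4 : 0 <= 4 * B by rewrite mulr_ge0.
(* [t] is chosen after [N]. Moving from [z] by [t v] with [|v| <= 2] costs [2 e t] for the
   differentiability of [f], [2 e t] for the tail and [4 B t^2 <= e t] for the partial sum; division
   by [t] leaves [5 e]. *)
have [t [t0 t1 tr Bt]] := small_step r2 e0 B4.
pose v := u - z; have v2 : nc v <= 2 by exact: disc_dist.
pose w := z + t%:C * v; have wz : w - z = t%:C * v by rewrite /w addrAC subrr add0r.
have Dw : disc w.
  apply/discE; have -> : w = (1 - t)%:C * z + t%:C * u.
    by rewrite /w /v rmorphB rmorph1; ring.
  rewrite (le_trans (modulusD _ _)) // !modulusM !modulus_real !ger0_norm ?subr_ge0 ?(ltW t0) //.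
  have e1 : (1 - t) * 1 + t * 1 = 1 :> R by ring.
  rewrite -[leRHS]e1; apply: lerD; apply: ler_wpM2l; rewrite ?subr_ge0 ?(ltW t0) //.
    exact/discE.
  exact/discE.
have nwz : nc (w - z) = t * nc v by rewrite wz modulusM modulus_real gtr0_norm.
have h1 := expansion_tail tail Dz Dw.
have h2 := quad _ _ Dz Dw.
have h3 : nc (w - z) < rho.
  rewrite nwz; have : t * nc v <= t * 2 by rewrite ler_wpM2l // ltW.
  lra.
have {}h3 := fr w Dw h3.
move: h1 h2 h3; set S := \sum_(m < N) _; set S' := \sum_(m < N) _.
set U := dz_sum N z; set V := dzbar_sum N z; rewrite nwz => h1 h2 h3.
have E : t%:C * (U * v + V * v^*%C - (complex.Re v)%:C * d.1 - (complex.Im v)%:C * d.2)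
  = (f w - f z - (complex.Re (w - z))%:C * d.1 - (complex.Im (w - z))%:C * d.2)
    - (f w - f z - (S - S')) - (S - S' - U * (w - z) - V * (w - z)^*%C).
  rewrite wz conjcM conjc_real.
  have -> : complex.Re (t%:C * v) = t * complex.Re v.
    by case: (v) => x y /=; rewrite mul0r subr0.
  have -> : complex.Im (t%:C * v) = t * complex.Im v.
    by case: (v) => x y /=; rewrite mul0r addr0.
  rewrite !(rmorphM (real_complex R)) /=.
  move: (f w) (f z) (S) (S') (U) (V) (v^*%C) (complex.Re v)%:C (complex.Im v)%:C (v) => *; ring.
rewrite -/v -(ler_pM2l t0) -[t in leLHS]ger0_norm ?(ltW t0) // -modulus_real -modulusM E.
rewrite (le_trans (modulusB _ _)) // (le_trans (lerD (modulusB _ _) (lexx _))) //.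
rewrite (le_trans (lerD (lerD h3 h1) h2)) //.
have tv : t * nc v <= t * 2 by rewrite ler_wpM2l // ltW.
have q1 : e * (t * nc v) <= e * (t * 2) by rewrite ler_wpM2l // ltW.
have q2 : B * (t * nc v) ^+ 2 <= B * (t * 2) ^+ 2.
  by rewrite ler_wpM2l // lerXn2r // nnegrE mulr_ge0 ?modulus_ge0 ?(ltW t0).
have q3 : 4 * B * t * t <= e * t by rewrite ler_wpM2r // ltW.
lra.
Qed.

Lemma wirtinger_sum_cvg z d : disc z -> has_partials f z d ->
  null (fun N => dz_sum N z - 2^-1 * (d.1 - 'i%C * d.2)) /\
  null (fun N => dzbar_sum N z - 2^-1 * (d.1 + 'i%C * d.2)).
Proof.
move=> Dz fd.
have key e : 0 < e -> exists N0, forall N, (N0 <= N)%N ->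
   nc (dz_sum N z + dzbar_sum N z - d.1) <= e /\
   nc ('i%C * (dz_sum N z - dzbar_sum N z) - d.2) <= e.
  move=> e0; have e5 : 0 < e / 5 by rewrite divr_gt0.
  have [N0 H] := differential_approx Dz fd e5; exists N0 => N /H.
  set U := dz_sum N z; set V := dzbar_sum N z => {}H.
  (* Both [u] and [- u] lie in the disc, and subtracting their two estimates eliminates the base
     point [z]. The directions 1 and ['i] then determine both derivatives. *)
  have main u : nc u = 1 ->
      nc (U * u + V * u^*%C - (complex.Re u)%:C * d.1 - (complex.Im u)%:C * d.2) <= e.
    move=> u1; have Du : disc u by apply/discE; rewrite u1.
    have Du' : disc (- u) by apply/discE; rewrite modulusN u1.
    have e5' : 5 * (e / 5) = e by field.
    have := lerD (H _ Du) (H _ Du'); rewrite e5' => /(le_trans (modulusB _ _)).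
    have cN : (- u)^*%C = - u^*%C by case: (u) => x y; apply/eqP; rewrite eq_complex /= !eqxx.
    have rN : (complex.Re (- u))%:C = - (complex.Re u)%:C :> C by rewrite -rmorphN; case: (u).
    have iN : (complex.Im (- u))%:C = - (complex.Im u)%:C :> C by rewrite -rmorphN; case: (u).
    rewrite !conjcB cN !raddfB /= rN iN.
    set X := (X in _ -> nc X <= _); set Y := (X in nc X <= _ -> _).
    have -> : Y = 2 * X by rewrite /X /Y; ring.
    by rewrite modulusM modulus_nat; lra.
  have n1 : nc 1 = 1 :> R by exact: modulus1.
  have ni : nc 'i%C = 1 :> R by rewrite /modulus normc_def /= expr0n expr1n add0r sqrtr1.
  split.
    have := main _ n1; congr (nc _ <= _).
    by rewrite conjc1 /= rmorph1 rmorph0; ring.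
  have := main _ ni; congr (nc _ <= _).
  have -> : ('i^*)%C = - 'i%C :> C by apply/eqP; rewrite eq_complex /= oppr0 !eqxx.
  by rewrite /= rmorph1 rmorph0; ring.
have ii : 'i%C * 'i%C = -1 :> C by rewrite -expr2 sqr_i.
have half (x : C) (e : R) : 0 < e -> nc x <= 2 * e -> nc (2^-1 * x) <= e.
  by move=> e0 h; rewrite modulusM modulusV modulus_nat mulrC ler_pdivrMr // mulrC.
have ni : nc 'i%C = 1 :> R by rewrite /modulus normc_def /= expr0n expr1n add0r sqrtr1.
have t2 (x : C) : x = 2^-1 * (x + x) by rewrite mulrDr (mulrC 2^-1) -splitr.
split; apply/nullP => e e0; have [N0 H] := key _ e0; exists N0 => N /H[].
  set U := dz_sum N z; set V := dzbar_sum N z => h1 h2.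
  have -> : U - 2^-1 * (d.1 - 'i%C * d.2) =
    2^-1 * ((U + V - d.1) - 'i%C * ('i%C * (U - V) - d.2)).
    rewrite [X in X - _]t2 -mulrBr; congr (_ * _); rewrite mulrBr mulrA ii; ring.
  apply: half => //; rewrite (le_trans (modulusB _ _)) // modulusM ni; lra.
set U := dz_sum N z; set V := dzbar_sum N z => h1 h2.
have -> : V - 2^-1 * (d.1 + 'i%C * d.2) =
    2^-1 * ((U + V - d.1) + 'i%C * ('i%C * (U - V) - d.2)).
  rewrite [X in X - _]t2 -mulrBr; congr (_ * _); rewrite mulrBr mulrA ii; ring.
apply: half => //; rewrite (le_trans (modulusD _ _)) // modulusM ni; lra.
Qed.

End DerivativeExpansion.

(** * Strict positive definiteness *)

Section StrictPositivity.
Variable R : realType.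
Local Notation C := R[i].
Local Notation nc := (@modulus R).
Local Open Scope complex_scope.

(** Equality case of Cauchy-Schwarz; it ensures that distinct points have inner product different
    from 1, as [powers_separate] requires. *)
Lemma spheres_eq p (x y : 'rV[C]_p) : sphere x -> sphere y -> dotmx x y = 1 -> x = y.
Proof.
move=> x1 y1 xy; have : dotmx (x - y) (x - y) = 0.
  transitivity (dotmx x x - dotmx x y - dotmx y x + dotmx y y).
    rewrite !dotmx_sum -!sumrB -big_split; apply: eq_bigr => j _.
    by rewrite !mxE conjcB /=; ring.
  by rewrite x1 y1 -(dotmx_conj x y) xy conjc1; ring.
rewrite dotmx_sum => /eqP; rewrite psumr_eq0 => [/allP xy0|i _]; last exact: mulcJ_ge0.
apply/rowP => j; have := xy0 j (mem_index_enum j).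
by rewrite -sqr_modulus real_complex_eq0 sqrf_eq0 modulus_eq0 !mxE subr_eq0 => /eqP.
Qed.

(* Test against a polynomial equal to 1 at 1 and vanishing at the other values of [w]. *)
Lemma powers_separate l (w : 'I_l -> 'I_l -> C) (c : 'I_l -> C) :
  (forall mu, w mu mu = 1) -> (forall mu nu, mu != nu -> w mu nu != 1) ->
  (forall k, \sum_mu \sum_nu c mu * (c nu)^*%C * w mu nu ^+ k = 0) -> forall mu, c mu = 0.
Proof.
move=> w1 w_neq1 wk.
pose p : {poly C} := \prod_mu \prod_(nu | mu != nu) ('X - (w mu nu)%:P).
have p1 : p.[1] != 0.
  rewrite horner_prod; apply/prodf_neq0 => mu _; rewrite horner_prod; apply/prodf_neq0 => nu munu.
  by rewrite hornerXsubC subr_eq0 eq_sym w_neq1.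
have p0 mu nu : mu != nu -> p.[w mu nu] = 0.
  move=> munu; rewrite /p (bigD1 mu) //= (bigD1 nu) //= !hornerM hornerXsubC subrr.
  by rewrite !mul0r.
have : \sum_mu \sum_nu c mu * (c nu)^*%C * p.[w mu nu] = 0.
  under eq_bigr => mu _ do under eq_bigr => nu _ do rewrite horner_coef mulr_sumr.
  under eq_bigr => mu _ do rewrite exchange_big.
  rewrite exchange_big big1 // => k _ /=.
  transitivity (p`_k * (\sum_mu \sum_nu c mu * (c nu)^*%C * w mu nu ^+ k)); last by rewrite wk mulr0.
  by rewrite mulr_sumr; apply: eq_bigr => mu _; rewrite mulr_sumr; apply: eq_bigr => nu _; rewrite mulrCA.
have -> : \sum_mu \sum_nu c mu * (c nu)^*%C * p.[w mu nu] = (\sum_mu c mu * (c mu)^*%C) * p.[1].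
  rewrite mulr_suml; apply: eq_bigr => mu _; rewrite (bigD1 mu) //= w1 big1 ?addr0 // => nu.
  by rewrite eq_sym => /p0 ->; rewrite mulr0.
move=> /eqP; rewrite mulf_eq0 (negPf p1) orbF psumr_eq0 => [/allP c0 mu|i _]; last exact: mulcJ_ge0.
have := c0 mu (mem_index_enum mu).
by rewrite -sqr_modulus real_complex_eq0 sqrf_eq0 modulus_eq0 => /eqP.
Qed.

Definition gram p l (xi : 'I_l -> 'rV[C]_p) (c : 'I_l -> C) (g : C -> C) : C :=
  \sum_mu \sum_nu c mu * (c nu)^*%C * g (dotmx (xi mu) (xi nu)).

Lemma gram_sum p l (xi : 'I_l -> 'rV[C]_p) c N (B : nat -> nat -> C) (h : nat -> nat -> C -> C) :
  gram xi c (fun z => \sum_(m < N) \sum_(n < N) B m n * h m n z)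
  = \sum_(m < N) \sum_(n < N) B m n * gram xi c (h m n).
Proof.
rewrite /gram.
under eq_bigr => mu _ do under eq_bigr => nu _ do rewrite mulr_sumr.
under eq_bigr => mu _ do rewrite exchange_big.
rewrite exchange_big. apply: eq_bigr => m _ /=.
under eq_bigr => mu _ do under eq_bigr => nu _ do rewrite mulr_sumr.
under eq_bigr => mu _ do rewrite exchange_big.
rewrite exchange_big; apply: eq_bigr => n _ /=.
rewrite mulr_sumr; apply: eq_bigr => mu _; rewrite mulr_sumr; apply: eq_bigr => nu _.
exact: mulrCA.
Qed.

Section Series.
Variables (a : nat) (B : nat -> nat -> R) (h : nat -> nat -> C -> C) (g : C -> C).
Local Notation S := (@sphere R a.+2).
Hypothesis B0 : forall m n, 0 <= B m n.
Hypothesis hP : forall m n, positive_definite S (fun x y => h m n (dotmx x y)).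
Hypothesis gE : forall z, disc z ->
  null (fun N => \sum_(m < N) \sum_(n < N) (B m n)%:C * h m n z - g z).

(** All terms of the series have nonnegative forms, so one of them bounds the total from below. If
    the total vanishes, so does every term with positive coefficient. *)
Lemma gram_series_ge l (xi : 'I_l -> 'rV[C]_a.+2) c m n : (forall mu, S (xi mu)) ->
  (B m n)%:C * gram xi c (h m n) <= gram xi c g.
Proof.
move=> xiS; rewrite -subr_ge0; pose K := (maxn m n).+1.
pose T N := \sum_(m < N) \sum_(n < N) (B m n)%:C * gram xi c (h m n).
have h0 i j : 0 <= gram xi c (h i j) by exact: hP.
have Bh0 i j : 0 <= (B i j)%:C * gram xi c (h i j) by rewrite mulr_ge0 // ler0c.
apply: (@null_ge0 _ (fun N => T (N + K)%N - (B m n)%:C * gram xi c (h m n))).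
  have := unull_sum (index_enum 'I_l) (P := xpredT) (fun (mu : 'I_l) _ =>
    unull_sum (index_enum 'I_l) (P := xpredT) (fun (nu : 'I_l) _ =>
      unull_mul (ubounded_cst (fun _ : unit => True) (c mu * (c nu)^*%C))
       (gE (disc_dotmx (xiS mu) (xiS nu))))).
  move=> H e e0; have [N0 HN] := H e e0; exists N0 => N NN t _.
  have := HN (N + K)%N (leq_trans NN (leq_addr _ _)) tt I; congr (nc _ <= _).
  have gen (x y z : C) : x - y - (z - y) = x - z by ring.
  rewrite gen /T -(gram_sum xi c _ (fun m n => (B m n)%:C)) /gram -sumrB; apply: eq_bigr => mu _; rewrite -sumrB.
  by apply: eq_bigr => nu _; exact: mulrBr.
move=> N; rewrite subr_ge0 /T.
have mK : (m < N + K)%N by rewrite /K; lia.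
have nK : (n < N + K)%N by rewrite /K; lia.
rewrite (bigD1 (Ordinal mK)) //= (bigD1 (Ordinal nK)) //= -addrA lerDl.
by rewrite addr_ge0 ?sumr_ge0 // => i _; rewrite sumr_ge0.
Qed.

Lemma series_pd : positive_definite S (fun x y => g (dotmx x y)).
Proof.
move=> l xi c xiS; apply: le_trans (gram_series_ge c 0 0 xiS).
by rewrite mulr_ge0 ?ler0c //; exact: hP.
Qed.

(** The maps [im] and [jn] select terms that are pure powers of [w]. Leaving [w] abstract covers the
    inner product and its conjugate alike. *)
Lemma series_spd (w : forall l, ('I_l -> 'rV[C]_a.+2) -> 'I_l -> 'I_l -> C) (im jn : nat -> nat) :
  (forall k, 0 < B (im k) (jn k)) ->
  (forall k l (xi : 'I_l -> 'rV[C]_a.+2) mu nu,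
     h (im k) (jn k) (dotmx (xi mu) (xi nu)) = w l xi mu nu ^+ k) ->
  (forall l (xi : 'I_l -> 'rV[C]_a.+2) mu nu, S (xi mu) -> S (xi nu) ->
     w l xi mu nu = 1 <-> xi mu = xi nu) ->
  strictly_positive_definite S (fun x y => g (dotmx x y)).
Proof.
move=> Bk hk w1; split; first exact: series_pd.
move=> l xi c xiS inj_xi [mu0 c0]; have g0 := series_pd c xiS.
rewrite lt_neqAle g0 andbT eq_sym; apply: contra_neqN c0 => /eqP gc0.
apply: (powers_separate (w := w l xi)) => [mu|mu nu|k]; first exact/w1.
  by apply: contra_neq => /(w1 _ _ _ _ (xiS mu) (xiS nu))/inj_xi.
have := gram_series_ge c (im k) (jn k) xiS; rewrite [gram xi c g]gc0.
rewrite pmulr_rle0 ?ltcR // => hle0.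
have := hP (im k) (jn k) c xiS; rewrite -/(gram xi c _) => hge0.
have : gram xi c (h (im k) (jn k)) = 0 by apply/eqP; rewrite eq_le hle0.
apply: etrans; apply: eq_bigr => mu _; apply: eq_bigr => nu _.
by rewrite hk.
Qed.

End Series.
End StrictPositivity.

(** * Assembly for the three derivatives *)

Section Conclusion.
Variables (R : realType) (a : nat).
Local Notation C := R[i].
Local Notation nc := (@modulus R).
Local Open Scope complex_scope.
Local Open Scope classical_set_scope.
Local Notation Rp := (@disc_poly R a%:R).
Local Opaque disc_poly.
Variable f : cplx R -> cplx R.
Hypothesis hf : continuously_differentiable f.

Lemma Dz_continuous : {within disc (R := R), continuous (Dz f)}.
Proof.
have [_ cx cy] := hf; move=> z; apply: cvgM; first exact: cvg_cst.
by apply: cvgB; [exact: cx | apply: cvgM; [exact: cvg_cst | exact: cy]].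
Qed.

Lemma Dzbar_continuous : {within disc (R := R), continuous (Dzbar f)}.
Proof.
have [_ cx cy] := hf; move=> z; apply: cvgM; first exact: cvg_cst.
by apply: cvgD; [exact: cx | apply: cvgM; [exact: cvg_cst | exact: cy]].
Qed.

Lemma Dx_DzDzbar z : Dx f z = Dz f z + Dzbar f z.
Proof.
rewrite /Dz /Dzbar -mulrDr addrACA addNr addr0 mulrDr mulrC -splitr //.
Qed.

Lemma positive_definiteD p (g h k : C -> C) : (forall z, k z = g z + h z) ->
  positive_definite (@sphere R p) (fun x y => g (dotmx x y)) ->
  positive_definite (@sphere R p) (fun x y => h (dotmx x y)) ->
  positive_definite (@sphere R p) (fun x y => k (dotmx x y)).
Proof.
move=> kE gP hP l xi c xiS; have := addr_ge0 (gP l xi c xiS) (hP l xi c xiS).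
rewrite -big_split; congr (_ <= _); apply: eq_bigr => mu _ /=; rewrite -big_split.
by apply: eq_bigr => nu _ /=; rewrite -mulrDr -kE.
Qed.

Lemma strictly_positive_definiteD p (g h k : C -> C) : (forall z, k z = g z + h z) ->
  strictly_positive_definite (@sphere R p) (fun x y => g (dotmx x y)) ->
  positive_definite (@sphere R p) (fun x y => h (dotmx x y)) ->
  strictly_positive_definite (@sphere R p) (fun x y => k (dotmx x y)).
Proof.
move=> kE [gP gS] hP; split; first exact: positive_definiteD kE gP hP.
move=> l xi c xiS xi_inj c0.
have := ltr_wpDr (hP l xi c xiS) (gS l xi c xiS xi_inj c0).
rewrite -big_split; congr (_ < _); apply: eq_bigr => mu _ /=; rewrite -big_split.
by apply: eq_bigr => nu _ /=; rewrite -mulrDr -kE.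
Qed.

Variable A : nat -> nat -> R.
Hypothesis A0 : forall m n, 0 <= A m n.
Hypothesis fA : forall z, disc z ->
  null (fun N => \sum_(m < N) \sum_(n < N) (A m n)%:C * Rp m n z - f z).

(** Differentiability at the single point 1 supplies the bound on the slopes; differentiability at
    [z] identifies the limits. *)
Lemma wirtinger_expansion z : disc z ->
  null (fun N => dz_sum a A N z - Dz f z) /\ null (fun N => dzbar_sum a A N z - Dzbar f z).
Proof.
have [fd _ _] := hf; move=> Dz0.
have D1 : disc (1 : C) by rewrite /disc /= normr1.
have [d1 fd1] := fd 1 D1; have [d fdz] := fd z Dz0.
have := wirtinger_sum_cvg A0 fA (ex_intro _ _ (slope_sum_bounded A0 fA fd1)) Dz0 fdz.
by rewrite /Dz /Dzbar /Dx /Dy (partialsE Dz0 fdz).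
Qed.

Let Bz m n := A m n * dz_coef R a m n.
Let Bzbar m n := A m n * dzbar_coef R a m n.
Let hz m n := @disc_poly R a.+1%:R m.-1 n.
Let hzbar m n := @disc_poly R a.+1%:R m n.-1.

Let Bz0 m n : 0 <= Bz m n. Proof. by rewrite mulr_ge0 ?A0 ?dz_coef_ge0. Qed.
Let Bzbar0 m n : 0 <= Bzbar m n. Proof. by rewrite mulr_ge0 ?A0 ?dzbar_coef_ge0. Qed.

Lemma Dz_pd : positive_definite (@sphere R a.+3) (fun x y => Dz f (dotmx x y)).
Proof.
apply: (@series_pd R a.+1 Bz hz) => // [m n|z Dz0]; first exact: disc_poly_pd.
exact: (wirtinger_expansion Dz0).1.
Qed.

Lemma Dzbar_pd : positive_definite (@sphere R a.+3) (fun x y => Dzbar f (dotmx x y)).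
Proof.
apply: (@series_pd R a.+1 Bzbar hzbar) => // [m n|z Dz0]; first exact: disc_poly_pd.
exact: (wirtinger_expansion Dz0).2.
Qed.

Hypothesis A_gt0 : forall m n, 0 < A m n.

(** The index [(k.+1, 0)] is used: differentiation in [z] turns it into the disc polynomial [z^k],
    with a positive factor. The exponent [k = 0] is therefore included. *)
Lemma Dz_spd : strictly_positive_definite (@sphere R a.+3) (fun x y => Dz f (dotmx x y)).
Proof.
apply: (@series_spd R a.+1 Bz hz (Dz f) _ _ _ (fun l xi mu nu => dotmx (xi mu) (xi nu)) succn (fun=> 0%N)); first exact: Bz0.
- by move=> m n; exact: disc_poly_pd.
- by move=> z Dz0; exact: (wirtinger_expansion Dz0).1.
- by move=> k; rewrite mulr_gt0 // /dz_coef divr_gt0 ?mulr_gt0 ?ltr0Sn.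
- by move=> k l xi mu nu; rewrite /hz disc_polyX0.
- move=> l xi mu nu xi1 xi2; split=> [|->]; first exact: spheres_eq.
  exact: xi2.
Qed.

Lemma Dzbar_spd : strictly_positive_definite (@sphere R a.+3) (fun x y => Dzbar f (dotmx x y)).
Proof.
apply: (@series_spd R a.+1 Bzbar hzbar (Dzbar f) _ _ _
  (fun l xi mu nu => dotmx (xi nu) (xi mu)) (fun=> 0%N) succn); first exact: Bzbar0.
- by move=> m n; exact: disc_poly_pd.
- by move=> z Dz0; exact: (wirtinger_expansion Dz0).2.
- by move=> k; rewrite mulr_gt0 // /dzbar_coef divr_gt0 ?mulr_gt0 ?ltr0Sn.
- by move=> k l xi mu nu; rewrite /hzbar disc_poly0X dotmx_conj.
- move=> l xi mu nu xi1 xi2; split=> [h|->]; first exact/esym/spheres_eq.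
  exact: xi2.
Qed.

End Conclusion.

Lemma schoenberg_coeffs_null (R : realType) (a : nat) (f : cplx R -> cplx R) (A : nat -> nat -> R) :
  schoenberg_coeffs a.+2 f A -> forall z, disc z ->
  null (fun N => \sum_(m < N) \sum_(n < N) (A m n)%:C%C * disc_poly a%:R m n z - f z).
Proof.
move=> [_ _ fA] z Dz; apply/nullP => e e0; have ec : 0 < e%:C%C :> cplx R by rewrite ltcR.
pose u (N : nat) : cplx R := \sum_(m < N) \sum_(n < N) (A m n)%:C%C * disc_poly (a.+2 - 2)%:R m n z.
have /(cvgrPdist_le (V := cplx R))/(_ _ ec)[N _ HN] : (u n @[n --> \oo] --> f z)%classic := fA z Dz.
exists N => L /HN /=; rewrite /u subSS subn1 /= => h.
by rewrite modulusBC -le_modulus.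
Qed.

Theorem theorem1p1 (R : realType) (q : nat) (f : cplx R -> cplx R)
    (hq : (2 <= q)%N) (hf : continuously_differentiable f) :
  (Psi q f ->
     [/\ Psi q.+1 (Dz f), Psi q.+1 (Dzbar f) & Psi q.+1 (Dx f)]) /\
  (forall a : nat -> nat -> R,
     Psi q f -> schoenberg_coeffs q f a -> (forall m n, 0 < a m n) ->
     [/\ Psi_plus q.+1 (Dz f), Psi_plus q.+1 (Dzbar f)
       & Psi_plus q.+1 (Dx f)]).
Proof.
case: q hq => [|[|a]] // _; have [_ cx _] := hf.
have cz := Dz_continuous hf; have czbar := Dzbar_continuous hf.
(* The first part constructs coefficients from [f]; the second differentiates the given expansion.
   In both, [Dx f] is the sum of the two Wirtinger derivatives. *)
split=> [[fc fP]|A _ fA A_gt0].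
  have A0 := schoenberg_ge0 fc fP; have fA := schoenberg_cvg fc fP.
  have Pz := Dz_pd hf A0 fA; have Pzbar := Dzbar_pd hf A0 fA.
  by split; split => //; exact: positive_definiteD (Dx_DzDzbar f) Pz Pzbar.
have A0 m n := ltW (A_gt0 m n); have {}fA := schoenberg_coeffs_null fA.
have Pz := Dz_spd hf A0 fA A_gt0; have Pzbar := Dzbar_spd hf A0 fA A_gt0.
by split; split => //; exact: strictly_positive_definiteD (Dx_DzDzbar f) Pz Pzbar.1.
Qed.
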